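(* Let $h\in[1,n]$ and $R\in\mathbb N$. (a) Let $A,B\in\Xi_d$ with $B-RE^\theta_{h,h+1}$ diagonal and $\mathrm{ro}(A)=\mathrm{co}(B)$. Then $$[B]*[A]=\sum_t v^{\beta(t)}\prod_{u=1}^N\overline{\begin{bmatrix}a_{hu}+t_u\\ t_u\end{bmatrix}}\Big[A+\sum_{u=1}^N t_u(E^\theta_{hu}-E^\theta_{h+1,u})\Big],$$ where $t=(t_1,\dots,t_N)$ runs over $\mathbb N^N$ with $\sum_u t_u=R$ and, for all $u$, $t_u\le a_{h+1,u}$ if $h<n$, respectively $t_u+t_{N+1-u}\le a_{h+1,u}$ if $h=n$, and $$\beta(t)=\sum_{j\le l}a_{hl}t_j-\sum_{j<l}a_{h+1,l}t_j+\sum_{j<l}t_jt_l+\delta_{h,n}\Big(\sum_{j<l,\;j+l<N+1}t_jt_l+\sum_{j<n+1}\frac{t_j(t_j+1)}2\Big).$$ (b) Let $A,C\in\Xi_d$ with $C-RE^\theta_{h+1,h}$ diagonal and $\mathrm{co}(C)=\mathrm{ro}(A)$. Below $t$ runs over $t\in\mathbb N^N$ with $\sum_ut_u=R$ and $t_u\le a_{hu}$ for all $u$. If $h<n$, then $$[C]*[A]=\sum_t v^{\beta'(t)}\prod_{u=1}^N\overline{\begin{bmatrix}a_{h+1,u}+t_u\\ t_u\end{bmatrix}}\Big[A-\sum_{u=1}^N t_u(E^\theta_{hu}-E^\theta_{h+1,u})\Big],$$ $$\beta'(t)=\sum_{j\ge l}a_{h+1,l}t_j-\sum_{j>l}a_{hl}t_j+\sum_{j>l}t_jt_l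 .$$ If $h=n$, then $$[C]*[A]=\sum_t v^{\beta''(t)}\prod_{u<n+1}\overline{\begin{bmatrix}a_{n+1,u}+t_u+t_{N+1-u}\\ t_u\end{bmatrix}}\prod_{u>n+1}\overline{\begin{bmatrix}a_{n+1,u}+t_u\\ t_u\end{bmatrix}}\cdot\prod_{i=0}^{t_{n+1}-1}\frac{\overline{[a_{n+1,n+1}+1+2i]}}{\overline{[i+1]}}\Big[A-\sum_{u=1}^N t_u(E^\theta_{nu}-E^\theta_{n+1,u})\Big],$$ $$\beta''(t)=\sum_{j\ge l}a_{n+1,l}t_j-\sum_{j>l}a_{nl}t_j+\sum_{j>l}t_jt_l-\sum_{j<l,\;j+l<N+1}t_jt_l-\sum_{j<n+1}\frac{t_j(t_j-1)}2+\frac{R(R-1)}2 .$$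
   Context: Let $\mathcal A=\mathbb Z[v,v^{-1}]$, $n,d\ge1$, $N=2n+1$, $D=2d+1$; $[a,b]$ denotes the set of integers from $a$ to $b$, $\mathbb N=\{0,1,2,\dots\}$, and $|U|=\dim U$. For an odd prime power $q$ equip $\mathbb F_q^D$ with a nondegenerate symmetric bilinear form with isometry group $O(D)$, and let $X$ be the set of flags $V=(0=V_0\subseteq V_1\subseteq\cdots\subseteq V_N=\mathbb F_q^D)$ with $V_i=V_{N-i}^\perp$ for all $i$. Let $\Xi_d$ be the set of $N\times N$ matrices $A=(a_{ij})$ over $\mathbb N$ with $\sum a_{ij}=D$ and $a_{ij}=a_{N+1-i,N+1-j}$ (so $a_{n+1,n+1}$ is odd). The $O(D)$-orbits $\mathcal O_A$ on $X\times X$ are indexed by $A\in\Xi_d$: $(V,V')\in\mathcal O_A$ iff $a_{ij}=|(V_{i-1}+V_i\cap V'_j)/(V_{i-1}+V_i\cap V'_{j-1})|$ for all $i,j$. $\mathbf S^{\jmath}$ is the free $\mathcal A$-module with basis $e_A$ ($A\in\Xi_d$), $e_A$ being the characteristic function of $\mathcal O_A$, with product $e_A*e_{A'}=\sum_{A''}g_{A,A',A''}e_{A''}$, where $g_{A,A',A''}\in\mathbb Z[v^2]$ is the polynomial whose value at $v=\sqrt q$, for every odd prime power $q$, is the number of $V\in X$ with $(V_1,V)\in\mathcal O_A$, $(V,V_2)\in\mathcal O_{A'}$, for any fixed $(V_1,V_2)\in\mathcal O_{A''}$. Standard basis: $[A]=v^{-d_A}e_A$, where $d_A$ is the dimension (over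 $\overline{\mathbb F}_q$) of $\mathcal O_A$ minus the dimension of its image under the first projection $X\times X\to X$; explicitly $$d_A=\sum_{i>k,\,j<l,\,i+k<N+1}a_{ij}a_{kl}+\sum_{j<l,\ (i<n+1\text{ or }j<N+1-l)}a_{ij}a_{il}+\sum_{i\ge n+1>j}\frac{a_{ij}(a_{ij}-1)}2 .$$ $\mathrm{ro}(A)$, $\mathrm{co}(A)$ are the vectors of row sums and column sums of $A$. $E_{ij}$ is the elementary matrix and $E^\theta_{ij}=E_{ij}+E_{N+1-i,N+1-j}$. For $a\in\mathbb Z$, $b\in\mathbb N$: $\begin{bmatrix} a \\ b \end{bmatrix}=\prod_{i=1}^b\frac{v^{2(a-i+1)}-1}{v^{2i}-1}$ and $[a]=\begin{bmatrix} a \\ 1 \end{bmatrix}$ for an integer $a$; the overline on scalars denotes $v\mapsto v^{-1}$. *)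

(* Defs.v *)
From HB Require Import structures.
From mathcomp Require Import all_boot all_order all_algebra.
From mathcomp Require Import generic_quotient boolp classical_sets.

Set Implicit Arguments.
Unset Strict Implicit.
Unset Printing Implicit Defensive.

Import Order.TTheory GRing.Theory Num.Theory.
Local Open Scope ring_scope.

(* Q(v), as the field of fractions of Z[v]; the ring A = Z[v, v^-1] is its
   subring [laurent] below. *)
Definition Qv := {fraction {poly int}}.
HB.instance Definition _ := GRing.Field.on Qv.

Definition vv : Qv := FracField.tofrac 'X.

Lemma vv_neq0 : vv != 0.
Proof. by rewrite /vv tofrac_eq0 polyX_eq0. Qed.

(* [bar] is the field automorphism of Q(v) with v |-> v^-1: a fraction
   p(v) / r(v) is sent to p(v^-1) / r(v^-1). *)
Definition eval_vinv (p : {poly int}) : Qv := (map_poly intr p).[vv^-1].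
Definition bar (x : Qv) : Qv :=
  eval_vinv \n_(repr x) / eval_vinv \d_(repr x).

Definition qbinom (a : int) (b : nat) : Qv :=
  \prod_(1 <= i < b.+1)
    ((vv ^ (2 * (a - i%:Z + 1)) - 1) / (vv ^+ (2 * i) - 1)).
Definition qint (a : int) : Qv := qbinom a 1.

Definition is_laurent : {pred Qv} := fun x =>
  `[< exists (p : {poly int}) (k : nat), x = FracField.tofrac p / vv ^+ k >].

Fact is_laurent_subring : subring_closed is_laurent.
Proof.
have vX k : vv ^+ k != 0 by rewrite expf_neq0 // vv_neq0.
have vXE k : vv ^+ k = FracField.tofrac 'X^k by rewrite rmorphXn.
split; first by apply/asboolP; exists 1, 0%N; rewrite rmorph1 expr0 divr1.
  move=> _ _ /asboolP[p [k ->]] /asboolP[r [l ->]]; apply/asboolP.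
  exists (p * 'X^l - r * 'X^k), (k + l)%N.
  rewrite rmorphB !rmorphM /= -!vXE exprD.
  rewrite mulrBl !invfM; congr (_ - _).
    by rewrite mulrACA divff // mulr1.
  by rewrite [X in _ * _ * X]mulrC mulrACA divff // mulr1.
move=> _ _ /asboolP[p [k ->]] /asboolP[r [l ->]]; apply/asboolP.
by exists (p * r), (k + l)%N; rewrite rmorphM /= exprD invfM mulrACA.
Qed.
HB.instance Definition _ :=
  GRing.isSubringClosed.Build Qv is_laurent is_laurent_subring.

Record laurent := Laurent {laurent_val :> Qv; _ : laurent_val \in is_laurent}.
HB.instance Definition _ := [isSub for laurent_val].
HB.instance Definition _ := [Choice of laurent by <:].
HB.instance Definition _ := [SubChoice_isSubComNzRing of laurent by <:].

Fact vpow_laurent (k : int) : vv ^ k \in is_laurent.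
Proof.
apply/asboolP; case: k => k.
  by exists 'X^k, 0%N; rewrite rmorphXn expr0 divr1.
by exists 1, k.+1; rewrite rmorph1 mul1r NegzE -exprnN.
Qed.
Definition vpow (k : int) : laurent := Laurent (vpow_laurent k).

(* Matrices are indexed by 'I_N with N = 2n + 1, whose elements have values
   0, ..., 2n.  [pos i] is the 1-based position of i, [idx k] the index with
   1-based position k, and N + 1 - i is [rev_ord i]. *)
Definition dimN (n : nat) : nat := n.*2.+1.
Definition pos n (i : 'I_(dimN n)) : nat := i.+1.
Definition idx n (k : nat) : 'I_(dimN n) := @inord n.*2 k.-1.

(* The entries of a matrix over N with sum D are at most D, hence the finite
   type of entries. *)
Record Xi n d := MkXi {
  xi_mx : 'M['I_(dimN d).+1]_(dimN n);
  _ : ((\sum_i \sum_j (xi_mx i j : nat))%N == dimN d) &&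
      [forall i, forall j, xi_mx i j == xi_mx (rev_ord i) (rev_ord j)] }.
HB.instance Definition _ n d := [isSub for @xi_mx n d].
HB.instance Definition _ n d := [Finite of Xi n d by <:].

Definition entry n d (A : Xi n d) (i j : 'I_(dimN n)) : nat := xi_mx A i j.
Coercion entry : Xi >-> Funclass.

Definition mxZ n d (A : Xi n d) : 'M[int]_(dimN n) :=
  \matrix_(i, j) (A i j)%:Z.

Definition ro n d (A : Xi n d) : {ffun 'I_(dimN n) -> nat} :=
  [ffun i => \sum_j A i j]%N.
Definition co n d (A : Xi n d) : {ffun 'I_(dimN n) -> nat} :=
  [ffun j => \sum_i A i j]%N.

Definition Etheta n (i j : 'I_(dimN n)) : 'M[int]_(dimN n) :=
  delta_mx i j + delta_mx (rev_ord i) (rev_ord j).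

Section FiniteVspace.
Import VectorInternalTheory.
Variables (F : finFieldType) (vT : vectType F).
HB.instance Definition _ := [Countable of {vspace vT} by <:].
HB.instance Definition _ := [Finite of {vspace vT} by <:].
End FiniteVspace.

Section Flags.

Variables (n d : nat) (F : finFieldType).
Let vT := 'rV[F]_(dimN d).

Definition chain := {ffun 'I_(dimN n).+1 -> {vspace vT}}.
Definition step (V : chain) (i : nat) : {vspace vT} := V (inord i).

Definition flags (f : {symmetric vT}) : {set chain} :=
  [set V : chain |
    [&& step V 0 == 0%VS, step V (dimN n) == fullv,
        [forall i : 'I_(dimN n), (step V i <= step V i.+1)%VS] &
        [forall i : 'I_(dimN n).+1,
          step V i == orthov f (step V (dimN n - i))]]].

(* The difference of dimensions is the dimension of the quotient, since the
   subtracted space is contained in the other one. *)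
Definition rel_pos (V V' : chain) (i j : 'I_(dimN n)) : nat :=
  (\dim (step V (pos i).-1 + (step V (pos i) :&: step V' (pos j)))%VS
   - \dim (step V (pos i).-1 + (step V (pos i) :&: step V' (pos j).-1))%VS)%N.

Definition in_orbit_of (A : Xi n d) (V V' : chain) : bool :=
  [forall i, forall j, A i j == rel_pos V V' i j].

End Flags.

(* [G] is the structure polynomial g_{A,A',A''} written in the variable v^2,
   so that its value at v = sqrt q is [G.[q]]. *)
Definition is_struct_poly n d (A A' A'' : Xi n d) (G : {poly int}) : Prop :=
  forall (F : finFieldType) (f : {symmetric 'rV[F]_(dimN d)}),
    odd #|F| -> nondegenerate f ->
  forall V1 V2 : chain n d F, V1 \in flags n f -> V2 \in flags n f ->
    in_orbit_of A'' V1 V2 ->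
  G.[#|F|%:Z] =
    #|[set V in flags n f | in_orbit_of A V1 V && in_orbit_of A' V V2]|%:Z.

(* "The" polynomial is taken by definite description; the default value 0 would
   only be used if no such polynomial existed. *)
Definition struct_poly n d (A A' A'' : Xi n d) : {poly int} :=
  xget 0 [set G | is_struct_poly A A' A'' G]%classic.

Definition struct_const n d (A A' A'' : Xi n d) : laurent :=
  (map_poly intr (struct_poly A A' A'')).[vpow 2].

Definition Sj n d := {ffun Xi n d -> laurent^o}.
HB.instance Definition _ n d := GRing.Lmodule.on (Sj n d).

Definition ebasis n d (A : Xi n d) : Sj n d := [ffun C => (C == A)%:R].

Definition Sj_mul n d (x y : Sj n d) : Sj n d :=
  \sum_(A : Xi n d) \sum_(A' : Xi n d)
    ((x A : laurent) * (y A' : laurent)) *: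
      (\sum_(A'' : Xi n d) struct_const A A' A'' *: ebasis A'').

Definition dA n d (A : Xi n d) : nat :=
  (\sum_i \sum_j \sum_k \sum_(l | [&& pos k < pos i, pos j < pos l
                                    & pos i + pos k < (dimN n).+1])
      A i j * A k l
   + \sum_i \sum_j \sum_(l | (pos j < pos l) &&
        ((pos i < n.+1) || (pos j < (dimN n).+1 - pos l))) A i j * A i l
   + \sum_(i | n.+1 <= pos i) \sum_(j | pos j < n.+1)
       (A i j * (A i j).-1) %/ 2)%N.

Definition std n d (A : Xi n d) : Sj n d := vpow (- (dA A)%:Z) *: ebasis A.

(* The standard basis element [M] for an integer matrix M, which is the unique
   term of the sum if M belongs to Xi_d. *)
Definition std_mx n d (M : 'M[int]_(dimN n)) : Sj n d :=
  \sum_(A : Xi n d | mxZ A == M) std A.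

(* Vectors t in N^N with sum R have entries at most R. *)
Definition tvec n R := {ffun 'I_(dimN n) -> 'I_R.+1}.

Definition sum_is n R (t : tvec n R) : bool :=
  (\sum_u (t u : nat))%N == R.

Definition shift n R (h : nat) (t : tvec n R) : 'M[int]_(dimN n) :=
  \sum_u (Etheta (idx n h) u - Etheta (idx n h.+1) u) *+ t u.

Definition range_a n d R (h : nat) (A : Xi n d) (t : tvec n R) : bool :=
  sum_is t &&
  (if (h < n)%N then [forall u, (t u <= A (idx n h.+1) u)%N]
   else [forall u, (t u + t (rev_ord u) <= A (idx n h.+1) u)%N]).

Definition range_b n d R (h : nat) (A : Xi n d) (t : tvec n R) : bool :=
  sum_is t && [forall u, (t u <= A (idx n h) u)%N].

Section Exponents.

Variables (n d R h : nat) (A : Xi n d) (t : tvec n R).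

Let a (k : nat) (u : 'I_(dimN n)) : int := (A (idx n k) u)%:Z.
Let s (u : 'I_(dimN n)) : int := (t u : nat)%:Z.

Definition beta : int :=
  \sum_j \sum_(l | (pos j <= pos l)%N) a h l * s j
  - \sum_j \sum_(l | (pos j < pos l)%N) a h.+1 l * s j
  + \sum_j \sum_(l | (pos j < pos l)%N) s j * s l
  + (h == n)%:Z *
    (\sum_j \sum_(l | (pos j < pos l)%N && (pos j + pos l < (dimN n).+1)%N)
        s j * s l
     + \sum_(j | (pos j < n.+1)%N) ((t j * (t j).+1) %/ 2)%N%:Z).

Definition beta' : int :=
  \sum_j \sum_(l | (pos l <= pos j)%N) a h.+1 l * s j
  - \sum_j \sum_(l | (pos l < pos j)%N) a h l * s j
  + \sum_j \sum_(l | (pos l < pos j)%N) s j * s l.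

Definition beta'' : int :=
  \sum_j \sum_(l | (pos l <= pos j)%N) a n.+1 l * s j
  - \sum_j \sum_(l | (pos l < pos j)%N) a n l * s j
  + \sum_j \sum_(l | (pos l < pos j)%N) s j * s l
  - \sum_j \sum_(l | (pos j < pos l)%N && (pos j + pos l < (dimN n).+1)%N)
      s j * s l
  - \sum_(j | (pos j < n.+1)%N) ((t j * (t j).-1) %/ 2)%N%:Z
  + ((R * R.-1) %/ 2)%N%:Z.

End Exponents.

(* Main.v *)
(* If (V, V') lies in O_B with B - R E^theta_{h,h+1} diagonal, then V and V' have
   the same i-th term for all i <= n except i = h, so V' is determined by the
   subspace W = V'_h, and the orbit of (V', V'') is read off from the dimensions of
   the W :&: V''_j.  Hence the structure constant counts the W between V_{h-1}
   and V_h (for C: between V_h and V_{h+1}, isotropic if h = n) with prescribed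
   dim (W :&: V''_j).  Adding one vector to W at a time gives these counts in
   closed form, as products of Gaussian binomials, with an additional factor for
   isotropic vectors in an odd-dimensional quadratic space.  The powers of v
   are compared through 2 d_A = sum_{k <= i, j < l} a_ij a_kl
   - sum_{i >= n+1 > j} a_ij, a quadratic expression in A.  A structure polynomial
   is determined by its values because every orbit is nonempty over each F_p with
   p odd. *)

From HB Require Import structures.
Require Import Defs.
From mathcomp Require Import all_boot all_order all_algebra.
From mathcomp Require Import generic_quotient zify ring.
From mathcomp Require Import finfield.
From mathcomp Require classical_sets.

Set Implicit Arguments.
Unset Strict Implicit.
Unset Printing Implicit Defensive.

Import Order.TTheory GRing.Theory Num.Theory.
Local Open Scope ring_scope.

(** * Gaussian binomials and the bar involution *)

(** The counts go by induction on [\sum_u t u]. Let [j] be the least index with [t j > 0], and count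
    pairs of a subspace [W] and a vector of [W] in [P + G j.+1] outside [P + G j]: every [W]
    contains [q ^ \dim P * (q ^ t j - 1)] such vectors, and adjoining one of them to [P] lowers
    [t j] by one. The closed forms obey the same recurrence by the absorption identity of Gaussian
    binomials, so no sum is ever evaluated. In the isotropic case the admissible vectors form the
    difference of two sets of isotropic vectors, each taken in a space that is isotropic or contains
    its orthogonal; in the second case a fraction [1/q] of all vectors is isotropic, because [D] is
    odd. For the powers of v the form 2 d_A is polarised. Adding a shift to [A] changes it by a part
    linear and a part quadratic in [t]. As [B] and [C] are shifts of diagonal matrices, on which the
    form vanishes, the same formula yields d_B, d_C and the dimensions on the right-hand side. The
    terms with delta_{h,n} appear because row n+1 is its own mirror image. *)

Fixpoint gaussp (m k : nat) {struct m} : {poly int} :=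
  match m, k with
  | _, 0 => 1
  | 0, _.+1 => 0
  | m'.+1, k'.+1 => gaussp m' k' + 'X^k * gaussp m' k
  end.

Lemma gaussp0 m : gaussp m 0 = 1.
Proof. by case: m. Qed.

Lemma gaussp_prod m k :
  gaussp m k * \prod_(i < k) ('X^(i.+1) - 1) = \prod_(i < k) ('X^(m - i) - 1).
Proof.
elim: m k => [|m IHm] [|k]; rewrite ?gaussp0 ?big_ord0 ?mulr1 //.
  by rewrite mul0r big_ord_recl subnn expr0 subrr mul0r.
have prod_last : \prod_(i < k.+1) ('X^(i.+1) - 1) =
    \prod_(i < k) ('X^(i.+1) - 1) * ('X^(k.+1) - 1) :> {poly int}.
  by rewrite big_ord_recr.
have rhs : \prod_(i < k.+1) ('X^(m.+1 - i) - 1) =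
    ('X^(m.+1) - 1) * \prod_(i < k) ('X^(m - i) - 1) :> {poly int}.
  by rewrite big_ord_recl subn0.
rewrite [LHS]mulrDl {1}prod_last mulrA IHm -mulrA IHm rhs big_ord_recr /=.
(* For [k > m] the product over [i < k] contains the factor ['X^(m - m) - 1 = 0]. *)
have [k_le_m|k_gt_m] := leqP k m; last first.
  rewrite (bigD1 (Ordinal k_gt_m)) //= subnn expr0 subrr mul0r.
  by rewrite !mul0r !mulr0 add0r.
have -> : 'X^(m.+1) = 'X^(k.+1) * 'X^(m - k) :> {poly int}.
  by rewrite -exprD addSn subnKC.
ring.
Qed.

Arguments gaussp : simpl never.

Lemma Xn_sub1_neq0 k : (0 < k)%N -> 'X^k - 1 != 0 :> {poly int}.
Proof. by move=> k_gt0; rewrite monic_neq0 // monicXnsubC. Qed.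

Lemma prod_Xn_sub1_neq0 k : \prod_(i < k) ('X^(i.+1) - 1) != 0 :> {poly int}.
Proof. by apply/prodf_neq0 => i _; apply: Xn_sub1_neq0. Qed.

Lemma gaussp_absorb m k :
  gaussp m.+1 k.+1 * ('X^(k.+1) - 1) = ('X^(m.+1) - 1) * gaussp m k.
Proof.
apply: (mulIf (prod_Xn_sub1_neq0 k)).
rewrite -!mulrA gaussp_prod [_ * \prod_(i < k) _]mulrC.
have := gaussp_prod m.+1 k.+1; rewrite big_ord_recr /= => ->.
by rewrite big_ord_recl subn0.
Qed.

(** Multiplied by both denominators, each side becomes the product of all ['X^(i.+1) - 1] with
    [i < m + k]. Part (a) uses this: there the subspaces counted have the entries a_hu as graded
    dimensions, not the t_u. *)
Lemma gaussp_sym m k : gaussp (m + k) m = gaussp (m + k) k.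
Proof.
apply: (mulIf (prod_Xn_sub1_neq0 m)); apply: (mulIf (prod_Xn_sub1_neq0 k)).
rewrite gaussp_prod [RHS]mulrAC gaussp_prod.
have prod_rev (a b : nat) : \prod_(i < a) ('X^(a + b - i) - 1) *
    \prod_(i < b) ('X^(i.+1) - 1) = \prod_(i < a + b) ('X^(i.+1) - 1) :> {poly int}.
  rewrite [RHS](reindex_inj rev_ord_inj) big_split_ord /=; congr (_ * _).
    by apply: eq_bigr => i _; congr ('X^_ - 1); case: i => /= *; lia.
  rewrite (reindex_inj rev_ord_inj); apply: eq_bigr => i _.
  by congr ('X^_ - 1); case: i => /= *; lia.
by rewrite prod_rev (addnC m) prod_rev.
Qed.

(* For [a = 2b - 1], the quotient of the product of the ['X^(a+1+2i) - 1] by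
   the product of the ['X^(i.+1) - 1], i < t; the second factor comes from
   ['X^(2(b+i)) - 1 = ('X^(b+i) - 1) * ('X^(b+i) + 1)]. *)
Definition isotropicp (a t : nat) : {poly int} :=
  gaussp (a.+1./2 + t).-1 t * \prod_(i < t) ('X^(a.+1./2 + i) + 1).

Lemma isotropicp0 a : isotropicp a 0 = 1.
Proof. by rewrite /isotropicp gaussp0 big_ord0 mulr1. Qed.

Lemma isotropicp_absorb a t : odd a ->
  isotropicp a t.+1 * ('X^(t.+1) - 1) = ('X^(a + t.*2.+1) - 1) * isotropicp a t.
Proof.
move=> a_odd; rewrite /isotropicp.
have [b b2] : exists b, a = b.*2.+1.
  by exists a./2; rewrite -[LHS]odd_double_half a_odd.
have -> : a.+1./2 = b.+1 by lia.
rewrite big_ord_recr /=.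
rewrite addnS.
rewrite mulrAC [gaussp _ t.+1 * _]gaussp_absorb.
have -> : 'X^(a + t.*2.+1) - 1 =
    ('X^((b + t).+1) - 1) * ('X^((b + t).+1) + 1) :> {poly int}.
  rewrite mulrDr mulrBl mulr1 mul1r -exprD.
  have -> : (a + t.*2.+1 = (b + t).+1 + (b + t).+1)%N by lia.
  ring.
rewrite addSn; ring.
Qed.

Definition polyv2 (G : {poly int}) : Qv := (map_poly intr G).[vv ^+ 2].

Lemma polyv2_is_monoid_morphism : monoid_morphism polyv2.
Proof.
by split=> [|p r]; rewrite /polyv2 ?rmorph1 ?hornerC // rmorphM hornerM.
Qed.
Lemma polyv2_is_zmod_morphism : zmod_morphism polyv2.
Proof. by move=> p r; rewrite /polyv2 rmorphB !hornerE. Qed.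
HB.instance Definition _ :=
  GRing.isZmodMorphism.Build {poly int} Qv polyv2 polyv2_is_zmod_morphism.
HB.instance Definition _ :=
  GRing.isMonoidMorphism.Build {poly int} Qv polyv2 polyv2_is_monoid_morphism.

Lemma polyv2Xn k : polyv2 'X^k = vv ^+ (2 * k).
Proof. by rewrite /polyv2 map_polyXn hornerXn exprM. Qed.

Lemma polyv2Xn_sub1 k : polyv2 ('X^k - 1) = vv ^+ (2 * k) - 1.
Proof. by rewrite (rmorphB polyv2) (rmorph1 polyv2) /= polyv2Xn. Qed.

Lemma laurent_val_horner (G : {poly int}) :
  laurent_val (map_poly intr G).[vpow 2] = polyv2 G.
Proof.
rewrite /polyv2 -[laurent_val _]/(val _) -horner_map; congr _.[_].
by apply/polyP => i; rewrite !coef_map /= -[laurent_val _]/(val _) rmorph_int.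
Qed.

Lemma vv_exprz (k : nat) : vv ^+ k = FracField.tofrac 'X^k :> Qv.
Proof. by rewrite /vv rmorphXn. Qed.

Lemma vv_sub1_neq0 k : (0 < k)%N -> vv ^+ k - 1 != 0.
Proof.
move=> k_gt0; rewrite vv_exprz -tofrac1 -tofracB tofrac_eq0.
exact: Xn_sub1_neq0.
Qed.

Lemma eval_vinv_is_monoid_morphism : monoid_morphism eval_vinv.
Proof.
by split=> [|p r]; rewrite /eval_vinv ?rmorph1 ?hornerC // rmorphM hornerM.
Qed.
Lemma eval_vinv_is_zmod_morphism : zmod_morphism eval_vinv.
Proof. by move=> p r; rewrite /eval_vinv rmorphB !hornerE. Qed.
HB.instance Definition _ :=
  GRing.isZmodMorphism.Build {poly int} Qv eval_vinv eval_vinv_is_zmod_morphism.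
HB.instance Definition _ :=
  GRing.isMonoidMorphism.Build {poly int} Qv eval_vinv
    eval_vinv_is_monoid_morphism.

Lemma eval_vinvXn k : eval_vinv 'X^k = vv ^- k.
Proof. by rewrite /eval_vinv map_polyXn hornerXn exprVn. Qed.

(** Multiplying p(v^-1) by [vv ^+ size p] gives v times the polynomial with reversed coefficients,
    so its vanishing kills every coefficient. Hence denominators stay nonzero under [eval_vinv]. *)
Lemma eval_vinv_eq0 p : (eval_vinv p == 0) = (p == 0).
Proof.
apply/eqP/eqP => [p_eq0|->]; last by rewrite rmorph0.
have tofrac_int (z : int) : FracField.tofrac z%:P = z%:~R :> Qv.
  by rewrite -[z in LHS]intz !rmorph_int.
have : FracField.tofrac (\poly_(i < size p) p`_(size p - i.+1)) * vv = 0 :> Qv.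
  rewrite -(mulr0 (vv ^+ size p)) -p_eq0 poly_def rmorph_sum /=.
  rewrite mulr_suml /eval_vinv (horner_coef_wide _ (size_poly _ _)) mulr_sumr.
  rewrite (reindex_inj rev_ord_inj); apply: eq_bigr => i _ /=.
  have le_i : (i <= size p)%N by apply: ltnW.
  rewrite coef_map /= -mul_polyC rmorphM /= tofrac_int rmorphXn -mulrA -exprSr.
  rewrite exprVn mulrCA -expfB_cond ?(negbTE vv_neq0) //.
  by rewrite subnSK // subKn.
move/eqP; rewrite mulf_eq0 (negbTE vv_neq0) orbF.
rewrite tofrac_eq0 => /eqP/polyP rev_p0.
apply/polyP => i; rewrite coef0; have [i_lt|] := ltnP i (size p); last first.
  by move=> ?; rewrite nth_default.
have := rev_p0 (size p - i.+1)%N; rewrite coef0 coef_poly.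
by rewrite subnSK // subKn ?leq_subr ?(ltnW i_lt) // ifT // ltn_subrL (leq_trans _ i_lt).
Qed.

Lemma frac_reprE (x : Qv) :
  x = FracField.tofrac \n_(repr x) / FracField.tofrac \d_(repr x).
Proof.
have d_neq0 : \d_(repr x) != 0 by apply: denom_ratioP.
rewrite -[LHS]reprK -[repr x in LHS]Ratio_numden; unlock FracField.tofrac.
rewrite -[X in _ = _ * X]FracField.pi_inv -[RHS]FracField.pi_mul.
rewrite /FracField.mulf /FracField.invf /= !numden_Ratio ?oner_neq0 //.
by rewrite mulr1 mul1r.
Qed.

(** [bar] is computed on a chosen representative; cross-multiplying and applying the ring morphism
    [eval_vinv] shows that the choice is immaterial. *)
Lemma bar_frac p r : r != 0 ->
  bar (FracField.tofrac p / FracField.tofrac r) = eval_vinv p / eval_vinv r.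
Proof.
move=> r_neq0; set x := _ / _; rewrite /bar.
have d_neq0 : \d_(repr x) != 0 by apply: denom_ratioP.
have : FracField.tofrac p * FracField.tofrac \d_(repr x) =
       FracField.tofrac \n_(repr x) * FracField.tofrac r :> Qv.
  by apply/eqP; rewrite -eqr_div ?tofrac_eq0 //; apply/eqP/frac_reprE.
rewrite -!rmorphM => /eqP; rewrite tofrac_eq => /eqP pd_nr.
by apply/eqP; rewrite eqr_div ?eval_vinv_eq0 // -!rmorphM /= pd_nr.
Qed.

Lemma barM : {morph bar : x y / x * y}.
Proof.
move=> x y; rewrite {1}(frac_reprE x) {1}(frac_reprE y).
have dx0 : \d_(repr x) != 0 by apply: denom_ratioP.
have dy0 : \d_(repr y) != 0 by apply: denom_ratioP.
rewrite mulrACA -invfM -!rmorphM bar_frac ?mulf_neq0 //.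
by rewrite !rmorphM invfM mulrACA.
Qed.

Lemma bar1 : bar 1 = 1.
Proof.
have := bar_frac 1 (oner_neq0 {poly int}).
have -> : eval_vinv 1 = 1 by rewrite rmorph1.
by rewrite tofrac1 !divr1.
Qed.

Lemma inv_ratio (K : fieldType) (x y : K) : x != 0 -> y != 0 -> y - 1 != 0 ->
  (x^-1 - 1) / (y^-1 - 1) = y / x * ((x - 1) / (y - 1)).
Proof.
move=> x0 y0 y1; have inv_sub1 (z : K) : z != 0 -> z^-1 - 1 = - ((z - 1) / z).
  by move=> z0; rewrite mulrBl divff // mul1r opprB.
rewrite !inv_sub1 // invrN mulrNN invf_div mulrACA (mulrC (x - 1)).
by rewrite mulrACA.
Qed.

Lemma bar_ratio a i : (0 < i)%N ->
  bar ((vv ^+ a - 1) / (vv ^+ i - 1)) =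
    vv ^+ i / vv ^+ a * ((vv ^+ a - 1) / (vv ^+ i - 1)).
Proof.
move=> i_gt0; rewrite !vv_exprz -tofrac1 -!tofracB.
rewrite bar_frac ?Xn_sub1_neq0 // !(rmorphB eval_vinv) /= !eval_vinvXn.
have -> : eval_vinv 1 = 1 by rewrite rmorph1.
rewrite !tofracB tofrac1 -!vv_exprz.
by apply: inv_ratio; rewrite ?vv_sub1_neq0 // expf_neq0 // vv_neq0.
Qed.

Lemma qbinom_nat (a b : nat) :
  qbinom (a + b)%N b =
    \prod_(i < b) ((vv ^+ (2 * (a + b - i)) - 1) / (vv ^+ (2 * i.+1) - 1)).
Proof.
rewrite /qbinom big_add1 big_mkord; apply: eq_bigr => i _.
have -> // : 2 * ((a + b)%N%:Z - i.+1%:Z + 1) = (2 * (a + b - i))%N :> int.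
by have := ltn_ord i; lia.
Qed.

Lemma qbinom_gaussp (a b : nat) : qbinom (a + b)%N b = polyv2 (gaussp (a + b) b).
Proof.
have den0 : polyv2 (\prod_(i < b) ('X^(i.+1) - 1)) != 0.
  rewrite rmorph_prod /=; apply/prodf_neq0 => i _.
  by rewrite polyv2Xn_sub1 vv_sub1_neq0.
apply: (mulIf den0); rewrite -rmorphM gaussp_prod qbinom_nat !rmorph_prod /=.
rewrite -big_split /=; apply: eq_bigr => i _.
rewrite !polyv2Xn_sub1; apply: divfK; exact: vv_sub1_neq0.
Qed.

(** Each factor is multiplied by a ratio of powers of v. With the denominators of these ratios taken
    in reverse order, each of the [b] factors contributes v^(-2a). *)
Lemma bar_qbinom (a b : nat) :
  bar (qbinom (a + b)%N b) = vv ^- (2 * (a * b)) * polyv2 (gaussp (a + b) b).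
Proof.
rewrite -qbinom_gaussp qbinom_nat (big_morph bar barM bar1).
rewrite (eq_bigr _ (fun i _ => bar_ratio _ _)) //.
rewrite big_split /=; congr (_ * _).
have vX k : vv ^+ k != 0 by rewrite expf_neq0 // vv_neq0.
have -> : \prod_(i < b) (vv ^+ (2 * i.+1) / vv ^+ (2 * (a + b - i))) =
  (\prod_(i < b) vv ^+ (2 * i.+1)) / \prod_(i < b) vv ^+ (2 * (a + i.+1)) :> Qv.
  rewrite big_split /= prodfV; congr (_ / _).
  rewrite (reindex_inj rev_ord_inj); apply: eq_bigr => i _ /=.
  by congr (vv ^+ (2 * _)); have := ltn_ord i; lia.
rewrite -prodfV -big_split /=.
rewrite (eq_bigr (fun=> vv ^- (2 * a))) => [|i _].
  by rewrite prodr_const card_ord exprVn -exprM mulnA.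
by rewrite mulnDr exprD invfM mulrCA mulfV ?mulr1.
Qed.

Lemma qint_ratio (K : fieldType) (e a t w p : K) :
  e != 0 -> a != 0 -> t != 0 -> w != 0 -> w - 1 != 0 -> t - 1 != 0 ->
  e^-1 * p * (w / (a * t) * ((a * t - 1) / (w - 1)) /
              (w / t * ((t - 1) / (w - 1)))) =
  (e * a)^-1 * ((a * t - 1) * p / (t - 1)).
Proof. by move=> *; field; do !(apply/andP; split). Qed.

(** The i-th quotient contributes v^(-2a - 2i), and the sum of 2a + 2i over i < t is 2at + t(t-1);
    what remains is the recurrence [isotropicp_absorb]. *)
Lemma bar_prod_qint (a t : nat) : odd a ->
  \prod_(0 <= i < t) (bar (qint (a + 1 + 2 * i)%N) / bar (qint i.+1)) =
    vv ^- (2 * (a * t) + t * t.-1) * polyv2 (isotropicp a t).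
Proof.
move=> a_odd.
have qintE (k : nat) : qint k = (vv ^+ (2 * k) - 1) / (vv ^+ 2 - 1).
  by rewrite /qint /qbinom big_nat1 subrK.
elim: t => [|t IHt].
  by rewrite big_nil isotropicp0 (rmorph1 polyv2) muln0 expr0 invr1 mulr1.
rewrite big_nat_recr //= IHt !qintE !bar_ratio // addn1.
have : polyv2 (isotropicp a t.+1) * (vv ^+ (2 * t.+1) - 1) =
       (vv ^+ (2 * (a + t.*2.+1)) - 1) * polyv2 (isotropicp a t).
  by rewrite -!polyv2Xn_sub1 -!rmorphM isotropicp_absorb.
have -> : (a.+1 + 2 * t = a + t.*2.+1)%N by lia.
have -> : (2 * (a * t.+1) + t.+1 * t = (2 * (a * t) + t * t.-1) + 2 * (a + t))%N.
  by case: t {IHt} => [|t]; nia.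
have -> : (2 * (a + t.*2.+1) = 2 * (a + t) + 2 * t.+1)%N by lia.
have vX k : vv ^+ k != 0 by rewrite expf_neq0 // vv_neq0.
have vt := vv_sub1_neq0 (isT : (0 < 2 * t.+1)%N).
rewrite !(exprD vv _ (2 * _)) => /(canRL (mulfK vt)) ->.
exact: (qint_ratio _ (vX _) (vX _) (vX _) (vX _)
                   (vv_sub1_neq0 (isT : (0 < 2)%N)) vt).
Qed.

(** * Symmetric bilinear forms over finite fields *)

(* [{vspace 'rV[F]_m}] elaborates with or without [reverse_coercion], which
   [lia] does not see through. *)
Ltac vlia := unfold reverse_coercion in *; lia.

Section Orthogonality.

Variables (F : finFieldType) (m : nat) (f : {symmetric 'rV[F]_m}).
Implicit Types (u v x y : 'rV[F]_m) (U V W P Y : {vspace 'rV[F]_m}).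

Local Notation perp := (orthov f).

Lemma symC u v : f u v = f v u.
Proof. by rewrite hermC expr0 mul1r. Qed.

Lemma orthovDcap U V : perp (U + V)%VS = (perp U :&: perp V)%VS.
Proof.
apply/vspaceP => x; rewrite memv_cap !memvE; exact: orthovD.
Qed.

Lemma orthovS U V : (U <= V)%VS -> (perp V <= perp U)%VS.
Proof.
move=> UV; apply/orthovP => x y xV yU.
by apply: (mem_orthovP xV); apply: (subvP UV).
Qed.

Lemma sub_orthovC U V : (U <= perp V)%VS = (V <= perp U)%VS.
Proof. exact: orthov_sym. Qed.

Lemma dim_rV : \dim {:'rV[F]_m} = m.
Proof. by rewrite dimvf /dim /= mul1n. Qed.

Lemma dim_orthov_ge U : (m <= \dim U + \dim (perp U))%N.
Proof.
suff: forall X : seq 'rV[F]_m, (m <= size X + \dim (perp <<X>>))%N.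
  by move=> /(_ (vbasis U)); rewrite size_tuple (span_basis (vbasisP U)).
elim=> [|v X IHX]; first by rewrite span_nil orthov0 dim_rV.
rewrite span_cons orthovDcap capvC.
have := leq_dim_orthov1 f v (perp <<X>>); rewrite /=; vlia.
Qed.

Hypothesis f_nondeg : nondegenerate f.

(** The lower bound holds for [U] and for a complement. The two orthogonals meet in the orthogonal
    of the whole space, which is 0, and this leaves no slack in either bound. *)
Lemma dim_orthov U : (\dim U + \dim (perp U))%N = m.
Proof.
have le1 := dim_orthov_ge U; have le2 := dim_orthov_ge U^C.
have /eqP cap0 : (perp U :&: perp U^C == 0)%VS.
  by rewrite -orthovDcap addv_complf; exact: f_nondeg.
have := dimv_sum_cap (perp U) (perp U^C); rewrite cap0 dimv0 addn0.
have := dimvS (subvf (perp U + perp U^C)); rewrite dim_rV.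
have : (\dim U^C = m - \dim U :> nat)%N by rewrite dimv_compl dim_rV.
by have := dimvS (subvf U); rewrite dim_rV; vlia.
Qed.

Lemma orthovK U : perp (perp U) = U.
Proof.
apply/eqP; rewrite eq_sym eqEdim sub_orthovC subvv /=.
by have := dim_orthov U; have := dim_orthov (perp U); vlia.
Qed.

Lemma orthov_cap U V : perp (U :&: V)%VS = (perp U + perp V)%VS.
Proof. by rewrite -[RHS]orthovK orthovDcap !orthovK. Qed.

Lemma dim_cap_orthov U V :
  (\dim (perp U :&: perp V) + \dim U + \dim V = m + \dim (U :&: V))%N.
Proof.
have := dim_orthov (U + V); rewrite orthovDcap.
by have := dimv_sum_cap U V; vlia.
Qed.

Hypothesis F_odd : odd #|F|.

Lemma two_neq0 : 2%:R != 0 :> F.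
Proof.
apply: contraL F_odd => F2; have pcharF2 : 2%N \in [pchar F] by rewrite inE F2.
have [k cardF] : exists k, #|F| = (2 ^ k)%N.
  by eexists; apply: (card_pprimeChar pcharF2).
by have := card_finNzRing_gt1 F; rewrite cardF oddX; case: k {cardF}.
Qed.

(** Pigeonhole: since [#|F|] is odd, more than half of the elements are squares, so the values of
    [a * x ^+ 2] and those of [- c - b * y ^+ 2] overlap. *)
Lemma exists_ternary_zero (a b c : F) : a != 0 -> b != 0 ->
  exists x y : F, a * x ^+ 2 + b * y ^+ 2 + c = 0.
Proof.
move=> a0 b0; pose S : {set F} := [set x ^+ 2 | x : F].
have S_gt : (#|F| < 2 * #|S|)%N.
  pose r (s : F) : F := odflt 0 [pick x : F | x ^+ 2 == s].
  pose A1 : {set F} := [set r s | s in S].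
  pose A2 : {set F} := [set - r s | s in S].
  have F_le : (#|F| <= #|A1 :|: A2|)%N.
    rewrite -cardsT subset_leq_card //; apply/subsetP => x _.
    have : r (x ^+ 2) ^+ 2 == x ^+ 2.
      by rewrite /r; case: pickP => //= /(_ x); rewrite eqxx.
    rewrite eqf_sqr inE => /orP[/eqP rx|/eqP rx]; apply/orP; [left|right].
      by rewrite -{1}rx; do 2! apply: imset_f.
    by rewrite -[x]opprK -rx; do 2! apply: imset_f.
  have A1_le : (#|A1| <= #|S|)%N by apply: leq_imset_card.
  have A2_le : (#|A2| <= #|S|)%N by apply: leq_imset_card.
  have := leq_trans F_le (leq_card_setU A1 A2); move: F_odd A1_le A2_le; lia.
pose A : {set F} := [set a * s | s in S].
pose B : {set F} := [set - c - b * s | s in S].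
have cardA : #|A| = #|S| by apply/card_imset/mulfI.
have cardB : #|B| = #|S|.
  by apply: card_imset => s s' /addrI/oppr_inj/(mulfI b0).
have /set0Pn[z] : A :&: B != set0.
  rewrite -card_gt0 -(ltn_add2l #|A :|: B|) addn0 cardsUI cardA cardB.
  by rewrite addnn -mul2n (leq_ltn_trans (max_card _)).
rewrite inE => /andP[/imsetP[_ /imsetP[x _ ->] ->] /imsetP[_ /imsetP[y _ ->]]].
by move=> e; exists x, y; rewrite e subrK addNr.
Qed.

Lemma form_lin2 u v (c : F) :
  f (u + c *: v) (u + c *: v) = f u u + 2%:R * c * f u v + c ^+ 2 * f v v.
Proof.
rewrite linearDl !linearDr !linearZl_LR !linearZr_LR /= (symC v u); ring.
Qed.

(** On a line [y + c *: x] with [f y x != 0] the quadratic form is affine in [c] with slope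
    [2 * f y x], so exactly one point of the line is isotropic. Hence the isotropic vectors are one
    in [#|F|] among those of [Y] not orthogonal to [x]. *)
Lemma card_isotropic_off_perp x Y : f x x = 0 -> x \in Y ->
  x \notin perp Y ->
  #|[set y in Y | (f y y == 0) && (f y x != 0)]| =
    (#|F| ^ (\dim Y).-1 - #|F| ^ (\dim Y).-2)%N.
Proof.
move=> fxx xY xYn; set S0 := [set y in _ | _].
pose S := [set y in Y | f y x != 0].
have fyx (y : 'rV[F]_m) c : f (y + c *: x) x = f y x.
  by rewrite linearDl linearZl_LR /= fxx mulr0 addr0.
have S_eq : S = [set p.1 + p.2 *: x | p in setX S0 [set: F]].
  apply/setP => z; apply/idP/imsetP => [|[[y c]]]; rewrite !inE /=.
    case/andP => zY fzx; pose c := f z z / (2%:R * f z x).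
    exists (z - c *: x, c); last by rewrite /= subrK.
    rewrite !inE /= andbT rpredB ?rpredZ //= -scaleNr fyx fzx andbT.
    have c_def : 2%:R * c * f z x = f z z.
      by rewrite mulrAC [LHS]mulrC divfK // mulf_neq0 ?two_neq0.
    by rewrite form_lin2 fxx mulr0 addr0 mulrN mulNr c_def subrr.
  case/andP=> /and3P[yY fyy fy0] _ ->.
  by rewrite rpredD ?rpredZ //= fyx.
have cardS : #|S| = (#|S0| * #|F|)%N.
  rewrite S_eq card_in_imset ?cardsX ?cardsT // => -[y c] [y' c'].
  rewrite !inE /= !andbT => /and3P[yY /eqP fyy fy0] /and3P[yY' /eqP fyy' _] e.
  have yE : y' = y + (c - c') *: x by rewrite scalerBl addrA e addrK.
  move: fyy'; rewrite yE form_lin2 fxx fyy mulr0 addr0 add0r => /eqP.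
  rewrite !mulf_eq0 (negbTE two_neq0) (negbTE fy0) orbF /= subr_eq0 => /eqP cc.
  by rewrite cc subrr scale0r addr0.
have q_gt0 : (0 < #|F|)%N by apply/card_gt0P; exists 0.
have dimY : (0 < \dim Y)%N.
  rewrite lt0n dimv_eq0; apply: contraNneq xYn => Y0.
  by rewrite Y0 orthov0 memvf.
have SD : S = [set y in Y] :\: [set y in (Y :&: perp <[x]>)%VS].
  apply/setP => y; rewrite !inE memv_cap mem_orthov1; case: (y \in Y) => //=.
  by rewrite andbT.
have : #|S| = (#|F| ^ (\dim Y) - #|F| ^ (\dim Y).-1)%N.
  rewrite SD cardsD (setIidPr _); last first.
    by apply/subsetP => y; rewrite !inE memv_cap => /andP[].
  by rewrite !cardsE !card_vspace -(eq_dim_orthov1 xYn).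
rewrite cardS => cardS0; apply/eqP; rewrite -(eqn_pmul2r q_gt0) cardS0.
rewrite mulnBl -!expnSr prednK // .
(* The nonzero vector [x] lies in the hyperplane of [Y] orthogonal to it, so both predecessors of
   [\dim Y] are genuine. *)
have dimY2 : (1 < \dim Y)%N.
  have x0 : x != 0 by apply: contraNneq xYn => ->; rewrite mem0v.
  have : (<[x]> <= Y :&: perp <[x]>)%VS by rewrite -memvE memv_cap xY mem_orthov1 fxx /=.
  move/dimvS; rewrite dim_vline x0 -(eq_dim_orthov1 xYn) /=.
  by move: dimY; vlia.
by rewrite prednK // -subn1 subn_gt0.
Qed.

(** The dimension leaves room for three mutually orthogonal vectors of [Y] outside [perp Y]. Either
    one of them is isotropic, or a ternary diagonal equation provides a combination that is; its
    pairing with [y3] keeps it outside [perp Y]. *)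
Lemma exists_isotropic_off_perp Y : (perp Y <= Y)%VS ->
  (\dim (perp Y) + 3 <= \dim Y)%N ->
  exists x, [/\ x \in Y, x \notin perp Y & f x x = 0].
Proof.
move=> pYY dimY.
have pick_off (Z : {vspace 'rV[F]_m}) : (\dim (perp Y) < \dim Z)%N ->
    exists2 y, y \in Z & y \notin perp Y.
  by move=> dimZ; apply/subvPn; apply: contraL dimZ => /dimvS; rewrite -leqNgt.
have [y1 y1Y y1n] : exists2 y, y \in Y & y \notin perp Y by apply: pick_off; vlia.
pose Y1 := (Y :&: perp <[y1]>)%VS.
have dim1 := leq_dim_orthov1 f y1 Y; rewrite -/Y1 in dim1.
have [y2 y2Y1 y2n] : exists2 y, y \in Y1 & y \notin perp Y by apply: pick_off; vlia.
pose Y2 := (Y1 :&: perp <[y2]>)%VS.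
have dim2 := leq_dim_orthov1 f y2 Y1; rewrite -/Y2 in dim2.
have [y3 y3Y2 y3n] : exists2 y, y \in Y2 & y \notin perp Y by apply: pick_off; vlia.
move: y2Y1 y3Y2; rewrite !memv_cap !mem_orthov1.
move=> /andP[y2Y /eqP f21] /andP[/andP[y3Y /eqP f31] /eqP f32].
have [f11|f11] := eqVneq (f y1 y1) 0; first by exists y1.
have [f22|f22] := eqVneq (f y2 y2) 0; first by exists y2.
have [f33|f33] := eqVneq (f y3 y3) 0; first by exists y3.
have [a [b ab0]] := exists_ternary_zero (f y3 y3) f11 f22.
have fx3 : f (y3 + a *: y1 + b *: y2) y3 = f y3 y3.
  by rewrite !linearDl !linearZl_LR /= (symC y1) (symC y2) f31 f32 !mulr0 !addr0.
exists (y3 + a *: y1 + b *: y2); split.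
- by rewrite !rpredD ?rpredZ.
- by apply/mem_orthovPn; exists y3; rewrite ?fx3.
rewrite form_lin2 form_lin2 linearDl linearZl_LR /= (symC y1 y2) f21 f32 f31 -[RHS]ab0.
by rewrite !mulr0 !addr0; ring.
Qed.

(** The difference [\dim Y - \dim (perp Y)] is odd. If it is at least 3, split by orthogonality to
    an isotropic [x] outside [perp Y]: the orthogonal vectors lie in a smaller space that still
    contains its orthogonal, the others are counted by [card_isotropic_off_perp], and q^(k-2) +
    (q^(k-1) - q^(k-2)) = q^(k-1). If it is 1, the isotropic vectors are those of [perp Y]. *)
Lemma card_isotropic Y : odd m -> (perp Y <= Y)%VS ->
  #|[set y in Y | f y y == 0]| = (#|F| ^ (\dim Y).-1)%N.
Proof.
move=> m_odd; move: {2}(\dim Y) (leqnn (\dim Y)) => k.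
elim: k Y => [|k IHk] Y.
  by move=> Y0 pYY; have := dim_orthov Y; have := dimvS pYY; move: m_odd; vlia.
move=> dimY pYY; have dimYp := dim_orthov Y; have le_dim := dimvS pYY.
have [dim_gt|dim_le] := leqP (\dim (perp Y) + 3) (\dim Y).
  have [x [xY xn fxx]] := exists_isotropic_off_perp pYY dim_gt.
  pose Y' := (Y :&: perp <[x]>)%VS.
  have dimY' : (\dim Y' = (\dim Y).-1)%N by rewrite -(eq_dim_orthov1 xn).
  have pY' : (perp Y' <= Y')%VS.
    rewrite orthov_cap orthovK subv_add !subv_cap pYY -memvE xY /=.
    rewrite -memvE mem_orthov1 fxx eqxx andbT.
    by rewrite orthovS // -memvE.
  have -> : [set y in Y | f y y == 0] = [set y in Y' | f y y == 0] :|: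
      [set y in Y | (f y y == 0) && (f y x != 0)].
    apply/setP => y; rewrite !inE memv_cap mem_orthov1.
    by case: (y \in Y); case: (f y y == 0); case: (f y x == 0).
  rewrite cardsU (_ : _ :&: _ = set0) ?cards0 ?subn0; last first.
    apply/setP => y; rewrite !inE memv_cap mem_orthov1.
    by case: (f y x == 0); rewrite ?andbF.
  rewrite card_isotropic_off_perp // IHk //; last by move: dimY dim_gt; vlia.
  rewrite dimY' subnKC // leq_pexp2l //; first by apply/card_gt0P; exists 0.
  exact: leq_pred.
have dim_pY : (\dim (perp Y) = (\dim Y).-1)%N.
  by move: m_odd dimYp dim_le le_dim; vlia.
have -> : [set y in Y | f y y == 0] = [set y in perp Y].
  apply/setP => y; rewrite !inE; apply/andP/idP => [[yY fyy]|yp].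
    case: (boolP (y \in perp Y)) => // yn.
    (* The hyperplane of [Y] orthogonal to [y] contains [perp Y] and has the same dimension; being
       isotropic, [y] belongs to it. *)
    suff pY_eq : (Y :&: perp <[y]>)%VS = perp Y.
      by case/negP: yn; rewrite -pY_eq memv_cap yY mem_orthov1.
    apply/eqP; rewrite eq_sym eqEdim subv_cap pYY orthovS -?memvE //=.
    by rewrite -(eq_dim_orthov1 yn) dim_pY.
  by rewrite (subvP pYY) //= (mem_orthovP yp) // (subvP pYY).
by rewrite cardsE card_vspace dim_pY.
Qed.

End Orthogonality.

(** * Counting subspaces in prescribed position to a flag *)

Definition psum N (t : 'I_N -> nat) (l : nat) : nat :=
  (\sum_(u < N | u < l) t u)%N.

Lemma psum0 N (t : 'I_N -> nat) : psum t 0 = 0%N.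
Proof. by rewrite /psum big_pred0. Qed.

Lemma psum_full N (t : 'I_N -> nat) : psum t N = (\sum_u t u)%N.
Proof. by apply: eq_bigl => u; rewrite ltn_ord. Qed.

Lemma psumS N (t : 'I_N -> nat) (j : 'I_N) : psum t j.+1 = (psum t j + t j)%N.
Proof.
rewrite /psum (bigD1 j) //= addnC; congr (_ + _)%N; apply: eq_bigl => u.
by rewrite ltnS ltn_neqAle andbC.
Qed.

Lemma psumD N (t s : 'I_N -> nat) l :
  psum (fun u => t u + s u)%N l = (psum t l + psum s l)%N.
Proof. exact: big_split. Qed.

Lemma eq_psum N (t s : 'I_N -> nat) l : t =1 s -> psum t l = psum s l.
Proof. by move=> ts; apply: eq_bigr => u _; rewrite ts. Qed.

Lemma psum_delta N (j : 'I_N) l : psum (fun u => u == j : nat) l = (j < l)%N.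
Proof.
rewrite /psum; have [j_lt|j_ge] := ltnP j l.
  by rewrite (bigD1 j) //= eqxx big1 // => u /andP[_ /negbTE->].
rewrite big1 // => u u_lt; case: eqP => // u_eq.
by move: u_lt; rewrite u_eq ltnNge j_ge.
Qed.

Lemma psum_eq0 N (t : 'I_N -> nat) (j : 'I_N) :
  (forall u : 'I_N, (u < j)%N -> t u = 0%N) -> psum t j = 0%N.
Proof. by move=> t0; apply: big1. Qed.

Definition decr N (j : 'I_N) (t : 'I_N -> nat) : 'I_N -> nat :=
  fun u => (t u - (u == j))%N.

Lemma decrK N (j : 'I_N) (t : 'I_N -> nat) : (0 < t j)%N ->
  t =1 (fun u => decr j t u + (u == j))%N.
Proof. by move=> tj u; rewrite /decr; case: eqP => [->|_]; lia. Qed.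

Lemma sum_decr N (j : 'I_N) (t : 'I_N -> nat) : (0 < t j)%N ->
  (\sum_u decr j t u).+1 = (\sum_u t u)%N.
Proof.
move=> tj; rewrite [RHS](eq_bigr _ (fun u _ => decrK tj u)) big_split /=.
have := psum_delta j N; rewrite psum_full ltn_ord => ->.
by rewrite addn1.
Qed.

Definition flag_exp N (a t : 'I_N -> nat) : nat := (\sum_(u < N) psum a u * t u)%N.

Lemma flag_exp_decr N (a t : 'I_N -> nat) (j : 'I_N) : (0 < t j)%N ->
  flag_exp a t = (flag_exp a (decr j t) + psum a j)%N.
Proof.
move=> tj; rewrite /flag_exp (bigD1 j) //= [in RHS](bigD1 j) //= addnAC.
congr (_ + _)%N; last first.
  by apply: eq_bigr => u /negbTE uj; rewrite /decr uj subn0.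
by rewrite /decr eqxx -mulnSr -subSn // subSS subn0.
Qed.

(** For a filtered space with graded dimensions [a u + t u], the binomials choose the graded pieces
    of a subspace, of dimensions [t u]. The power of ['X] counts the lifts: [t u] vectors modulo a
    quotient of dimension [psum a u]. *)
Definition linear_count N (a t : 'I_N -> nat) : {poly int} :=
  \prod_u gaussp (a u + t u) (t u) * 'X^(flag_exp a t).

(** Absorption in the single factor [j]; the shape is that of [card_step] divided by
    [q ^ \dim P]. *)
Lemma linear_count_decr N (a t : 'I_N -> nat) (j : 'I_N) : (0 < t j)%N ->
  linear_count a t * ('X^(t j) - 1) =
    'X^(psum a j) * ('X^(a j + t j) - 1) * linear_count a (decr j t).
Proof.
move=> tj; rewrite /linear_count (flag_exp_decr a tj) exprD.
rewrite (bigD1 j) //= [in RHS](bigD1 j) //=.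
rewrite [in RHS](eq_bigr (fun u => gaussp (a u + t u) (t u))); last first.
  by move=> u /negbTE uj; rewrite /decr uj subn0.
rewrite {2 3}/decr eqxx subn1.
have := gaussp_absorb (a j + t j).-1 (t j).-1.
rewrite !prednK ?(leq_trans tj (leq_addl _ _)) // => e.
have -> : (a j + (t j).-1 = (a j + t j).-1)%N by lia.
move: e; set g := gaussp _ _; set g' := gaussp _.-1 _ => e.
transitivity ((g * ('X^(t j) - 1)) * \prod_(i | i != j) gaussp (a i + t i) (t i)
  * ('X^(flag_exp a (decr j t)) * 'X^(psum a j))); first by ring.
rewrite e; ring.
Qed.

Lemma leq_dimN n (u : 'I_(dimN n)) : (u <= n.*2)%N.
Proof. by rewrite -ltnS. Qed.

Lemma rev_dimN n (u : 'I_(dimN n)) : rev_ord u = (n.*2 - u)%N :> nat.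
Proof. by rewrite /= subSS. Qed.

Lemma mul_absorb (R : comNzRingType) (g g' x y p s : R) :
  g * (x - 1) = (y - 1) * g' -> g * p * s * (x - 1) = (s * y - s) * (g' * p).
Proof.
move=> gg'; transitivity (g * (x - 1) * p * s); first by ring.
by rewrite gg'; ring.
Qed.

(** * Closed form for the number of isotropic subspaces *)

Section IsotropicCount.

Variable n : nat.
Local Notation N := (dimN n).
Let mid : 'I_N := inord n.
Implicit Types (a t : 'I_N -> nat) (j u : 'I_N).

(** The exponent is a number of free parameters. A vector in degree [u] can be altered by
    [a l + t (rev_ord l)] coordinates for each [l < u]; isotropy imposes one equation for each
    unordered pair of lifted vectors, equal ones included, in degrees [j], [l] with [n.*2 < j + l].
    The difference of the two totals is this sum. *)
Definition isotropic_exp a t : nat :=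
  (flag_exp a t + \sum_(u : 'I_N | n < u) 'C(t u, 2)
   + \sum_(j < N) \sum_(l < N | (j < l) && (n.*2 < j + l)) t j * t l)%N.

(** The graded dimensions of the ambient [perp P] over [P] are [a u + t u + t (rev_ord u)]. Above
    the middle the piece must be orthogonal to the one already chosen in degree [rev_ord u], which
    leaves [a u + t u]; in the middle it is a totally isotropic subspace of a quadratic space of odd
    dimension [a mid + 2 * t mid]. *)
Definition isotropic_count a t : {poly int} :=
  \prod_(u < N | (u < n)%N) gaussp (a u + t u + t (rev_ord u)) (t u) *
  \prod_(u < N | (n < u)%N) gaussp (a u + t u) (t u) *
  isotropicp (a mid) (t mid) * 'X^(isotropic_exp a t).

Lemma psum_rev t j : psum (fun u => t (rev_ord u)) j = (\sum_(l < N | rev_ord j < l) t l)%N.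
Proof.
rewrite /psum (reindex_inj rev_ord_inj); apply: eq_big => u; last by rewrite rev_ordK.
by have := leq_dimN u; have := leq_dimN j; rewrite !rev_dimN; lia.
Qed.

(** As [t] vanishes below [j], the reflected part of the partial sum consists of the partners of [j]
    in the quadratic term, and of [t j] itself if [n < j]. There the binomial coefficient loses only
    [t j - 1], whence the correction by one. *)
Lemma isotropic_exp_decr a t j : (0 < t j)%N ->
  (forall u, (u < j)%N -> t u = 0%N) ->
  isotropic_exp a t = (isotropic_exp a (decr j t) +
    psum (fun u => a u + t u + t (rev_ord u)) j - (n < j))%N.
Proof.
move=> tj t0; have decr_neq u : u != j -> decr j t u = t u.
  by move=> /negbTE uj; rewrite /decr uj subn0.
have decr_j : decr j t j = (t j).-1 by rewrite /decr eqxx subn1.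
pose S u := (\sum_(l < N | (u < l) && (n.*2 < u + l)) t l)%N.
pose S' u := (\sum_(l < N | (u < l) && (n.*2 < u + l)) decr j t l)%N.
have S'E u : (j <= u)%N -> S' u = S u.
  move=> ju; apply: eq_bigr => l /andP[ul _]; apply: decr_neq.
  by rewrite -val_eqE /= gtn_eqF // (leq_ltn_trans ju).
have quadE : (\sum_(i < N) \sum_(l < N | (i < l) && (n.*2 < i + l)) t i * t l =
    \sum_(i < N) \sum_(l < N | (i < l) && (n.*2 < i + l)) decr j t i * decr j t l + S j)%N.
  under eq_bigr => i _ do rewrite -big_distrr /=.
  under [in RHS]eq_bigr => i _ do rewrite -big_distrr /= -/(S' i).
  rewrite (bigD1 j) //= [in RHS](bigD1 j) //= S'E //.
  rewrite decr_j -{1}(prednK tj) mulSn -addnA addnC; congr (_ + _ + _)%N.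
  apply: eq_bigr => i ij; rewrite decr_neq //.
  by have [/t0->|ji] := ltnP i j; rewrite ?mul0n // S'E.
have binE : (\sum_(u < N | n < u) 'C(t u, 2) =
    \sum_(u < N | n < u) 'C(decr j t u, 2) + (n < j) * (t j).-1)%N.
  have [nj|jn] := ltnP n j; last first.
    rewrite addn0; apply: eq_bigr => u nu; rewrite decr_neq //.
    by rewrite -val_eqE /= gtn_eqF // (leq_ltn_trans jn).
  rewrite (bigD1 j) //= [in RHS](bigD1 j) //= mul1n addnAC; congr (_ + _)%N.
    by rewrite decr_j -{1}(prednK tj) binS bin1.
  by apply: eq_bigr => u /andP[_ uj]; rewrite decr_neq.
rewrite /isotropic_exp quadE binE (flag_exp_decr a tj).
have -> : psum (fun u => a u + t u + t (rev_ord u))%N j =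
          (psum a j + ((n < j) * t j + S j))%N.
  rewrite !psumD (psum_eq0 t0) addn0 psum_rev; congr (_ + _)%N.
  have revj : (rev_ord j < j)%N = (n < j)%N.
    by have := leq_dimN j; rewrite rev_dimN; lia.
  have -> : S j = (\sum_(l < N | (rev_ord j < l)%N && (l != j)) t l)%N.
    rewrite /S big_mkcond [RHS]big_mkcond; apply: eq_bigr => l _.
    have [/t0->|jl] := ltnP l j; first by rewrite !if_same.
    rewrite -[l == j]val_eqE rev_dimN /=; congr (if _ then _ else _).
    by have := leq_dimN j; have := leq_dimN l; lia.
  have [nj|jn] := ltnP n j; first by rewrite (bigD1 j) ?revj //= mul1n.
  rewrite mul0n add0n; apply: eq_bigl => l; apply/esym/andb_idr.
  by apply: contraTneq => ->; rewrite revj -leqNgt.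
by case: (n < j)%N => /=; lia.
Qed.

(** The difference of powers is the number of admissible vectors divided by [q ^ \dim P]; the
    subtracted booleans record that isotropy costs one dimension past the middle. The absorbing
    factor is a Gaussian binomial for [j != n] and [isotropicp] for [j = n]. *)
Lemma isotropic_count_decr a t j : odd (a mid) -> (0 < t j)%N ->
  (forall u, (u < j)%N -> t u = 0%N) ->
  let M u := (a u + t u + t (rev_ord u))%N in
  isotropic_count a t * ('X^(t j) - 1) =
    ('X^(psum M j.+1 - (n <= j)) - 'X^(psum M j - (n < j))) *
    isotropic_count a (decr j t).
Proof.
move=> a_odd tj t0 M; have decr_neq u : u != j -> decr j t u = t u.
  by move=> /negbTE uj; rewrite /decr uj subn0.
have decr_j : decr j t j = (t j).-1 by rewrite /decr eqxx subn1.
have psumM0 : psum M j = (psum a j + psum (fun u => t (rev_ord u)) j)%N.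
  by rewrite !psumD (psum_eq0 t0) addn0.
have midE : mid = n :> nat by rewrite inordK // ltnS -addnn leq_addr.
have neq_val (u i : 'I_N) : (u != i) = (u != i :> nat) by rewrite -val_eqE.
rewrite psumS -/(M j) /isotropic_count (isotropic_exp_decr a tj t0) -/M.
set e := isotropic_exp a (decr j t).
have [jn|nj|jn] := ltngtP j n; rewrite ?subn0.
- have jr : rev_ord j != j by rewrite neq_val rev_dimN; lia.
  have -> : \prod_(u < N | (n < u)%N) gaussp (a u + decr j t u) (decr j t u) =
            \prod_(u < N | (n < u)%N) gaussp (a u + t u) (t u).
    by apply: eq_bigr => u nu; rewrite decr_neq // neq_val; lia.
  have mid_j : mid != j by rewrite neq_val midE; lia.
  rewrite (decr_neq mid) //.
  rewrite (bigD1 j) //= [in RHS](bigD1 j) //= decr_j decr_neq //.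
  have -> : \prod_(u < N | (u < n)%N && (u != j))
       gaussp (a u + decr j t u + decr j t (rev_ord u)) (decr j t u) =
     \prod_(u < N | (u < n)%N && (u != j)) gaussp (M u) (t u).
    apply: eq_bigr => u /andP[un uj]; rewrite !decr_neq // neq_val rev_dimN.
    by have := leq_dimN j; lia.
  have := gaussp_absorb (M j).-1 (t j).-1.
  rewrite !prednK //; last by rewrite /M; lia.
  have -> : (a j + (t j).-1 + t (rev_ord j) = (M j).-1)%N by rewrite /M; lia.
  rewrite -/(M j) => absorb; rewrite (exprD _ e) (exprD _ (psum M j)).
  set A := \prod_(u < N | _) gaussp (_ + _) _; set B := \prod_(u < N | _) _.
  set I := isotropicp _ _; set E := 'X^e.
  have := mul_absorb (A * B * I * E) 'X^(psum M j) absorb.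
  rewrite -/(M j) => H.
  transitivity (gaussp (M j) (t j) * (A * B * I * E) * 'X^(psum M j) * ('X^(t j) - 1)).
    by rewrite /A; ring.
  by rewrite H; ring.
- have rjj : (rev_ord j < j)%N by rewrite rev_dimN; lia.
  have -> : \prod_(u < N | (u < n)%N)
       gaussp (a u + decr j t u + decr j t (rev_ord u)) (decr j t u) =
     \prod_(u < N | (u < n)%N) gaussp (a u + t u + t (rev_ord u)) (t u).
    apply: eq_bigr => u un.
    have tu : t u = 0%N by apply: t0; lia.
    by rewrite (decr_neq u) ?tu ?gaussp0 // neq_val; lia.
  have mid_j : mid != j by rewrite neq_val midE; lia.
  rewrite (decr_neq mid) //.
  rewrite !(bigD1 (P := fun u : 'I_N => (n < u)%N) j nj) /= decr_j.
  have -> : \prod_(u < N | (n < u)%N && (u != j))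
       gaussp (a u + decr j t u) (decr j t u) =
     \prod_(u < N | (n < u)%N && (u != j)) gaussp (a u + t u) (t u).
    by apply: eq_bigr => u /andP[un uj]; rewrite !decr_neq.
  have MjE : M j = (a j + t j)%N by rewrite /M (t0 _ rjj) addn0.
  (* The reflected index of [j] lies below [j] and contributes [t j > 0], so subtracting one is not
     truncated. *)
  have psum_gt0 : (0 < psum M j)%N.
    rewrite psumM0 psum_rev (bigD1 j) //=; move: tj; lia.
  have -> : (e + psum M j - true = e + (psum M j).-1)%N by lia.
  have -> : (psum M j + M j - true = (psum M j).-1 + M j)%N by lia.
  have -> : (psum M j - true = (psum M j).-1)%N by lia.
  have := gaussp_absorb (M j).-1 (t j).-1.
  rewrite !prednK //; last by rewrite /M; lia.
  have -> : (a j + (t j).-1 = (M j).-1)%N by lia.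
  rewrite -MjE => absorb; rewrite (exprD _ e) (exprD _ (psum M j).-1).
  set A := \prod_(u < N | _) gaussp (_ + _) _; set B := \prod_(u < N | _) _.
  set I := isotropicp _ _; set E := 'X^e.
  have H := mul_absorb (A * B * I * E) 'X^((psum M j).-1) absorb.
  transitivity (gaussp (M j) (t j) * (A * B * I * E) * 'X^((psum M j).-1) * ('X^(t j) - 1)).
    by ring.
  by rewrite H; ring.
- have jmid : j = mid by apply/val_inj; rewrite /= midE.
  have rj : rev_ord j = j by apply/val_inj; rewrite /= subSS jmid midE; lia.
  have -> : \prod_(u < N | (u < n)%N)
       gaussp (a u + decr j t u + decr j t (rev_ord u)) (decr j t u) =
     \prod_(u < N | (u < n)%N) gaussp (a u + t u + t (rev_ord u)) (t u).
    apply: eq_bigr => u un.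
    by rewrite !decr_neq // neq_val ?rev_dimN; lia.
  have -> : \prod_(u < N | (n < u)%N) gaussp (a u + decr j t u) (decr j t u) =
     \prod_(u < N | (n < u)%N) gaussp (a u + t u) (t u).
    by apply: eq_bigr => u un; rewrite !decr_neq // neq_val; lia.
  rewrite -jmid decr_j.
  have absorb := isotropicp_absorb (t j).-1 a_odd.
  have MjE : M j = (a j + (t j).*2)%N by rewrite /M rj; lia.
  have -> : (psum M j + M j - true = psum M j + (a j + (t j).-1.*2.+1))%N by lia.
  rewrite prednK // -jmid in absorb; rewrite (exprD _ e) (exprD _ (psum M j)).
  set A := \prod_(u < N | _) gaussp (_ + _) _; set B := \prod_(u < N | _) _.
  set E := 'X^e.
  have H := mul_absorb (A * B * E) 'X^(psum M j) absorb.
  transitivity (isotropicp (a j) (t j) * (A * B * E) * 'X^(psum M j) * ('X^(t j) - 1)).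
    by ring.
  by rewrite H; ring.
Qed.

End IsotropicCount.

(** * Counting subspaces by adjoining one vector *)

Section FlagCounting.

Variables (F : finFieldType) (m N : nat) (G : nat -> {vspace 'rV[F]_m}).
Implicit Types (x : 'rV[F]_m) (P Q W H : {vspace 'rV[F]_m}).
Local Notation q := #|F|.

Lemma dim_cap_add P W H : (P <= W)%VS ->
  (\dim (W :&: (P + H)) + \dim (P :&: H) = \dim P + \dim (W :&: H))%N.
Proof.
move=> PW; have := dimv_sum_cap P (H :&: W).
rewrite vspace_modl // capvA [(P :&: H)%VS]capvC -capvA (capv_idPl PW).
by rewrite ![(_ :&: W)%VS]capvC [(H :&: P)%VS]capvC.
Qed.

(** Double counting of the pairs (W, x) with [x] in [X] and in [W]. *)
Lemma card_extend P (Phi : pred {vspace 'rV[F]_m}) (X : {set 'rV[F]_m}) (c k : nat) :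
  (forall W, (P <= W)%VS -> Phi W -> #|[set x in X | x \in W]| = c) ->
  (forall x, x \in X -> #|[set W | (P + <[x]> <= W)%VS && Phi W]| = k) ->
  (#|[set W | (P <= W)%VS && Phi W]| * c = #|X| * k)%N.
Proof.
move=> cardW cardX; set S := [set W | _].
transitivity (\sum_(W in S) \sum_(x in X) (x \in W : nat))%N.
  rewrite -sum_nat_const; apply: eq_bigr => W; rewrite inE => /andP[PW phiW].
  by rewrite -(cardW W) // -sum1dep_card big_mkcondr.
rewrite exchange_big -sum_nat_const; apply: eq_bigr => x xX.
rewrite -(cardX x) // -sum1dep_card big_mkcond [RHS]big_mkcond; apply: eq_bigr => W _.
rewrite inE subv_add -memvE.
by case: (P <= W)%VS; case: (Phi W); case: (x \in W).
Qed.

Lemma card_sub_off H0 H1 : (H0 <= H1)%VS ->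
  #|[set x | (x \in H1) && (x \notin H0)]| = (q ^ \dim H1 - q ^ \dim H0)%N.
Proof.
move=> H01; rewrite -!card_vspace -[in RHS]cardsE -[#|H0|]cardsE.
have -> : [set x | (x \in H1) && (x \notin H0)] = [set x in H1] :\: [set x in H0].
  by apply/setP => x; rewrite !inE andbC.
rewrite cardsD (setIidPr _) //.
by apply/subsetP => x; rewrite !inE; apply: subvP.
Qed.

Hypothesis G_mono : forall i j, (i <= j <= N)%N -> (G i <= G j)%VS.
Hypothesis G_full : G N = fullv.

(** The vector [x] lies in [P + G l] exactly when [j < l]; the formula for the dimension of a sum
    converts this into a jump of the intersection. *)
Lemma dim_cap_add_line P x (j l : nat) : (j < N)%N -> (l <= N)%N ->
  x \in (P + G j.+1)%VS -> x \notin (P + G j)%VS ->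
  (\dim ((P + <[x]>) :&: G l) = \dim (P :&: G l) + (j < l))%N.
Proof.
move=> jN lN xj1 xj; have xP : x \notin P.
  by apply: contra xj; apply: subvP; apply: addvSl.
have dim_line (U : {vspace 'rV[F]_m}) : (\dim (U + <[x]>) = \dim U + (x \notin U))%N.
  have [xU|xU] := boolP (x \in U).
    by rewrite (addv_idPl _) ?addn0 // -memvE.
  have x0 : x != 0 by apply: contraNneq xU => ->; apply: mem0v.
  rewrite dimv_disjoint_sum ?dim_vline ?x0 //; apply/eqP; rewrite -subv0.
  apply/subvP => y; rewrite memv_cap => /andP[yU /vlineP[k y_eq]].
  have [k0|k0] := eqVneq k 0; first by rewrite y_eq k0 scale0r mem0v.
  by case/negP: xU; rewrite -(scalerK k0 x) -y_eq rpredZ.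
have x_mem : (x \in (P + G l)%VS) = (j < l)%N.
  have [jl|lj] := ltnP j l.
    by apply: (subvP (addvS (subvv P) (G_mono _)) _ xj1); rewrite jl.
  apply: contraNF xj; apply: subvP; apply: addvS => //; apply: G_mono.
  by rewrite lj ltnW.
have := dimv_sum_cap (P + <[x]>) (G l); have := dimv_sum_cap P (G l).
have -> : (P + <[x]> + G l = P + G l + <[x]>)%VS by rewrite -!addvA (addvC <[x]>%VS).
rewrite !dim_line x_mem xP.
by case: (j < l)%N; vlia.
Qed.

Definition cap_dims (r : nat -> nat) W : bool :=
  [forall l : 'I_N.+1, \dim (W :&: G l) == r l].

Lemma cap_dimsP r W :
  reflect (forall l, (l <= N)%N -> (\dim (W :&: G l) = r l)%N) (cap_dims r W).
Proof.
apply: (iffP forallP) => [dimW l|dimW l]; last by apply/eqP/dimW; rewrite -ltnS.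
by rewrite -ltnS => lN; apply/eqP: (dimW (Ordinal lN)).
Qed.

Section Step.

Variables (Phi : pred {vspace 'rV[F]_m}) (good : pred 'rV[F]_m).
Variables (P : {vspace 'rV[F]_m}) (r : nat -> nat) (t : 'I_N -> nat).
Hypothesis Phi_good :
  forall W, (P <= W)%VS -> Phi W -> {in W, forall x, good x}.
Hypothesis r_def : forall l, (l <= N)%N -> (r l = \dim (P :&: G l) + psum t l)%N.

Lemma card_base : (forall u, t u = 0%N) -> Phi P ->
  #|[set W | (P <= W)%VS && (Phi W && cap_dims r W)]| = 1%N.
Proof.
move=> t0 PhiP; have psum0 l : psum t l = 0%N by apply: big1.
rewrite -[RHS](cards1 P); congr #|pred_of_set _|.
apply/setP => W; rewrite !inE; apply/and3P/eqP => [[PW _ /cap_dimsP dimW]|->].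
  apply/esym/eqP; rewrite eqEdim PW /=.
  by have := dimW N (leqnn N); rewrite r_def // psum0 addn0 G_full !capvf => ->.
split=> //; apply/cap_dimsP => l lN; by rewrite r_def // psum0 addn0.
Qed.

(** Since [t] vanishes below [j], a subspace [W] meets [P + G j] in dimension [\dim P] and
    [P + G j.+1] in dimension [\dim P + t j], so the number of its vectors in [X] is the same for
    all [W]. [Phi] and [good] stand for the constraint on [W] and the one it puts on vectors, so
    that the step serves both the linear and the isotropic count. *)
Lemma card_step (j : 'I_N) (k : nat) : (forall u : 'I_N, (u < j)%N -> t u = 0%N) ->
  let X := [set x | [&& good x, x \in (P + G j.+1)%VS & x \notin (P + G j)%VS]] in
  (forall x, x \in X ->
    #|[set W | (P + <[x]> <= W)%VS && (Phi W && cap_dims r W)]| = k) ->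
  (#|[set W | (P <= W)%VS && (Phi W && cap_dims r W)]| *
    (q ^ (\dim P + t j) - q ^ \dim P) = #|X| * k)%N.
Proof.
move=> t0 X cardX; apply: card_extend => // W PW /andP[PhiW /cap_dimsP dimW].
have dimWG l : (l <= N)%N -> (\dim (W :&: (P + G l)) = \dim P + psum t l)%N.
  move=> lN; have := dim_cap_add (G l) PW; rewrite dimW // r_def //; vlia.
have -> : [set x in X | x \in W] =
    [set x | (x \in (W :&: (P + G j.+1))%VS) && (x \notin (W :&: (P + G j))%VS)].
  apply/setP => x; rewrite !inE !memv_cap.
  case: (boolP (x \in W)) => xW; rewrite ?andbF //= andbT.
  by rewrite (Phi_good PW PhiW).
rewrite card_sub_off; last first.
  by rewrite capvS // addvS // G_mono // leqnSn ltn_ord.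
rewrite !dimWG //; last by rewrite ltnW.
by rewrite psumS (psum_eq0 t0) addn0 add0n.
Qed.

End Step.

Lemma exists_min_pos (t : 'I_N -> nat) : (0 < \sum_u t u)%N ->
  exists j : 'I_N, (0 < t j)%N /\ (forall u : 'I_N, (u < j)%N -> t u = 0%N).
Proof.
rewrite lt0n sum_nat_eq0 negb_forall => /existsP[i0 /= ti0].
rewrite -lt0n in ti0.
case: (@arg_minnP _ i0 (fun i => 0 < t i)%N (fun i : 'I_N => i : nat) ti0) => j tj jmin.
exists j; split=> // u uj; apply/eqP; rewrite -leqn0 leqNgt.
by apply: contraL uj => /jmin; rewrite -leqNgt.
Qed.

Lemma horner_Xn_sub (a b : nat) : (a <= b)%N ->
  ('X^b - 'X^a : {poly int}).[q%:Z] = (q ^ b - q ^ a)%N%:Z.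
Proof.
move=> ab; rewrite hornerD hornerN !hornerXn -!natz -!natrX -natrB //.
by rewrite leq_pexp2l //; apply/card_gt0P; exists 0.
Qed.

Lemma card_F_gt1 : (1 < q)%N.
Proof. exact: card_finNzRing_gt1. Qed.

Lemma horner_Xn_sub1_neq0 (b : nat) : (0 < b)%N ->
  ('X^b - 1 : {poly int}).[q%:Z] != 0.
Proof.
move=> b0; rewrite hornerD hornerN hornerXn hornerC -!natz -natrX subr_eq0.
by rewrite natz eqz_nat -(expn0 q) eqn_exp2l ?card_F_gt1 // -lt0n.
Qed.

(* Common to the two inductions below: [card_step] divided by [q ^ \dim P]. *)
Lemma horner_of_step (p b c k e : nat) (f f' g : {poly int}) :
  (0 < b)%N -> (k * (q ^ (p + b) - q ^ p) = e * c)%N ->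
  e%:Z = ('X^p * g).[q%:Z] -> c%:Z = f'.[q%:Z] ->
  f * ('X^b - 1) = g * f' -> k%:Z = f.[q%:Z].
Proof.
move=> b0 kec eE cE ff'; apply: (mulIf (horner_Xn_sub1_neq0 b0)).
rewrite -hornerM ff' hornerM -cE.
have qp0 : 'X^p.[q%:Z] != 0 :> int.
  by rewrite hornerXn expf_neq0 // -lt0n ltnW ?card_F_gt1.
apply: (mulfI qp0); rewrite [RHS]mulrA -[X in _ = X * _]hornerM -eE -PoszM -kec PoszM.
rewrite -horner_Xn_sub ?leq_addr // mulrCA -hornerM; congr (_ * _.[_]).
by rewrite exprD mulrBr mulr1.
Qed.

Section Linear.

Variables (Q : {vspace 'rV[F]_m}) (r : nat -> nat) (a : 'I_N -> nat).

(** The induction enlarges [P] and lowers [t] while [a], the graded dimensions of [Q] over [W],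
    stays fixed. *)
Lemma card_linear (t : 'I_N -> nat) P : (P <= Q)%VS ->
  (forall l, (l <= N)%N ->
    (\dim (Q :&: G l) = \dim (P :&: G l) + psum (fun u => a u + t u) l)%N) ->
  (forall l, (l <= N)%N -> (r l = \dim (P :&: G l) + psum t l)%N) ->
  #|[set W | (P <= W)%VS && ((W <= Q)%VS && cap_dims r W)]|%:Z =
    (linear_count a t).[q%:Z].
Proof.
have [k] := ubnP (\sum_u t u)%N.
elim: k t P => // k IHk t P; rewrite ltnS => t_le PQ dimQ r_def.
have [/eqP|t_gt0] := posnP (\sum_u t u)%N.
  rewrite sum_nat_eq0 => /forallP t0.
  have {}t0 u : t u = 0%N by apply/eqP/t0.
  have flag0 : flag_exp a t = 0%N by apply: big1 => u _; rewrite t0 muln0.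
  rewrite (card_base r_def t0) // /linear_count flag0 big1 => [|u _].
    by rewrite mulr1 hornerC.
  by rewrite t0 gaussp0.
have [j [tj t0]] := exists_min_pos t_gt0.
have dim_add l : (l <= N)%N ->
    (\dim (Q :&: (P + G l)) = \dim P + psum (fun u => a u + t u) l)%N.
  by move=> lN; have := dim_cap_add (G l) PQ; rewrite dimQ //; vlia.
set X := [set x | [&& x \in Q, x \in (P + G j.+1)%VS & x \notin (P + G j)%VS]].
have cardX : #|X| = (q ^ (\dim P + psum (fun u => a u + t u) j + (a j + t j))
                     - q ^ (\dim P + psum (fun u => a u + t u) j))%N.
  rewrite -addnA -psumS -!dim_add //; last by rewrite ltnW.
  rewrite -card_sub_off; last by rewrite capvS // addvS // G_mono // leqnSn ltn_ord.
  congr #|pred_of_set _|; apply/setP => x; rewrite !inE !memv_cap.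
  by case: (x \in Q).
have step x : x \in X ->
    #|[set W | (P + <[x]> <= W)%VS && ((W <= Q)%VS && cap_dims r W)]|%:Z =
      (linear_count a (decr j t)).[q%:Z].
  rewrite inE => /and3P[xQ xj1 xj]; have dimPx := dim_cap_add_line (ltn_ord j) _ xj1 xj.
  apply: IHk => [|||l lN].
  - by rewrite -ltnS sum_decr // (leq_ltn_trans _ t_le).
  - by rewrite subv_add PQ -memvE.
  - move=> l lN; rewrite dimQ // dimPx // -addnA; congr (_ + _)%N.
    rewrite -(psum_delta j l) -psumD; apply: eq_psum => u.
    by rewrite {1}(decrK tj u) addnA addnC.
  - rewrite r_def // dimPx // -addnA; congr (_ + _)%N.
    rewrite -(psum_delta j l) -psumD; apply: eq_psum => u.
    by rewrite {1}(decrK tj u) addnC.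
(* A witness is needed to name the common number of subspaces above [P + <[x]>]; [t j > 0] makes [X]
   nonempty. *)
have [x0 x0X] : exists x0, x0 \in X.
  by apply/card_gt0P; rewrite cardX subn_gt0 ltn_exp2l ?card_F_gt1 //; lia.
apply: (horner_of_step tj (card_step (Phi := fun W => (W <= Q)%VS)
    (good := fun x => x \in Q) _ r_def t0 _) _ (step x0 x0X) (linear_count_decr a tj)).
- by move=> W _ /subvP.
- by move=> x xX; apply/eqP; rewrite -eqz_nat !step.
rewrite -/X cardX -horner_Xn_sub ?leq_addr //; congr _.[_].
by rewrite psumD (psum_eq0 t0) addn0 !exprD; ring.
Qed.

End Linear.

End FlagCounting.

(** * Isotropic subspaces in prescribed position to a self-dual flag *)

Section IsotropicCounting.

Variables (F : finFieldType) (m n : nat) (f : {symmetric 'rV[F]_m}).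
Variable G : nat -> {vspace 'rV[F]_m}.
Implicit Types (x : 'rV[F]_m) (P Q W : {vspace 'rV[F]_m}).
Local Notation q := #|F|.
Local Notation N := (dimN n).
Local Notation perp := (orthov f).

Hypothesis f_nondeg : nondegenerate f.
Hypothesis F_odd : odd #|F|.
Hypothesis m_odd : odd m.
Hypothesis G_mono : forall i j, (i <= j <= N)%N -> (G i <= G j)%VS.
Hypothesis G_full : G N = fullv.
Hypothesis G_perp : forall l, (l <= N)%N -> perp (G l) = G (N - l).

Lemma dim_perp_cap P l : (l <= N)%N ->
  (\dim (perp P :&: G l) + \dim P + \dim (G (N - l)) =
     m + \dim (P :&: G (N - l)))%N.
Proof.
move=> lN; rewrite -(dim_cap_orthov f_nondeg P (G (N - l))).
by rewrite G_perp ?leq_subr // subKn.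
Qed.

Section Reduced.

Variables (P : {vspace 'rV[F]_m}) (M : nat -> nat).
Hypothesis P_iso : (P <= perp P)%VS.
Hypothesis dimP : forall l, (l <= N)%N ->
  (\dim (perp P :&: G l) = \dim (P :&: G l) + M l)%N.

(** The preimage in [perp P] of the flag induced on the quotient of [perp P] by [P]. By [perpY] it
    is self-dual again, so the quotient space itself need not be formed. *)
Let Y l := (perp P :&: (P + G l))%VS.

Let dimY l : (l <= N)%N -> (\dim (Y l) = \dim P + M l)%N.
Proof. by move=> lN; have := dim_cap_add (G l) P_iso; rewrite dimP // /Y; vlia. Qed.

Let perpY l : (l <= N)%N -> perp (Y l) = Y (N - l).
Proof.
move=> lN; rewrite /Y orthov_cap // orthovK // orthovDcap G_perp //.
by rewrite [(perp P :&: (P + _))%VS]capvC -vspace_modl // [(G _ :&: _)%VS]capvC.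
Qed.

Let Y_mono i j : (i <= j <= N)%N -> (Y i <= Y j)%VS.
Proof. by move=> ij; rewrite capvS // addvS // G_mono. Qed.

(** Otherwise [Y l] and its orthogonal, which lies between [P] and [Y l], would both have dimension
    [\dim P], making [m] even. *)
Lemma reduced_pos l : (n < l <= N)%N -> (0 < M l)%N.
Proof.
move=> /andP[nl lN]; rewrite lt0n; apply: contraTneq m_odd => M0.
have := dimY lN; rewrite M0 addn0 => dimYl.
have := dim_orthov f_nondeg (Y l); rewrite perpY // dimYl.
have PY : (P <= Y (N - l))%VS by rewrite subv_cap P_iso addvSl.
have YY : (Y (N - l) <= Y l)%VS by apply: Y_mono; rewrite /dimN in lN *; lia.
by have := dimvS PY; have := dimvS YY; rewrite dimYl; vlia.
Qed.

(** Up to the middle [Y l] lies in its orthogonal and all its vectors are isotropic; past the middle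
    it contains its orthogonal and [card_isotropic] applies. *)
Lemma card_isotropic_reduced l : (l <= N)%N ->
  #|[set x in Y l | f x x == 0]| = (q ^ (\dim P + (M l - (n < l))))%N.
Proof.
move=> lN; have [ln|nl] := leqP l n; last first.
  rewrite card_isotropic //; last first.
    by rewrite perpY //; apply: Y_mono; rewrite /dimN in lN *; lia.
  have := @reduced_pos l; rewrite nl lN => /(_ isT) M0.
  by rewrite dimY // -subn1 addnBA.
rewrite subn0 -dimY // -card_vspace; apply: eq_card => x; rewrite !inE.
apply: andb_idr => xY; apply/eqP.
have Y_iso : (Y l <= perp (Y l))%VS.
  by rewrite perpY //; apply: Y_mono; rewrite /dimN in lN *; lia.
exact: (mem_orthovP (subvP Y_iso _ xY)).
Qed.

Lemma card_isotropic_step_vectors j : (j < N)%N ->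
  #|[set x | [&& (x \in perp P) && (f x x == 0), x \in (P + G j.+1)%VS
               & x \notin (P + G j)%VS]]| =
  (q ^ (\dim P + (M j.+1 - (n <= j))) - q ^ (\dim P + (M j - (n < j))))%N.
Proof.
move=> jN; rewrite -(card_isotropic_reduced jN) -(card_isotropic_reduced (ltnW jN)).
have -> : [set x | [&& (x \in perp P) && (f x x == 0), x \in (P + G j.+1)%VS
               & x \notin (P + G j)%VS]] =
    [set x in Y j.+1 | f x x == 0] :\: [set x in Y j | f x x == 0].
  apply/setP => x; rewrite !inE !memv_cap.
  case: (x \in perp P); case: (f x x == 0); rewrite ?andbF //=.
  by case: (x \in P + G j)%VS; case: (x \in P + G j.+1)%VS.
rewrite cardsD (setIidPr _) //.
apply/subsetP => x; rewrite !inE => /andP[xY ->]; rewrite andbT.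
by apply: subvP xY; apply: Y_mono; rewrite leqnSn.
Qed.

End Reduced.

Variables (r : nat -> nat) (a : 'I_N -> nat).
Hypothesis a_odd : odd (a (inord n)).

(** Here [a] stands for the graded dimensions of [perp W] over [W]: those of [perp P] over [P]
    exceed them by [t u] for the growth of [P] to [W] and by [t (rev_ord u)] for the shrinking of
    the orthogonal. *)
Lemma card_isotropic_subspaces (t : 'I_N -> nat) P : (P <= perp P)%VS ->
  (forall l, (l <= N)%N -> (\dim (perp P :&: G l) =
     \dim (P :&: G l) + psum (fun u => a u + t u + t (rev_ord u)) l)%N) ->
  (forall l, (l <= N)%N -> (r l = \dim (P :&: G l) + psum t l)%N) ->
  #|[set W | (P <= W)%VS && ((W <= perp W)%VS && cap_dims N G r W)]|%:Z =
    (isotropic_count a t).[q%:Z].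
Proof.
have [k] := ubnP (\sum_u t u)%N.
elim: k t P => // k IHk t P; rewrite ltnS => t_le P_iso dimP r_def.
have [/eqP|t_gt0] := posnP (\sum_u t u)%N.
  rewrite sum_nat_eq0 => /forallP t0.
  have {}t0 u : t u = 0%N by apply/eqP/t0.
  have exp0 : isotropic_exp a t = 0%N.
    rewrite /isotropic_exp /flag_exp !big1 // => [u _|u _|u _].
    - by rewrite big1 // => l _; rewrite t0.
    - by rewrite t0.
    - by rewrite t0 muln0.
  rewrite (card_base G_full r_def t0) // /isotropic_count exp0 t0 isotropicp0.
  rewrite !big1 => [|u _|u _]; first by rewrite !mulr1 hornerC.
  - by rewrite t0 gaussp0.
  - by rewrite t0 gaussp0.
have [j [tj t0]] := exists_min_pos t_gt0.
set X := [set x | [&& (x \in perp P) && (f x x == 0), x \in (P + G j.+1)%VS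
               & x \notin (P + G j)%VS]].
have cardX := card_isotropic_step_vectors P_iso dimP (ltn_ord j); rewrite -/X in cardX.
have step x : x \in X ->
    #|[set W | (P + <[x]> <= W)%VS && ((W <= perp W)%VS && cap_dims N G r W)]|%:Z =
      (isotropic_count a (decr j t)).[q%:Z].
  rewrite inE => /and3P[/andP[xP /eqP fxx] xj1 xj].
  have dimPx l (lN : (l <= N)%N) := dim_cap_add_line G_mono (ltn_ord j) lN xj1 xj.
  have dimPx1 : (\dim (P + <[x]>) = \dim P + 1)%N.
    by have := dimPx N (leqnn N); rewrite G_full !capvf ltn_ord.
  apply: IHk => [|||l lN].
  - by rewrite -ltnS sum_decr // (leq_ltn_trans _ t_le).
  - rewrite subv_add orthovDcap !subv_cap P_iso -!memvE xP mem_orthov1 fxx eqxx.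
    by rewrite andbT sub_orthovC -memvE xP.
  - move=> l lN; have := dim_perp_cap P lN; have := dim_perp_cap (P + <[x]>) lN.
    rewrite dimP // dimPx1 !dimPx ?leq_subr //.
    (* Adjoining [x] removes one unit at [j], where [P] grows, and one at [rev_ord j], where its
       orthogonal shrinks. *)
    have -> : psum (fun u => a u + t u + t (rev_ord u))%N l =
        (psum (fun u => a u + decr j t u + decr j t (rev_ord u)) l
          + (j < l) + (rev_ord j < l))%N.
      rewrite -(psum_delta j l) -(psum_delta (rev_ord j) l) -!psumD.
      apply: eq_psum => u; rewrite {1}(decrK tj u) {1}(decrK tj (rev_ord u)).
      rewrite (inv_eq rev_ordK) !addnA; congr (_ + _)%N; exact: addnAC.
    rewrite rev_dimN; have := leq_dimN j; rewrite /dimN in lN *.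
    vlia.
  - rewrite r_def // dimPx // -addnA; congr (_ + _)%N.
    rewrite -(psum_delta j l) -psumD; apply: eq_psum => u.
    by rewrite {1}(decrK tj u) addnC.
set M := psum _ in cardX.
(* This makes [X] nonempty. For [j > n] the subtraction is genuine by [reduced_pos]; for [j = n] the
   jump of [M] is [a j + 2 * t j > 1]. *)
have lt_exp : (M j - (n < j) < M j.+1 - (n <= j))%N.
  have := reduced_pos P_iso dimP (l := j); rewrite -/M.
  have := leq_dimN j; have := rev_dimN j; rewrite {2 3}/M psumS -/M.
  have [jn|nj|jn] := ltngtP j n => revj jle => [_|/(_ (ltnW (ltn_ord j)))|_].
  - lia.
  - lia.
  - have -> : rev_ord j = j by apply/ord_inj; rewrite revj; lia.
    lia.
have [x0 x0X] : exists x0, x0 \in X.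
  by apply/card_gt0P; rewrite cardX subn_gt0 ltn_exp2l ?card_F_gt1 // ltn_add2l.
apply: (horner_of_step tj (card_step G_mono (Phi := fun W => (W <= perp W)%VS)
    (good := fun x => (x \in perp P) && (f x x == 0)) _ r_def t0 _) _
    (step x0 x0X) (isotropic_count_decr a_odd tj t0)).
- move=> W PW W_iso x xW; rewrite (mem_orthovP (subvP W_iso _ xW)) // eqxx andbT.
  by apply: (subvP (orthovS f PW)); apply: (subvP W_iso).
- by move=> x xX; apply/eqP; rewrite -eqz_nat !step.
rewrite -/X cardX -horner_Xn_sub ?leq_add2l ?(ltnW lt_exp) //; congr _.[_].
by rewrite mulrBr -!exprD.
Qed.

End IsotropicCounting.

(** * Flags and orbits *)

Section RankFunction.

Variable n : nat.
Local Notation N := (dimN n).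
Implicit Types (b : 'I_N -> 'I_N -> nat) (k l : 'I_N).

(** Corner sums stand for the dimensions of the intersections of the steps of two flags; they
    compare more directly between flags than the entries, their second differences. *)
Definition rk b (i j : nat) : nat := psum (fun k => psum (b k) j) i.

Lemma rk0l b j : rk b 0 j = 0%N.
Proof. exact: psum0. Qed.

Lemma rkSl b k j : rk b k.+1 j = (rk b k j + psum (b k) j)%N.
Proof. exact: psumS. Qed.

Lemma rk_row_full b i j : (j <= N)%N ->
  (forall k l, (k < i)%N -> (j <= l)%N -> b k l = 0%N) -> rk b i j = rk b i N.
Proof.
move=> jN b0; apply: eq_bigr => k ki; rewrite psum_full /psum.
rewrite big_mkcond; apply: eq_bigr => l _.
by case: ltnP => // jl; rewrite b0.
Qed.

Lemma rk_col_full b i j : (i <= N)%N ->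
  (forall k l, (i <= k)%N -> (l < j)%N -> b k l = 0%N) -> rk b i j = rk b N j.
Proof.
move=> iN b0; rewrite /rk psum_full /psum.
rewrite big_mkcond; apply: eq_bigr => k _.
by case: ltnP => // ik; rewrite big1 // => l lj; rewrite b0.
Qed.

Lemma rk_split b i j : (i <= N)%N -> (j <= N)%N ->
  (rk b N N + rk b i j =
   rk b i N + rk b N j + \sum_(k < N | i <= k) \sum_(l < N | j <= l) b k l)%N.
Proof.
move=> iN jN; have rowE k : psum (b k) N = (psum (b k) j + \sum_(l < N | j <= l) b k l)%N.
  rewrite psum_full (bigID (fun l : 'I_N => l < j)%N) /=; congr (_ + _)%N.
  by apply: eq_bigl => l; rewrite -leqNgt.
have colE (g : 'I_N -> nat) : psum g N = (psum g i + \sum_(k < N | i <= k) g k)%N.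
  rewrite psum_full (bigID (fun l : 'I_N => l < i)%N) /=; congr (_ + _)%N.
  by apply: eq_bigl => l; rewrite -leqNgt.
have rkNN : rk b N N = _ := colE _; have rkNj : rk b N j = _ := colE _.
rewrite rkNN rkNj -/(rk b i N) -/(rk b i j).
have -> : (\sum_(k < N | i <= k) psum (b k) N = \sum_(k < N | i <= k) psum (b k) j +
    \sum_(k < N | i <= k) \sum_(l < N | j <= l) b k l)%N.
  by rewrite -big_split; apply: eq_bigr => k _; rewrite rowE.
rewrite !addnA addnAC; congr (_ + _)%N; exact: addnAC.
Qed.

(** The counterpart of [dim_cap_orthov] for matrices: the symmetry carries the corner at (N-i, N-j)
    to the block opposite to the corner at (i, j). *)
Lemma rk_rev b i j : (forall k l, b (rev_ord k) (rev_ord l) = b k l) ->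
  (i <= N)%N -> (j <= N)%N ->
  (rk b (N - i) (N - j) + rk b i N + rk b N j = rk b N N + rk b i j)%N.
Proof.
move=> b_rev iN jN; rewrite rk_split //.
suff -> : rk b (N - i) (N - j) =
    (\sum_(k < N | i <= k) \sum_(l < N | j <= l) b k l)%N by lia.
have rev_lt (u : 'I_N) a : (a <= N)%N -> (rev_ord u < N - a)%N = (a <= u)%N.
  by move=> aN; rewrite rev_dimN; have := leq_dimN u; rewrite /dimN in aN *; lia.
rewrite /rk /psum (reindex_inj rev_ord_inj).
apply: eq_big => k; first exact: rev_lt.
move=> _; rewrite (reindex_inj rev_ord_inj).
by apply: eq_big => l; [exact: rev_lt | rewrite b_rev].
Qed.

End RankFunction.

Lemma dimN_sub_le n i : (n < i)%N -> (dimN n - i <= n)%N.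
Proof. by rewrite /dimN; lia. Qed.

Section FlagTheory.

Variables (n d : nat) (F : finFieldType) (f : {symmetric 'rV[F]_(dimN d)}).
Local Notation N := (dimN n).
Local Notation D := (dimN d).
Local Notation perp := (orthov f).
Implicit Types (V : chain n d F) (A : Xi n d).

Lemma flagsP V : reflect
  [/\ step V 0 = 0%VS, step V N = fullv,
      forall i, (i < N)%N -> (step V i <= step V i.+1)%VS &
      forall i, (i <= N)%N -> step V i = perp (step V (N - i))]
  (V \in flags n f).
Proof.
rewrite inE; apply: (iffP and4P) => -[V0 VN Vm Vp]; split.
- exact/eqP.
- exact/eqP.
- by move=> i iN; apply: (forallP Vm (Ordinal iN)).
- by move=> i iN; apply/eqP; apply: (forallP Vp (Ordinal (iN : (i < N.+1)%N))).
- exact/eqP.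
- exact/eqP.
- by apply/forallP => i; apply: Vm.
- by apply/forallP => i; apply/eqP/Vp; rewrite -ltnS.
Qed.

Lemma flag_mono V i j : V \in flags n f -> (i <= j <= N)%N ->
  (step V i <= step V j)%VS.
Proof.
move=> /flagsP[_ _ Vm _] /andP[ij]; elim: j ij => [|j IHj].
  by rewrite leqn0 => /eqP-> _; apply: subvv.
rewrite leq_eqVlt => /predU1P[-> _|ij jN]; first exact: subvv.
by apply: subv_trans (IHj _ _) (Vm _ _) => //; apply: ltnW.
Qed.

Lemma flag_full V : V \in flags n f -> step V N = fullv.
Proof. by case/flagsP. Qed.

Lemma flag_perp V i : V \in flags n f -> (i <= N)%N ->
  perp (step V i) = step V (N - i).
Proof.
case/flagsP=> _ _ _ Vp iN; rewrite [RHS]Vp ?leq_subr //.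
by rewrite subKn.
Qed.

Lemma flag_isotropic V : V \in flags n f -> (step V n <= perp (step V n))%VS.
Proof.
by move=> Vf; rewrite flag_perp ?flag_mono // /dimN; lia.
Qed.

Lemma flag_isotropic_le V i : V \in flags n f -> (i <= n)%N ->
  (step V i <= perp (step V i))%VS.
Proof.
move=> Vf i_n; have Vin : (step V i <= step V n)%VS.
  by apply: flag_mono => //; rewrite i_n /dimN; lia.
exact: subv_trans Vin (subv_trans (flag_isotropic Vf) (orthovS f Vin)).
Qed.

Lemma eq_flags V V' : V \in flags n f -> V' \in flags n f ->
  (forall i, (i <= n)%N -> step V i = step V' i) -> V = V'.
Proof.
move=> Vf Vf' VV'; apply/ffunP => i; have iN : (i <= N)%N by rewrite -ltnS.
rewrite -[i]inord_val -/(step V i) -/(step V' i).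
have [/VV'//|ni] := leqP i n; have [_ _ _ ->] := flagsP _ Vf => //.
have [_ _ _ ->] := flagsP _ Vf' => //; rewrite VV' //.
exact: dimN_sub_le.
Qed.

Lemma rel_posE V V' (i j : 'I_N) :
  V \in flags n f -> V' \in flags n f ->
  (rel_pos V V' i j + \dim (step V i :&: step V' j.+1) +
     \dim (step V i.+1 :&: step V' j) =
   \dim (step V i.+1 :&: step V' j.+1) + \dim (step V i :&: step V' j))%N.
Proof.
move=> Vf Vf'; have ViS : (step V i <= step V i.+1)%VS by rewrite flag_mono // leqnSn /=.
have VjS : (step V' j <= step V' j.+1)%VS by rewrite flag_mono // leqnSn /=.
have dim_sum (U : {vspace 'rV[F]_D}) :
    (\dim (step V i + (step V i.+1 :&: U)) + \dim (step V i :&: U) =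
     \dim (step V i) + \dim (step V i.+1 :&: U))%N.
  by rewrite -(dimv_sum_cap (step V i)) capvA (capv_idPl ViS).
have le_sum : (\dim (step V i + (step V i.+1 :&: step V' j)) <=
               \dim (step V i + (step V i.+1 :&: step V' j.+1)))%N.
  by apply/dimvS/addvS => //; apply: capvS.
have := dim_sum (step V' j); have := dim_sum (step V' j.+1).
rewrite /rel_pos /pos /=; move: le_sum; vlia.
Qed.

(** By [rel_posE] a relative position is a mixed second difference of dimensions of intersections,
    which summation over corners inverts. *)
Lemma orbitP A V V' : V \in flags n f -> V' \in flags n f ->
  reflect (forall i j, (i <= N)%N -> (j <= N)%N ->
             (\dim (step V i :&: step V' j) = rk A i j)%N)
          (in_orbit_of A V V').
Proof.
move=> Vf Vf'; have [V0 _ _ _] := flagsP _ Vf; have [V'0 _ _ _] := flagsP _ Vf'.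
apply: (iffP forallP) => [relV|dimV i].
  have {}relV (i j : 'I_N) : rel_pos V V' i j = A i j.
    by apply/esym/eqP; apply: (forallP (relV i)).
  elim=> [|i IHi] j iN jN; first by rewrite V0 cap0v dimv0 rk0l.
  rewrite -[i]/(nat_of_ord (Ordinal iN)) rkSl -IHi //=; last exact: ltnW.
  elim: j jN => [|j IHj] jN.
    by rewrite V'0 !capv0 dimv0 psum0.
  rewrite -[j.+1]/((nat_of_ord (Ordinal jN)).+1) psumS.
  have := rel_posE (Ordinal iN) (Ordinal jN) Vf Vf'; rewrite relV /=.
  by have := IHj (ltnW jN); vlia.
apply/forallP => j; apply/eqP; have := rel_posE i j Vf Vf'.
rewrite !dimV ?(ltnW (ltn_ord _)) //.
by rewrite !rkSl psumS; lia.
Qed.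

End FlagTheory.

Lemma idx_val n k : (k <= n.+1)%N -> idx n k = k.-1 :> nat.
Proof. by move=> kn; rewrite inordK // ltnS; lia. Qed.

Lemma EthetaE n (i j k l : 'I_(dimN n)) :
  Etheta i j k l = ((k == i) && (l == j) : nat)%:Z +
                   ((k == rev_ord i) && (l == rev_ord j) : nat)%:Z.
Proof. by rewrite !mxE !natz. Qed.

Section Orbits.

Variables (n d : nat).
Local Notation N := (dimN n).
Local Notation D := (dimN d).
Implicit Types (A B C : Xi n d).

Lemma xi_rev A i j : A (rev_ord i) (rev_ord j) = A i j.
Proof.
rewrite /entry; case: A => M /= /andP[_ /forallP/(_ i)/forallP/(_ j)/eqP Mij].
by rewrite -Mij.
Qed.

Lemma rk_total A : rk A N N = D.
Proof.
rewrite /rk psum_full; under eq_bigr => k _ do rewrite psum_full.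
by rewrite /entry; case: A => M /= /andP[/eqP].
Qed.

Section Adjacent.

Variables (h R : nat).
Hypothesis h_range : (1 <= h <= n)%N.

Lemma diag_entry (i j : 'I_N) B (k l : 'I_N) :
  is_diag_mx (mxZ B - Etheta i j *+ R) -> k != l ->
  B k l = (((k == i) && (l == j)) * R +
           ((k == rev_ord i) && (l == rev_ord j)) * R)%N.
Proof.
move=> /is_diag_mxP diagB kl; have := diagB k l kl.
rewrite mxE [X in X + _]mxE [X in _ + X]mxE mulmxnE EthetaE => /eqP.
rewrite subr_eq0 => /eqP.
move=> BE; apply/eqP; rewrite -eqz_nat BE -mulr_natr natz PoszD !PoszM.
by rewrite mulrDl.
Qed.

Let idx_h : idx n h = h.-1 :> nat.
Proof. by apply: idx_val; lia. Qed.
Let idx_hS : idx n h.+1 = h :> nat.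
Proof. by apply: idx_val; lia. Qed.
Let rev_h : rev_ord (idx n h) = (n.*2 - h).+1 :> nat.
Proof. by rewrite rev_dimN idx_h; lia. Qed.
Let rev_hS : rev_ord (idx n h.+1) = (n.*2 - h)%N :> nat.
Proof. by rewrite rev_dimN idx_hS. Qed.

Let pair_eq (k l : 'I_N) (i j : 'I_N) :
  (k == i) && (l == j) = (k == i :> nat) && (l == j :> nat).
Proof. by rewrite -!val_eqE. Qed.

Let and_false (a b c e : nat) : ~ (a = b /\ c = e) -> (a == b) && (c == e) = false.
Proof. by move=> ab; apply/negP => /andP[/eqP ? /eqP ?]; apply: ab. Qed.

Section Upper.

Variable B : Xi n d.
Hypothesis diagB : is_diag_mx (mxZ B - Etheta (idx n h) (idx n h.+1) *+ R).

Lemma upper_eq0 (k l : 'I_N) : k <> l :> nat -> ~ (k = h.-1 :> nat /\ l = h :> nat) ->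
  ~ (k = (n.*2 - h).+1 :> nat /\ l = (n.*2 - h)%N :> nat) -> B k l = 0%N.
Proof.
move=> kl nB nB'; rewrite (diag_entry diagB); last by apply/eqP => /(congr1 val).
by rewrite !pair_eq idx_h idx_hS rev_h rev_hS !and_false.
Qed.

Lemma upper_eqR (k l : 'I_N) : k = h.-1 :> nat -> l = h :> nat -> B k l = R.
Proof.
move=> kh lh; rewrite (diag_entry diagB); last by rewrite -val_eqE /= kh lh; lia.
rewrite !pair_eq idx_h idx_hS rev_h rev_hS kh lh !eqxx mul1n.
by rewrite and_false ?mul0n ?addn0 //; lia.
Qed.

(** On a pair (V, V') in the orbit of [B] this means that V'_j is contained in V_i; equality with
    the full row sum, as in [rk_upper_row], means the reverse inclusion. *)
Lemma rk_upper_col i j : (i <= n)%N -> (j <= i)%N -> rk B i j = rk B N j.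
Proof.
move=> i_n ji; apply: rk_col_full => [|k l ik lj]; first by rewrite /dimN; lia.
by apply: upper_eq0; lia.
Qed.

Lemma rk_upper_row i j : (i <= n)%N -> (i <= j <= N)%N -> i != h \/ (i < j)%N ->
  rk B i j = rk B i N.
Proof.
move=> i_n /andP[ij jN] ih; apply: rk_row_full => // k l ki jl.
by apply: upper_eq0; move: ih; lia.
Qed.

Lemma rk_upper_h : rk B h N = (rk B N h + R)%N.
Proof.
rewrite -(@rk_upper_col h h) //; last by lia.
rewrite -(@rk_upper_row h h.+1); try (rewrite /dimN; lia).
have hE : h = (idx n h).+1 by rewrite idx_h; lia.
rewrite {1 3}hE !rkSl idx_h.
rewrite (@rk_upper_row h.-1 h); try (rewrite /dimN; lia).
rewrite (@rk_upper_row h.-1 h.+1); try (rewrite /dimN; lia).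
by rewrite -addnA -[X in psum _ X.+1]idx_hS psumS idx_hS (upper_eqR idx_h idx_hS).
Qed.

End Upper.

Section Lower.

Variable C : Xi n d.
Hypothesis diagC : is_diag_mx (mxZ C - Etheta (idx n h.+1) (idx n h) *+ R).

Lemma lower_eq0 (k l : 'I_N) : k <> l :> nat -> ~ (k = h :> nat /\ l = h.-1 :> nat) ->
  ~ (k = (n.*2 - h)%N :> nat /\ l = (n.*2 - h).+1 :> nat) -> C k l = 0%N.
Proof.
move=> kl nC nC'; rewrite (diag_entry diagC); last by apply/eqP => /(congr1 val).
by rewrite !pair_eq idx_h idx_hS rev_h rev_hS !and_false.
Qed.

Lemma lower_eqR (k l : 'I_N) : k = h :> nat -> l = h.-1 :> nat -> C k l = R.
Proof.
move=> kh lh; rewrite (diag_entry diagC); last by rewrite -val_eqE /= kh lh; lia.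
rewrite !pair_eq idx_h idx_hS rev_h rev_hS kh lh !eqxx mul1n.
by rewrite and_false ?mul0n ?addn0 //; lia.
Qed.

Lemma rk_lower_row i j : (i <= n)%N -> (i <= j <= N)%N -> rk C i j = rk C i N.
Proof.
move=> i_n /andP[ij jN]; apply: rk_row_full => // k l ki jl.
by apply: lower_eq0; lia.
Qed.

Lemma rk_lower_col i j : (i <= n.+1)%N -> (j <= i)%N -> (j <= n)%N ->
  i != h \/ (j < i)%N -> j != h \/ (h < i)%N -> rk C i j = rk C N j.
Proof.
move=> i_n ji jn ih jh; apply: rk_col_full => [|k l ik lj]; first by rewrite /dimN; lia.
by apply: lower_eq0; move: ih jh; lia.
Qed.

Lemma rk_lower_h : rk C N h = (rk C h N + R)%N.
Proof.
rewrite -(@rk_lower_row h h) //; try (rewrite /dimN; lia).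
rewrite -(@rk_lower_col h.+1 h); try lia.
rewrite -{1}idx_hS rkSl idx_hS; congr (_ + _)%N.
have hE : h = (idx n h).+1 by rewrite idx_h; lia.
rewrite {2}hE psumS (lower_eqR idx_hS idx_h) psum_eq0 // => u; rewrite idx_h => uh.
by apply: lower_eq0; rewrite ?idx_hS; lia.
Qed.

End Lower.
End Adjacent.

Variables (F : finFieldType) (f : {symmetric 'rV[F]_D}).
Local Notation perp := (orthov f).
Implicit Types (V : chain n d F) (W : {vspace 'rV[F]_D}).
Hypothesis f_nondeg : nondegenerate f.

(** For [i > n], orthogonality expresses the dimensions through the index [N - i <= n], and [rk_rev]
    is the same relation for [A]. *)
Lemma orbit_of_half A V V' : V \in flags n f -> V' \in flags n f ->
  (forall i j, (i <= n)%N -> (j <= N)%N ->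
     (\dim (step V i :&: step V' j) = rk A i j)%N) ->
  (forall j, (j <= N)%N -> (\dim (step V' j) = rk A N j)%N) ->
  in_orbit_of A V V'.
Proof.
move=> Vf Vf' dimV dimV'; apply/(orbitP _ Vf Vf') => i j iN jN.
have [iN2|iN2] := leqP i n; first exact: dimV.
have i'n : (N - i <= n)%N := dimN_sub_le iN2.
have := dim_cap_orthov f_nondeg (step V (N - i)) (step V' (N - j)).
rewrite !(flag_perp, subKn, leq_subr) //.
have := rk_rev (xi_rev A) (leq_subr i N) (leq_subr j N).
rewrite !subKn // dimV ?leq_subr // dimV' ?leq_subr //.
have := dimV (N - i)%N N i'n (leqnn N); rewrite (flag_full Vf') capvf rk_total => ->.
vlia.
Qed.

Lemma orbit_diml A V V' i : V \in flags n f -> V' \in flags n f ->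
  in_orbit_of A V V' -> (i <= N)%N -> (\dim (step V i) = rk A i N)%N.
Proof.
move=> Vf Vf' orb iN; have := elimT (orbitP A Vf Vf') orb i N iN (leqnn N).
by rewrite (flag_full Vf') capvf.
Qed.

Lemma orbit_dimr A V V' j : V \in flags n f -> V' \in flags n f ->
  in_orbit_of A V V' -> (j <= N)%N -> (\dim (step V' j) = rk A N j)%N.
Proof.
move=> Vf Vf' orb jN; have := elimT (orbitP A Vf Vf') orb N j (leqnn N) jN.
by rewrite (flag_full Vf) capfv.
Qed.

End Orbits.

(** * Structure constants of the Chevalley generators *)

Section AdjacentFlags.

Variables (n d : nat).
Local Notation N := (dimN n).
Local Notation D := (dimN d).
Implicit Types (A B C : Xi n d).

Lemma rk_ro_co A B i : ro A = co B -> rk A i N = rk B N i.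
Proof.
move=> roA; rewrite /rk [RHS]psum_full /psum [RHS]exchange_big /=.
apply: eq_bigr => k _; rewrite -/(psum (A k) N) psum_full.
by have := congr1 (fun g : {ffun 'I_N -> nat} => g k) roA; rewrite !ffunE.
Qed.

Variables (F : finFieldType) (f : {symmetric 'rV[F]_D}).
Local Notation perp := (orthov f).
Implicit Types (V : chain n d F) (W : {vspace 'rV[F]_D}).
Hypothesis f_nondeg : nondegenerate f.

Variables (h R : nat).
Hypothesis h_range : (1 <= h <= n)%N.

Let hN : (h <= N)%N. Proof. by rewrite /dimN; lia. Qed.
Let leqN i : (i <= n)%N -> (i <= N)%N. Proof. by rewrite /dimN; lia. Qed.

Definition agree_off V1 V := forall i, (i <= n)%N -> i != h -> step V i = step V1 i.

Section Upper.

Variable B : Xi n d.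
Hypothesis diagB : is_diag_mx (mxZ B - Etheta (idx n h) (idx n h.+1) *+ R).

Lemma upper_adjacent V1 V : V1 \in flags n f -> V \in flags n f ->
  in_orbit_of B V1 V -> agree_off V1 V /\ (step V h <= step V1 h)%VS.
Proof.
move=> V1f Vf orb; have dimV1V := elimT (orbitP B V1f Vf) orb.
have sub i : (i <= n)%N -> (step V1 i :&: step V i = step V i)%VS.
  move=> i_n; apply/eqP; rewrite eqEdim capvSr /= dimV1V ?leqN //.
  by rewrite (orbit_dimr V1f Vf orb) ?leqN // (rk_upper_col h_range diagB).
split=> [i i_n ih|]; last by rewrite -sub ?capvSl //; lia.
apply/eqP; rewrite eqEdim -{1}sub // capvSl /=.
rewrite -[step V i]sub // dimV1V ?leqN // (orbit_diml V1f Vf orb) ?leqN //.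
by rewrite (rk_upper_row h_range diagB) // ?leqN ?leqnn //; left.
Qed.

Lemma adjacent_upper V1 V : V1 \in flags n f -> V \in flags n f ->
  agree_off V1 V -> (step V h <= step V1 h)%VS ->
  (forall i, (i <= N)%N -> \dim (step V i) = rk B N i :> nat) ->
  (\dim (step V1 h) = \dim (step V h) + R)%N ->
  in_orbit_of B V1 V.
Proof.
move=> V1f Vf agree subh dimV dimh; apply: (orbit_of_half f_nondeg V1f Vf _ dimV) => i j i_n jN.
have sub k : (k <= n)%N -> (step V k <= step V1 k)%VS.
  by move=> kn; have [->//|kh] := eqVneq k h; rewrite agree.
have dimV1 : (\dim (step V1 i) = rk B i N)%N.
  have [ih|ih] := eqVneq i h.
    by rewrite ih dimh dimV // (rk_upper_h h_range diagB).
  rewrite -agree // dimV ?leqN // -(rk_upper_col h_range diagB i_n (leqnn i)).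
  by rewrite (rk_upper_row h_range diagB) // ?leqN ?leqnn //; left.
have [ji|ij] := leqP j i.
  rewrite (capv_idPr _) ?dimV ?(rk_upper_col h_range diagB) //.
  apply: subv_trans (sub j _) _; first exact: leq_trans i_n.
  by rewrite (flag_mono V1f) // ji leqN.
suff V1iVj : (step V1 i <= step V j)%VS.
  have ij' : (i <= j <= N)%N by rewrite ltnW.
  by rewrite (capv_idPl V1iVj) dimV1 (rk_upper_row h_range diagB i_n ij' (or_intror ij)).
have [jn|nj] := leqP j n.
  have [jh|jh] := eqVneq j h; last first.
    by rewrite agree // (flag_mono V1f) // ltnW //= leqN.
  by rewrite -agree ?(flag_mono Vf) ?(ltnW ij) //; rewrite -jh ?ltn_eqF.
(* Past the middle the inclusion comes from isotropy: V1_n lies in its orthogonal, hence in the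
   orthogonal of the smaller V_n, which is V_(n+1). *)
apply: (@subv_trans _ _ (step V1 n)); first by rewrite (flag_mono V1f) // i_n leqN.
apply: (@subv_trans _ _ (step V n.+1)); last by rewrite (flag_mono Vf) // nj.
apply: (subv_trans (flag_isotropic V1f)); apply: (subv_trans (orthovS f (sub n (leqnn n)))).
by rewrite (flag_perp Vf) ?leqN // (_ : N - n = n.+1)%N // /dimN; lia.
Qed.

End Upper.

Section Lower.

Variable C : Xi n d.
Hypothesis diagC : is_diag_mx (mxZ C - Etheta (idx n h.+1) (idx n h) *+ R).

Lemma lower_adjacent V1 V : V1 \in flags n f -> V \in flags n f ->
  in_orbit_of C V1 V -> agree_off V1 V /\ (step V1 h <= step V h)%VS.
Proof.
move=> V1f Vf orb; have dimV1V := elimT (orbitP C V1f Vf) orb.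
have sub i : (i <= n)%N -> (step V1 i :&: step V i = step V1 i)%VS.
  move=> i_n; apply/eqP; rewrite eqEdim capvSl /= dimV1V ?leqN //.
  by rewrite (orbit_diml V1f Vf orb) ?leqN // (rk_lower_row h_range diagC) ?leqnn ?leqN.
split=> [i i_n ih|]; last by rewrite -sub ?capvSr //; lia.
apply/esym/eqP; rewrite eqEdim -{1}sub // capvSr /=.
rewrite -[step V1 i]sub // dimV1V ?leqN // (orbit_dimr V1f Vf orb) ?leqN //.
by rewrite (rk_lower_col h_range diagC) ?leqnn //; [lia|left|left].
Qed.

Lemma adjacent_lower V1 V : V1 \in flags n f -> V \in flags n f ->
  agree_off V1 V -> (step V1 h <= step V h)%VS ->
  (forall i, (i <= N)%N -> \dim (step V i) = rk C N i :> nat) ->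
  (\dim (step V h) = \dim (step V1 h) + R)%N ->
  in_orbit_of C V1 V.
Proof.
move=> V1f Vf agree subh dimV dimh; apply: (orbit_of_half f_nondeg V1f Vf _ dimV) => i j i_n jN.
have sub k : (k <= n)%N -> (step V1 k <= step V k)%VS.
  by move=> kn; have [->//|kh] := eqVneq k h; rewrite agree.
have dimV1 : (\dim (step V1 i) = rk C i N)%N.
  have [ih|ih] := eqVneq i h.
    apply/eqP; rewrite ih -(eqn_add2r R) -dimh dimV //.
    by rewrite (rk_lower_h h_range diagC).
  rewrite -agree // dimV ?leqN // -(rk_lower_row h_range diagC i_n (_ : i <= i <= N)%N).
    by rewrite (rk_lower_col h_range diagC) ?leqnn //; [lia|left|left].
  by rewrite leqnn leqN.
have [ij|ji] := leqP i j.
  rewrite (capv_idPl _) ?dimV1 ?(rk_lower_row h_range diagC) ?ij //.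
  by apply: subv_trans (sub i i_n) _; rewrite (flag_mono Vf) // ij.
rewrite (capv_idPr _).
  rewrite dimV // (rk_lower_col h_range diagC) ?(ltnW ji) //; try lia.
have [jh|jh] := eqVneq j h.
  by rewrite -[step V1 i]agree ?(flag_mono Vf) ?(ltnW ji) ?leqN //; lia.
by rewrite agree ?(flag_mono V1f) ?(ltnW ji) ?leqN //; lia.
Qed.

End Lower.

Definition replace V1 W : chain n d F :=
  [ffun i : 'I_N.+1 => if i == h :> nat then W
     else if i == (N - h)%N :> nat then perp W else V1 i].

Lemma step_replace V1 W i : (i <= N)%N ->
  step (replace V1 W) i =
    if i == h then W else if i == (N - h)%N then perp W else step V1 i.
Proof. by move=> iN; rewrite /step ffunE !inordK. Qed.

(** For [h = n] the term after [W] is [perp W], so the bound from above is the isotropy of [W];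
    hence the guard [h < n]. *)
Lemma replace_flag V1 W : V1 \in flags n f ->
  (step V1 h.-1 <= W)%VS -> (W <= perp W)%VS ->
  ((h < n)%N -> (W <= step V1 h.+1)%VS) -> replace V1 W \in flags n f.
Proof.
move=> V1f V1W W_iso WV1.
have [V10 V1N _ V1p] := elimT (flagsP f V1) V1f.
have NhN : (N - h = (n.*2 - h).+1)%N by rewrite /dimN; lia.
apply/flagsP; split.
- rewrite step_replace //; have -> : (0 == h)%N = false by lia.
  by rewrite NhN.
- rewrite step_replace //; have -> : (N == h)%N = false by rewrite /dimN; lia.
  by have -> : (N == N - h)%N = false by rewrite /dimN; lia.
- move=> i iN; rewrite !step_replace ?(ltnW iN) //.
  have [ih|ih] := eqVneq i h.
    have -> : (i.+1 == h)%N = false by lia.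
    have [hn|hn] := eqVneq h n.
      by have -> : (i.+1 == N - h)%N by rewrite NhN; lia.
    have -> : (i.+1 == N - h)%N = false by rewrite NhN; lia.
    by rewrite ih; apply: WV1; lia.
  have [iNh|iNh] := eqVneq i (N - h)%N.
    have -> : (i.+1 == h)%N = false by lia.
    have -> : (i.+1 == N - h)%N = false by lia.
    rewrite -[step V1 _](orthovK f_nondeg) orthovS // (flag_perp V1f) //.
    have -> // : (N - i.+1 = h.-1)%N by move: iN; rewrite /dimN in iNh *; lia.
  have [iSh|iSh] := eqVneq i.+1 h.
    by have -> // : i = h.-1 by lia.
  have [iSNh|iSNh] := eqVneq i.+1 (N - h)%N; last first.
    by rewrite (flag_mono V1f) // leqnSn.
  rewrite -[step V1 _](orthovK f_nondeg) orthovS // (flag_perp V1f) ?(ltnW iN) //.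
  have -> : (N - i = h.+1)%N by lia.
  by apply: WV1; lia.
- move=> i iN; rewrite !step_replace ?leq_subr //.
  have -> : (N - i == N - h)%N = (i == h) by rewrite /dimN in iN *; lia.
  have [ih|ih] := eqVneq i h.
    have -> : (N - i == h)%N = false by lia.
    by rewrite orthovK.
  have -> : (N - i == h)%N = (i == N - h)%N by rewrite /dimN in iN *; lia.
  by case: eqP => // _; apply: V1p.
Qed.

End AdjacentFlags.

(** * Shifts of matrices and their corner sums *)

Section Shift.

Variables (n d h R : nat).
Local Notation N := (dimN n).
Hypothesis h_range : (1 <= h <= n)%N.
Implicit Types (A : Xi n d) (t : tvec n R).

Lemma shiftE t (k l : 'I_N) :
  shift h t k l =
    ((k == h.-1 :> nat)%:R - (k == h :> nat)%:R) * (t l : nat)%:Z +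
    ((rev_ord k == h.-1 :> nat)%:R - (rev_ord k == h :> nat)%:R) *
      (t (rev_ord l) : nat)%:Z.
Proof.
have idx_eq i (k' : 'I_N) : (i <= n.+1)%N -> (k' == idx n i) = (k' == i.-1 :> nat).
  by move=> i_n; rewrite -val_eqE /= idx_val.
have pick (c : int) (l' : 'I_N) :
    \sum_u c * (l' == u)%:R * (t u : nat)%:Z = c * (t l' : nat)%:Z.
  rewrite (bigD1 l') //= eqxx mulr1 big1 ?addr0 // => u ul.
  by rewrite eq_sym (negbTE ul) mulr0 mul0r.
rewrite /shift summxE -!pick -big_split /=; apply: eq_bigr => u _.
rewrite mulmxnE !mxE -!(canF_eq rev_ordK) !idx_eq; try lia.
by rewrite -mulr_natr natz -!mulnb !natrM /=; ring.
Qed.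

Lemma shift_col_sum t (l : 'I_N) : \sum_k shift h t k l = 0.
Proof.
have h1N : (h.-1 < N)%N by rewrite /dimN; lia.
have hN : (h < N)%N by rewrite /dimN; lia.
have one i (iN : (i < N)%N) : \sum_(k < N) (k == i :> nat)%:R = 1 :> int.
  rewrite (bigD1 (Ordinal iN)) //= eqxx big1 ?addr0 // => k.
  by rewrite -val_eqE /= => /negbTE->.
have one_rev i (iN : (i < N)%N) : \sum_(k < N) (rev_ord k == i :> nat)%:R = 1 :> int.
  by rewrite -(one i iN) [RHS](reindex_inj rev_ord_inj).
under eq_bigr => k _ do rewrite shiftE.
by rewrite big_split -!mulr_suml !sumrB !one // !one_rev // subrr !mul0r.
Qed.

(** The symmetry transports the zero rows past the middle, and the column sums then kill the middle
    row. *)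
Lemma mx_rev_eq0 (M : 'M[int]_N) :
  (forall k l, M (rev_ord k) (rev_ord l) = M k l) ->
  (forall k l : 'I_N, (k < n)%N -> M k l = 0) ->
  (forall l, \sum_k M k l = 0) -> M = 0.
Proof.
move=> M_rev M0 M_col; have M0' (k l : 'I_N) : k != n :> nat -> M k l = 0.
  have [kn _|nk _|//] := ltngtP k n.
    exact: M0.
  by rewrite -M_rev M0 // rev_dimN; have := leq_dimN k; lia.
apply/matrixP => k l; rewrite mxE; have [kn|] := eqVneq (k : nat) n; last exact: M0'.
rewrite -(M_col l) (bigD1 k) //= big1 ?addr0 // => k' k'k.
by apply: M0'; move: k'k; rewrite -val_eqE /= kn.
Qed.

Section Shifted.

Variables (A A' : Xi n d) (t : tvec n R).
Let T (u : 'I_N) : nat := t u.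

Lemma shift_row : mxZ A' = mxZ A + shift h t -> forall k l : 'I_N, (k < n)%N ->
  (A' k l + (k == h :> nat) * T l = A k l + (k == h.-1 :> nat) * T l)%N.
Proof.
move=> A'E k l kn; have := congr1 (fun M : 'M_N => M k l) A'E; rewrite !mxE shiftE.
have -> : (rev_ord k == h.-1 :> nat) = false by rewrite rev_dimN; lia.
have -> : (rev_ord k == h :> nat) = false by rewrite rev_dimN; lia.
by rewrite /T; case: eqP; case: eqP => *; lia.
Qed.

Lemma rk_shift : mxZ A' = mxZ A + shift h t -> forall i j, (i <= n)%N ->
  rk A' i j = (rk A i j + (i == h) * psum T j)%N.
Proof.
move=> A'E; elim=> [|i IHi] j i_n.
  by rewrite !rk0l; have -> : (0 == h)%N = false by lia.
have iN : (i < N)%N by rewrite /dimN; lia.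
have rkS (b : 'I_N -> 'I_N -> nat) :
    rk b i.+1 j = (rk b i j + psum (b (Ordinal iN)) j)%N := rkSl b (Ordinal iN) j.
rewrite !rkS IHi ?(ltnW i_n) //.
have psum_mul c : psum (fun u => c * T u)%N j = (c * psum T j)%N.
  by rewrite /psum big_distrr.
have : psum (fun u => A' (Ordinal iN) u + (i == h) * T u)%N j =
       psum (fun u => A (Ordinal iN) u + (i == h.-1) * T u)%N j.
  by apply: eq_psum => u; apply: (shift_row A'E).
rewrite !psumD !psum_mul; have -> : (i.+1 == h) = (i == h.-1) by lia.
by move=> e; rewrite -addnA [X in (_ + X)%N]addnC e addnA.
Qed.

Lemma rk_shift_full : mxZ A' = mxZ A + shift h t -> forall j, rk A' N j = rk A N j.
Proof.
move=> A'E j; rewrite /rk !psum_full /psum exchange_big [RHS]exchange_big.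
apply: eq_bigr => l _; apply/eqP; rewrite -eqz_nat; apply/eqP.
rewrite -![(\sum_(k < N) _)%N%:Z]natz !natr_sum.
have A'kl k : (A' k l)%:R = (A k l)%:R + shift h t k l :> int.
  by have := congr1 (fun M : 'M_N => M k l) A'E; rewrite !mxE -!natz.
by rewrite (eq_bigr _ (fun k _ => A'kl k)) big_split /= shift_col_sum addr0.
Qed.

Lemma eq_shift :
  (forall i j, (i <= n)%N -> (j <= N)%N -> rk A' i j = (rk A i j + (i == h) * psum T j)%N) ->
  (forall j, (j <= N)%N -> rk A' N j = rk A N j) ->
  mxZ A' = mxZ A + shift h t.
Proof.
move=> rkE rkNE; apply/eqP; rewrite -subr_eq0 opprD addrA; apply/eqP.
apply: mx_rev_eq0 => [k l|k l kn|l].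
- by rewrite !mxE !xi_rev !shiftE !rev_ordK; congr (_ - _); rewrite addrC.
- have psumE j : (j <= N)%N -> (psum (A' k) j + (k == h :> nat) * psum T j =
      psum (A k) j + (k == h.-1 :> nat) * psum T j)%N.
    move=> jN; have := rkE k.+1 j kn jN; rewrite !rkSl rkE ?(ltnW kn) //.
    have -> : (k.+1 == h) = (k == h.-1 :> nat) by lia.
    lia.
  have := psumE l.+1 (ltn_ord l); have := psumE l (ltnW (ltn_ord l)).
  rewrite !psumS !mxE shiftE.
  have -> : (rev_ord k == h.-1 :> nat) = false by rewrite rev_dimN; lia.
  have -> : (rev_ord k == h :> nat) = false by rewrite rev_dimN; lia.
  by rewrite /T; case: eqP => ?; case: eqP => ?; rewrite ?mul1n ?mul0n; lia.
- have colE : (\sum_k A' k l = \sum_k A k l)%N.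
    have colS (b : 'I_N -> 'I_N -> nat) : rk b N l.+1 = (rk b N l + \sum_k b k l)%N.
      by rewrite /rk !psum_full -big_split; apply: eq_bigr => k _; rewrite psumS.
    have := rkNE l.+1 (ltn_ord l).
    by rewrite !colS rkNE ?(ltnW (ltn_ord l)) // => /addnI.
  under eq_bigr => k _ do rewrite !mxE -!natz.
  by rewrite !sumrB shift_col_sum subr0 -!natr_sum colE subrr.
Qed.

End Shifted.

(** The vector [t] is the difference of the rows of index [h]: the hypothesis on consecutive corner
    sums makes it nonnegative, the last one gives its sum. *)
Lemma exists_shift (A A' : Xi n d) :
  (forall i j, (i <= n)%N -> (j <= N)%N -> i != h -> rk A' i j = rk A i j) ->
  (forall j, (j <= N)%N -> rk A' N j = rk A N j) ->
  (forall j, (j < N)%N -> (rk A h j.+1 + rk A' h j <= rk A' h j.+1 + rk A h j)%N) ->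
  rk A' h N = (rk A h N + R)%N ->
  exists2 t : tvec n R, sum_is t & mxZ A' = mxZ A + shift h t.
Proof.
move=> rkE rkNE rk_le rkR.
have h_eq : h = (idx n h).+1 by rewrite idx_val; lia.
have rk_h1 j : (j <= N)%N -> rk A' (idx n h) j = rk A (idx n h) j.
  by move=> jN; apply: rkE => //; rewrite idx_val; lia.
have hS (b : 'I_N -> 'I_N -> nat) j : rk b h j = (rk b (idx n h) j + psum (b (idx n h)) j)%N.
  by rewrite {1}h_eq rkSl.
have A_le l : (A (idx n h) l <= A' (idx n h) l)%N.
  have := rk_le l (ltn_ord l); rewrite !hS !psumS !rk_h1 ?(ltnW (ltn_ord l)) //.
  lia.
pose s l := (A' (idx n h) l - A (idx n h) l)%N.
have psum_s j : (psum (A' (idx n h)) j = psum (A (idx n h)) j + psum s j)%N.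
  by rewrite -psumD; apply: eq_psum => l; rewrite subnKC.
have sum_s : (\sum_l s l)%N = R.
  by move: rkR; rewrite !hS rk_h1 // psum_s -psum_full; lia.
have s_le l : (s l < R.+1)%N by rewrite ltnS -sum_s (bigD1 l) //= leq_addr.
pose t : tvec n R := [ffun l => inord (s l)].
have tE l : (t l : nat) = s l by rewrite ffunE inordK.
exists t; first by rewrite /sum_is (eq_bigr s (fun l _ => tE l)) sum_s.
apply: eq_shift => // i j i_n jN; rewrite (eq_psum j tE).
have [->|ih] := eqVneq i h; last by rewrite addn0 rkE.
by rewrite mul1n !hS rk_h1 // psum_s addnA.
Qed.

End Shift.

Lemma odd_sum_rev n (g : 'I_(dimN n) -> nat) :
  (forall u, g (rev_ord u) = g u) -> odd (\sum_u g u) = odd (g (idx n n.+1)).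
Proof.
move=> g_rev; set mid := idx n n.+1; have midE : mid = n :> nat by rewrite idx_val.
have mid_eq u : (u == mid) = (u == n :> nat) by rewrite -val_eqE /= midE.
rewrite (bigD1 mid) //= oddD (bigID (fun u : 'I_(dimN n) => u < n)%N) /= oddD.
have -> : (\sum_(u | (u != mid) && (u < n)%N) g u =
           \sum_(u | (u != mid) && ~~ (u < n)%N) g u)%N.
  rewrite (reindex_inj rev_ord_inj); apply: eq_big => u; last by rewrite g_rev.
  by rewrite !mid_eq rev_dimN; have := leq_dimN u; lia.
by rewrite addbb addbF.
Qed.

Lemma xi_center_odd n d (A : Xi n d) : odd (A (idx n n.+1) (idx n n.+1)).
Proof.
have rev_mid : rev_ord (idx n n.+1) = idx n n.+1.
  by apply/ord_inj; rewrite rev_dimN idx_val //=; lia.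
rewrite -odd_sum_rev => [|u]; last by rewrite -{1}rev_mid xi_rev.
rewrite -(odd_sum_rev (g := fun k => (\sum_l A k l)%N)) => [|k].
  have := rk_total A; rewrite /rk psum_full.
  under eq_bigr => k _ do rewrite psum_full.
  by move=> ->; rewrite /dimN /= odd_double.
by rewrite (reindex_inj rev_ord_inj); apply: eq_bigr => l _; rewrite xi_rev.
Qed.

(** * Structure polynomials as counts of subspaces *)

Section StructurePolynomials.

Variables (n d h R : nat).
Local Notation N := (dimN n).
Local Notation D := (dimN d).
Hypothesis h_range : (1 <= h <= n)%N.
Implicit Types (A B C : Xi n d) (t : tvec n R).

Let hN : (h <= N)%N. Proof. by rewrite /dimN; lia. Qed.
Let h1N : (h.-1 <= N)%N. Proof. by rewrite /dimN; lia. Qed.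
Let leqN i : (i <= n)%N -> (i <= N)%N. Proof. by rewrite /dimN; lia. Qed.
Let h_n : (h <= n)%N. Proof. by case/andP: h_range. Qed.
Let h1_n : (h.-1 <= n)%N. Proof. exact: leq_trans (leq_pred h) h_n. Qed.
Let h1_neq : h.-1 != h. Proof. by case/andP: h_range => h_gt0; rewrite neq_ltn prednK ?leqnn. Qed.
Let h_row : (1 <= h <= n.+1)%N. Proof. by case/andP: h_range => -> /leqW->. Qed.

Section Counting.

Variables (F : finFieldType) (f : {symmetric 'rV[F]_D}).
Implicit Types (V : chain n d F) (W : {vspace 'rV[F]_D}).
Hypothesis f_nondeg : nondegenerate f.

(** Along [V2] the jumps of V_h are bounded by those of the larger V'_h, because V_h and V'_h :&:
    V2_j meet inside V2_(j+1) only in V_h :&: V2_j. *)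
Lemma exists_shift_flags A A' V V' V2 : V \in flags n f -> V' \in flags n f ->
  V2 \in flags n f -> in_orbit_of A V V2 -> in_orbit_of A' V' V2 ->
  agree_off h V V' -> (step V h <= step V' h)%VS ->
  (\dim (step V' h) = \dim (step V h) + R)%N ->
  exists2 t : tvec n R, sum_is t & mxZ A' = mxZ A + shift h t.
Proof.
move=> Vf V'f V2f orb orb' agree subh dimh.
have dimV := elimT (orbitP A Vf V2f) orb.
have dimV' := elimT (orbitP A' V'f V2f) orb'.
apply: exists_shift => // [i j i_n jN ih|j jN|j jN|].
- by rewrite -dimV' ?(leqN i_n) // -dimV ?(leqN i_n) // agree.
- by rewrite -(orbit_dimr V'f V2f orb') // -(orbit_dimr Vf V2f orb).
- have jN' := ltnW jN; rewrite -!dimV' // -!dimV //.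
  have jj : (step V2 j <= step V2 j.+1)%VS by rewrite (flag_mono V2f) // leqnSn.
  have := dimv_sum_cap (step V h :&: step V2 j.+1) (step V' h :&: step V2 j).
  have -> : (step V h :&: step V2 j.+1 :&: (step V' h :&: step V2 j))%VS =
            (step V h :&: step V2 j)%VS.
    apply/vspaceP => x; rewrite !memv_cap.
    case: (boolP (x \in step V h)) => [/(subvP subh)->|] //=.
    by case: (boolP (x \in step V2 j)) => [/(subvP jj)->|]; rewrite ?andbF.
  have : (step V h :&: step V2 j.+1 + step V' h :&: step V2 j <=
          step V' h :&: step V2 j.+1)%VS by rewrite subv_add !capvS.
  by move/dimvS; vlia.
- by rewrite -!(orbit_diml V'f V2f orb', orbit_diml Vf V2f orb).
Qed.

(** The map from [V] to its h-th step is injective, since the other steps up to [n] come from [V1],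
    and [replace] inverts it. The predicate [cond] lets one bijection serve both generators and the
    isotropic case. *)
Lemma card_adjacent B A A'' (cond : pred {vspace 'rV[F]_D}) V1 V2 :
  V1 \in flags n f -> V2 \in flags n f -> in_orbit_of A'' V1 V2 ->
  (forall i j, (i <= n)%N -> (j <= N)%N -> i != h -> rk A'' i j = rk A i j) ->
  (forall j, (j <= N)%N -> rk A'' N j = rk A N j) ->
  (forall V, V \in flags n f -> in_orbit_of B V1 V ->
     agree_off h V1 V /\ cond (step V h)) ->
  (forall W, cond W -> [/\ (step V1 h.-1 <= W)%VS, (W <= orthov f W)%VS &
     (h < n)%N -> (W <= step V1 h.+1)%VS]) ->
  (forall V, V \in flags n f -> agree_off h V1 V -> cond (step V h) ->
     in_orbit_of A V V2 -> in_orbit_of B V1 V) ->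
  #|[set V in flags n f | in_orbit_of B V1 V && in_orbit_of A V V2]| =
  #|[set W | cond W && cap_dims N (step V2) (rk A h) W]|.
Proof.
move=> V1f V2f orb'' rkE rkNE B_cond condP cond_B.
have dim'' := elimT (orbitP A'' V1f V2f) orb''.
set S := [set V in _ | _].
have S_inj : {in S &, injective (fun V : chain n d F => step V h)}.
  move=> V V' /setIdP[Vf /andP[VB _]] /setIdP[V'f /andP[V'B _]] VV'.
  have [agree _] := B_cond V Vf VB; have [agree' _] := B_cond V' V'f V'B.
  apply: (eq_flags Vf V'f) => i i_n.
  by have [->//|ih] := eqVneq i h; rewrite agree ?agree'.
rewrite -(card_in_imset S_inj); congr #|pred_of_set _|.
apply/setP => W; apply/imsetP/setIdP => [[V]|[condW /cap_dimsP dimW]].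
  move=> /setIdP[Vf /andP[VB VA]] ->; have [agree condV] := B_cond V Vf VB.
  by split=> //; apply/cap_dimsP => l lN; apply: (elimT (orbitP A Vf V2f) VA).
have [W1 W_iso W2] := condP W condW.
have Wf := replace_flag f_nondeg h_range V1f W1 W_iso W2.
have Wh : step (replace f h V1 W) h = W by rewrite step_replace // eqxx.
have W_agree : agree_off h V1 (replace f h V1 W).
  move=> i i_n ih; rewrite step_replace ?leqN // (negbTE ih).
  by have -> : (i == N - h)%N = false by rewrite /dimN; lia.
have WA : in_orbit_of A (replace f h V1 W) V2.
  apply: (orbit_of_half f_nondeg Wf V2f) => [i j i_n jN|j jN].
    have [->|ih] := eqVneq i h; first by rewrite Wh dimW.
    by rewrite W_agree // dim'' ?(leqN i_n) // rkE.
  by rewrite (orbit_dimr V1f V2f orb'') // rkNE.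
exists (replace f h V1 W); last by rewrite Wh.
by apply/setIdP; split=> //; rewrite WA andbT; apply: cond_B; rewrite ?Wh.
Qed.

End Counting.

Let row A (k : nat) : 'I_N -> nat := A (idx n k).

Let rk_row A k j : (1 <= k <= n.+1)%N -> rk A k j = (rk A k.-1 j + psum (row A k) j)%N.
Proof.
move=> k_range; have kE : k = (idx n k).+1 by rewrite idx_val; lia.
by rewrite {1}kE rkSl; congr (rk A _ j + _)%N; rewrite idx_val //; lia.
Qed.

Let rk_off A A' t : mxZ A' = mxZ A + shift h t ->
  forall i j, (i <= n)%N -> (j <= N)%N -> i != h -> rk A' i j = rk A i j.
Proof. by move=> A'E i j i_n _ /negbTE ih; rewrite (rk_shift h_range A'E) // ih addn0. Qed.

Let flag_cap_monoS (F : finFieldType) (f : {symmetric 'rV[F]_D})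
    (V : chain n d F) : V \in flags n f ->
  forall i j, (i <= j <= N)%N -> (step V i <= step V j)%VS.
Proof. move=> Vf i j; exact: (flag_mono Vf). Qed.

(** Between V1_(h-1) and V1_h the graded dimensions of [W] are a_hu and those of V1_h over [W] are
    t_u, so the arguments of [linear_count] are exchanged relative to the lower case. *)
Lemma struct_poly_upper A A'' B t :
  is_diag_mx (mxZ B - Etheta (idx n h) (idx n h.+1) *+ R) -> ro A = co B ->
  sum_is t -> mxZ A'' = mxZ A + shift h t ->
  is_struct_poly B A A'' (linear_count (fun u => t u : nat) (row A h)).
Proof.
move=> diagB roA /eqP sum_t A''E F f F_odd f_nondeg V1 V2 V1f V2f orb.
have dim'' := elimT (orbitP A'' V1f V2f) orb.
pose cond W := (step V1 h.-1 <= W)%VS && (W <= step V1 h)%VS.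
have V1h : (step V1 h <= orthov f (step V1 h))%VS.
  by apply: flag_isotropic_le => //; case/andP: h_range.
rewrite (card_adjacent (cond := cond) f_nondeg V1f V2f orb (rk_off A''E)).
- have -> : [set W | cond W && cap_dims N (step V2) (rk A h) W] =
      [set W | (step V1 h.-1 <= W)%VS &&
               ((W <= step V1 h)%VS && cap_dims N (step V2) (rk A h) W)].
    by apply/setP => W; rewrite !inE andbA.
  apply/esym/(card_linear (flag_cap_monoS V2f) (flag_full V2f)) => [|l lN|l lN].
  + by rewrite (flag_mono V1f) // leq_pred.
  + rewrite !dim'' // rk_row; last by lia.
    congr (_ + _)%N; apply: eq_psum => u.
    have := shift_row h_range A''E (k := idx n h) u.
    rewrite /row idx_val; last by lia.
    have -> : (h.-1 == h) = false by lia.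
    by rewrite eqxx mul0n mul1n addn0 addnC => ->; [|lia].
  + by rewrite dim'' // rk_row ?(rk_off A''E).
- by move=> j _; apply: (rk_shift_full h_range A''E).
- move=> V Vf VB; have [agree Vh] := upper_adjacent f_nondeg h_range diagB V1f Vf VB.
  by split=> //; rewrite /cond Vh -agree // (flag_mono Vf) // leq_pred hN.
- move=> W /andP[W1 W2]; split=> // [|hn].
    by apply: subv_trans W2 (subv_trans V1h (orthovS f W2)).
  by apply: subv_trans W2 _; rewrite (flag_mono V1f) // leqnSn leqN.
- move=> V Vf agree /andP[_ Vh] VA.
  apply: (adjacent_upper f_nondeg h_range diagB) => // [i iN|].
    by rewrite (orbit_diml Vf V2f VA) // (rk_ro_co i roA).
  rewrite (orbit_diml Vf V2f VA) // (orbit_diml V1f V2f orb) //.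
  by rewrite (rk_shift h_range A''E) ?eqxx ?mul1n ?psum_full ?sum_t.
Qed.

Lemma struct_poly_upper0 A A'' B :
  is_diag_mx (mxZ B - Etheta (idx n h) (idx n h.+1) *+ R) ->
  (forall t, sum_is t -> mxZ A'' <> mxZ A + shift h t) ->
  is_struct_poly B A A'' 0.
Proof.
move=> diagB no_t F f F_odd f_nondeg V1 V2 V1f V2f orb; rewrite horner0.
apply/esym/eqP; rewrite eqz_nat cards_eq0; apply/eqP/setP => V; rewrite [RHS]inE.
apply/negbTE/negP => /setIdP[Vf /andP[VB VA]].
have [agree Vh] := upper_adjacent f_nondeg h_range diagB V1f Vf VB.
have agree' : agree_off h V V1 by move=> i i_n ih; rewrite agree.
have [|t sum_t A''E] := exists_shift_flags f_nondeg Vf V1f V2f VA orb agree' Vh.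
- by rewrite (orbit_diml V1f Vf VB) // (orbit_dimr V1f Vf VB) // (rk_upper_h h_range diagB).
exact: no_t A''E.
Qed.

Lemma struct_poly_lower0 A A'' C :
  is_diag_mx (mxZ C - Etheta (idx n h.+1) (idx n h) *+ R) ->
  (forall t, sum_is t -> mxZ A <> mxZ A'' + shift h t) ->
  is_struct_poly C A A'' 0.
Proof.
move=> diagC no_t F f F_odd f_nondeg V1 V2 V1f V2f orb; rewrite horner0.
apply/esym/eqP; rewrite eqz_nat cards_eq0; apply/eqP/setP => V; rewrite [RHS]inE.
apply/negbTE/negP => /setIdP[Vf /andP[VC VA]].
have [agree Vh] := lower_adjacent f_nondeg h_range diagC V1f Vf VC.
have [|t sum_t A''E] := exists_shift_flags f_nondeg V1f Vf V2f orb VA agree Vh.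
- by rewrite (orbit_diml V1f Vf VC) // (orbit_dimr V1f Vf VC) // (rk_lower_h h_range diagC).
exact: no_t A''E.
Qed.

Section Lower.

Variables (A A'' C : Xi n d) (t : tvec n R).
Hypothesis diagC : is_diag_mx (mxZ C - Etheta (idx n h.+1) (idx n h) *+ R).
Hypothesis roA : ro A = co C.
Hypothesis sum_t : sum_is t.
Hypothesis AE : mxZ A = mxZ A'' + shift h t.

Lemma card_lower (F : finFieldType) (f : {symmetric 'rV[F]_D})
    (cond : pred {vspace 'rV[F]_D}) (V1 V2 : chain n d F) : nondegenerate f ->
  V1 \in flags n f -> V2 \in flags n f -> in_orbit_of A'' V1 V2 ->
  (forall V, V \in flags n f -> agree_off h V1 V -> (step V1 h <= step V h)%VS ->
     cond (step V h)) ->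
  (forall W, cond W -> [/\ (step V1 h <= W)%VS, (W <= orthov f W)%VS &
     (h < n)%N -> (W <= step V1 h.+1)%VS]) ->
  #|[set V in flags n f | in_orbit_of C V1 V && in_orbit_of A V V2]| =
  #|[set W | cond W && cap_dims N (step V2) (rk A h) W]|.
Proof.
move=> f_nondeg V1f V2f orb condV condP.
apply: (card_adjacent f_nondeg V1f V2f orb).
- by move=> i j i_n jN ih; rewrite (rk_off AE).
- by move=> j _; rewrite (rk_shift_full h_range AE).
- move=> V Vf VC; have [agree Vh] := lower_adjacent f_nondeg h_range diagC V1f Vf VC.
  by split; last exact: condV.
- move=> W /condP[W1 W2 W3]; split=> //; apply: subv_trans W1.
  by rewrite (flag_mono V1f) // leq_pred.
- move=> V Vf agree /condP[Vh _ _] VA.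
  apply: (adjacent_lower f_nondeg h_range diagC) => // [i iN|].
    by rewrite (orbit_diml Vf V2f VA) // (rk_ro_co i roA).
  rewrite (orbit_diml Vf V2f VA) // (orbit_diml V1f V2f orb) //.
  by rewrite (rk_shift h_range AE) ?eqxx ?mul1n ?psum_full ?(eqP sum_t).
Qed.

Let rk_A_h l : rk A h l = (rk A'' h l + psum (fun u => t u : nat) l)%N.
Proof. by rewrite (rk_shift h_range AE) ?eqxx ?mul1n. Qed.

(** Between V1_h and V1_(h+1) the graded dimensions of [W] are t_u and those of V1_(h+1) over [W]
    are a_(h+1,u). *)
Lemma struct_poly_lower : (h < n)%N ->
  is_struct_poly C A A'' (linear_count (row A h.+1) (fun u => t u : nat)).
Proof.
move=> hn F f F_odd f_nondeg V1 V2 V1f V2f orb.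
have dim'' := elimT (orbitP A'' V1f V2f) orb.
pose cond W := (step V1 h <= W)%VS && (W <= step V1 h.+1)%VS.
have V1h : (step V1 h.+1 <= orthov f (step V1 h.+1))%VS by apply: flag_isotropic_le.
rewrite (card_lower (cond := cond) f_nondeg V1f V2f orb).
- have -> : [set W | cond W && cap_dims N (step V2) (rk A h) W] =
      [set W | (step V1 h <= W)%VS &&
               ((W <= step V1 h.+1)%VS && cap_dims N (step V2) (rk A h) W)].
    by apply/setP => W; rewrite !inE andbA.
  apply/esym/(card_linear (flag_cap_monoS V2f) (flag_full V2f)) => [|l lN|l lN].
  + by rewrite (flag_mono V1f) // leqnSn leqN.
  + have hS_N : (h.+1 <= N)%N := leqN hn.
    have hS_row : (1 <= h.+1 <= n.+1)%N := h_n.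
    rewrite !dim'' // (rk_row _ _ hS_row).
    congr (_ + _)%N; apply: eq_psum => u.
    have := shift_row h_range AE (k := idx n h.+1) u.
    rewrite /row idx_val; last by lia.
    have -> : (h.+1.-1 == h.-1) = false by lia.
    by rewrite eqxx mul0n mul1n addn0 => ->; [|lia].
  + by rewrite dim'' // rk_A_h.
- move=> V Vf agree Vh; rewrite /cond Vh -agree // ?gtn_eqF //.
  by rewrite (flag_mono Vf) // leqnSn leqN.
- move=> W /andP[W1 W2]; split=> //.
  by apply: subv_trans W2 (subv_trans V1h (orthovS f W2)).
Qed.

(** Here V1_(n+1) is the orthogonal of V1_n, and row n+1 of [A''] is that of [A] increased by t_u
    and, by symmetry, by the reflected t. *)
Lemma struct_poly_lower_mid : h = n ->
  is_struct_poly C A A'' (isotropic_count (row A n.+1) (fun u => t u : nat)).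
Proof.
move=> hn F f F_odd f_nondeg V1 V2 V1f V2f orb.
have dim'' := elimT (orbitP A'' V1f V2f) orb.
pose cond W := (step V1 h <= W)%VS && (W <= orthov f W)%VS.
have D_odd : odd D by rewrite /dimN /= odd_double.
have perp_h : orthov f (step V1 h) = step V1 n.+1.
  by rewrite (flag_perp V1f) // hn; congr step; rewrite /dimN; lia.
rewrite (card_lower (cond := cond) f_nondeg V1f V2f orb).
- have -> : [set W | cond W && cap_dims N (step V2) (rk A h) W] =
      [set W | (step V1 h <= W)%VS &&
               ((W <= orthov f W)%VS && cap_dims N (step V2) (rk A h) W)].
    by apply/setP => W; rewrite !inE andbA.
  apply/esym/(card_isotropic_subspaces f_nondeg F_odd D_odd (flag_cap_monoS V2f)
    (flag_full V2f)) => [l lN||||].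
  + exact: flag_perp.
  + exact: xi_center_odd.
  + by rewrite hn; apply: flag_isotropic.
  + have nS_N : (n.+1 <= N)%N by rewrite /dimN ltnS -addnn leq_addr.
    have mid_row : (1 <= n.+1 <= n.+1)%N := leqnn n.+1.
    move=> l lN; rewrite perp_h !dim'' // (rk_row _ _ mid_row) {1}hn.
    congr (_ + _)%N; apply: eq_psum => u.
    have mid_h : idx n n.+1 = h :> nat by rewrite idx_val.
    have rev_mid : rev_ord (idx n n.+1) = idx n n.+1.
      by apply/ord_inj; rewrite rev_dimN mid_h; lia.
    have := congr1 (fun M : 'M_N => M (idx n n.+1) u) AE; rewrite !mxE shiftE //.
    rewrite rev_mid mid_h eqxx eq_sym (negbTE h1_neq) /row.
    lia.
  + by move=> l lN; rewrite dim'' // rk_A_h.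
- move=> V Vf agree Vh; rewrite /cond Vh hn; apply: flag_isotropic => //.
- by move=> W /andP[W1 W2]; split=> //; rewrite hn ltnn.
Qed.

End Lower.

End StructurePolynomials.

(** * Nonempty orbits and uniqueness of structure polynomials *)

Section AntidiagonalForm.

Variables (F : finFieldType) (m : nat).
Implicit Types (u v : 'rV[F]_m) (S T : pred 'I_m).

(** For this form the orthogonal of a coordinate subspace is again one, so every orbit can be
    realised by flags of coordinate subspaces. *)
Definition antidiag_form u v : F := \sum_i u 0 i * v 0 (rev_ord i).

Lemma antidiag_form_bilinear : bilinear_for
  (GRing.Scale.Law.clone _ _ *%R _) (GRing.Scale.Law.clone _ _ (idfun \; *%R) _)
  antidiag_form.
Proof.
split=> [u'|u] a x y /=; rewrite /antidiag_form mulr_sumr -big_split /=;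
  by apply: eq_bigr => i _; rewrite !mxE; ring.
Qed.

HB.instance Definition _ := bilinear_isBilinear.Build F 'rV[F]_m 'rV[F]_m F
  _ _ antidiag_form antidiag_form_bilinear.

Lemma antidiag_form_sym u v :
  antidiag_form u v = (-1) ^+ false * idfun (antidiag_form v u).
Proof.
rewrite mul1r /antidiag_form (reindex_inj rev_ord_inj) /=.
by apply: eq_bigr => i _; rewrite rev_ordK mulrC.
Qed.

HB.instance Definition _ := isHermitianSesquilinear.Build F 'rV[F]_m false idfun
  antidiag_form antidiag_form_sym.

Definition coordv S : {vspace 'rV[F]_m} :=
  <<[seq (delta_mx 0 i)%R | i <- enum S]>>%VS.

Lemma coordvP S v : reflect (forall i, ~~ S i -> v 0 i = 0) (v \in coordv S).
Proof.
apply: (iffP idP) => [vS i Si|v0].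
  have : forall w : 'rV[F]_m, w \in [seq delta_mx 0 i | i <- enum S] -> w 0 i = 0.
    move=> w /mapP; case=> j; rewrite mem_enum => Sj ->; rewrite mxE eqxx /=; case: eqP => // ij.
    by case/negP: Si; rewrite ij.
  move: vS; rewrite /coordv; move: [seq _ | _ <- _] => X.
  move/(coord_span (X := in_tuple X)) => -> X0; rewrite summxE big1 // => j _.
  by rewrite mxE X0 ?mulr0 // mem_nth.
rewrite [v]row_sum_delta; apply: rpred_sum => i _.
have [Si|/v0->] := boolP (S i); last by rewrite scale0r mem0v.
by rewrite rpredZ // memv_span // map_f // mem_enum.
Qed.

Lemma eq_coordv S T : S =1 T -> coordv S = coordv T.
Proof. by move=> ST; rewrite /coordv (eq_enum ST). Qed.

Lemma coordvS S T : (forall i, S i -> T i) -> (coordv S <= coordv T)%VS.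
Proof.
move=> ST; apply/subvP => v /coordvP v0; apply/coordvP => i Ti; apply: v0.
by apply: contra Ti; apply: ST.
Qed.

Lemma coordv_cap S T : (coordv S :&: coordv T = coordv (predI S T))%VS.
Proof.
apply/vspaceP => v; rewrite memv_cap; apply/andP/coordvP => [[/coordvP vS /coordvP vT] i|v0].
  by rewrite negb_and => /orP[/vS|/vT].
by split; apply/coordvP => i Si; apply: v0; rewrite /= negb_and Si ?orbT.
Qed.

Lemma coordv_full : coordv predT = fullv.
Proof. by apply/vspaceP => v; rewrite memvf; apply/coordvP. Qed.

Lemma coordv0 : coordv pred0 = 0%VS.
Proof.
apply/vspaceP => v; rewrite memv0; apply/coordvP/eqP => [v0|-> i _]; last by rewrite mxE.
by apply/rowP => i; rewrite mxE v0.
Qed.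

(** The upper bound holds for [S] and its complement, and both pairs of numbers add up to [m]. *)
Lemma dim_coordv S : \dim (coordv S) = #|S|.
Proof.
have dim_le T : (\dim (coordv T) <= #|T|)%N.
  by rewrite (leq_trans (dim_span _)) // size_map cardE.
have cap0 : (coordv S :&: coordv (predC S) = 0)%VS.
  by rewrite coordv_cap -coordv0; apply: eq_coordv => i; rewrite /= andbN.
have full : (coordv S + coordv (predC S) = fullv)%VS.
  apply/eqP; rewrite eqEsubv subvf -coordv_full; apply/span_subvP => w /mapP; case=> i _ ->.
  rewrite memvE; case: (boolP (S i)) => Si.
    by rewrite (subv_trans _ (addvSl _ _)) // -memvE memv_span // map_f // mem_enum.
  by rewrite (subv_trans _ (addvSr _ _)) // -memvE memv_span // map_f // mem_enum.
have cardS : (#|S| + #|predC S| = m)%N by rewrite -[RHS]card_ord -(cardC S).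
have dimS : (\dim (coordv S) + \dim (coordv (predC S)) = m)%N.
  by rewrite -dimv_sum_cap cap0 full dimv0 addn0 dim_rV.
have leS := dim_le S; have leSC := dim_le (predC S).
apply/eqP; rewrite eqn_leq leS /= -(leq_add2r #|predC S|) cardS.
by apply: leq_trans (eq_leq (esym dimS)) _; rewrite leq_add2l.
Qed.

Lemma orthov_coordv S :
  orthov antidiag_form (coordv S) = coordv (fun i => ~~ S (rev_ord i)).
Proof.
apply/vspaceP => u; apply/mem_orthovP/coordvP => [uS i|u0 v /coordvP vS].
  rewrite negbK => Si; have := uS (delta_mx 0 (rev_ord i)).
  rewrite memv_span ?map_f ?mem_enum // => /(_ isT); rewrite /= /antidiag_form.
  rewrite (bigD1 i) //= mxE !eqxx mulr1 big1 ?addr0 // => j ji.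
  by rewrite mxE (inj_eq rev_ord_inj) (negbTE ji) andbF mulr0.
rewrite /= /antidiag_form big1 // => i _.
have [Si|Si] := boolP (S (rev_ord i)); last by rewrite vS // mulr0.
by rewrite u0 ?mul0r // negbK.
Qed.

Lemma antidiag_nondegenerate : nondegenerate antidiag_form.
Proof.
by rewrite /nondegenerate -coordv_full orthov_coordv -coordv0; apply/eqP/eq_coordv.
Qed.

End AntidiagonalForm.

(** * Flags of coordinate subspaces in a prescribed orbit *)

Section NonemptyOrbits.

Variables (n d : nat) (A : Xi n d) (F : finFieldType).
Local Notation N := (dimN n).
Local Notation D := (dimN d).
Local Notation cell := ('I_N * 'I_N)%type.

Let rev_cell (c : cell) : cell := (rev_ord c.1, rev_ord c.2).
Let mid : 'I_N := idx n n.+1.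
(** One cell from each pair exchanged by [rev_cell]; only the centre is its own image. *)
Let half (c : cell) := (c.1 < n)%N || ((c.1 == n :> nat) && (c.2 < n)%N).
Let copies (c : cell) : seq cell := nseq (A c.1 c.2) c.
Let half_cells : seq cell := flatten [seq copies c | c <- enum half].

(* A list of cells, each with the multiplicity prescribed by [A], that is
   reversed by [rev_cell]; its k-th item is the cell of the k-th basis vector. *)
Let cells : seq cell :=
  half_cells ++ copies (mid, mid) ++ rev (map rev_cell half_cells).

Let rev_cellK : involutive rev_cell.
Proof. by case=> i j; rewrite /rev_cell /= !rev_ordK. Qed.

Let rev_mid : rev_ord mid = mid.
Proof. by apply/ord_inj; rewrite rev_dimN idx_val //=; lia. Qed.

Let rev_cells : rev cells = map rev_cell cells.
Proof.
rewrite /cells !rev_cat !map_cat revK map_rev (mapK rev_cellK) -catA.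
by congr (_ ++ (_ ++ _)); rewrite /copies map_nseq rev_nseq /rev_cell /= rev_mid.
Qed.

Let count_half c : count_mem c half_cells = if half c then A c.1 c.2 else 0%N.
Proof.
rewrite /half_cells count_flatten -map_comp sumnE big_map big_enum /=.
have [hc|hc] := boolP (half c).
  rewrite (bigD1 c) //= count_nseq /= eqxx mul1n big1 ?addn0 // => c' /andP[_ cc'].
  by rewrite count_nseq /= (negbTE cc').
rewrite big1 // => c' hc'; rewrite count_nseq /=; case: eqP => // cc'.
by case/negP: hc; rewrite -cc'.
Qed.

Let count_cells c : count_mem c cells = A c.1 c.2.
Proof.
rewrite /cells !count_cat count_rev count_map count_half.
have -> : count (preim rev_cell (pred1 c)) half_cells = count_mem (rev_cell c) half_cells.
  by apply: eq_count => c' /=; rewrite (can2_eq rev_cellK rev_cellK).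
rewrite count_half count_nseq /= xi_rev.
have midE : mid = n :> nat by rewrite idx_val.
have half_rev : half (rev_cell c) = (n < c.1)%N || ((c.1 == n :> nat) && (n < c.2)%N).
  case: c => i j; rewrite /half /rev_cell /= !subSS.
  by have := leq_dimN i; have := leq_dimN j; lia.
rewrite half_rev /half; case: c {half_rev} => i j /=.
have -> : ((mid, mid) == (i, j)) = (i == n :> nat) && (j == n :> nat).
  by rewrite eq_sym xpair_eqE -!val_eqE /= midE.
case: (ltngtP i n) => [_|_|i_n] /=; rewrite ?mul0n ?addn0 //.
case: (ltngtP j n) => [_|_|j_n] /=; rewrite ?mul0n ?mul1n ?addn0 //.
by congr (entry A _ _); apply/ord_inj; rewrite midE.
Qed.

Let count_cellsE (P : pred cell) : count P cells = (\sum_(c | P c) A c.1 c.2)%N.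
Proof.
under eq_bigr => c _ do rewrite -count_cells.
elim: cells => [|c s IHs] /=; first by rewrite big1.
rewrite big_split /= -IHs; congr (_ + _)%N.
rewrite big_mkcond (bigD1 c) //= eqxx big1 ?addn0; first by case: (P c).
by move=> c' /negbTE; rewrite eq_sym => ->; rewrite if_same.
Qed.

Let size_cells : size cells = D.
Proof.
rewrite -(count_predT cells) count_cellsE -(rk_total A) /rk psum_full.
rewrite -(pair_bigA _ (fun i j => A i j)) /=.
by apply: eq_bigr => i _; rewrite psum_full.
Qed.

Let cell_of (k : 'I_D) : cell := nth (mid, mid) cells k.

Let cell_of_rev k : cell_of (rev_ord k) = rev_cell (cell_of k).
Proof.
have k_lt : (k < size cells)%N by rewrite size_cells.
rewrite /cell_of -(nth_map _ (mid, mid)) // -rev_cells nth_rev // size_cells.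
by rewrite rev_dimN /dimN subSS.
Qed.

Let card_cell_of (P : pred cell) : #|[pred k | P (cell_of k)]| = (\sum_(c | P c) A c.1 c.2)%N.
Proof.
rewrite -count_cellsE cardE /enum_mem size_filter -enumT /=.
have -> : cells = [seq cell_of k | k <- enum 'I_D].
  rewrite -[LHS](mkseq_nth (mid, mid)) size_cells /mkseq -val_enum_ord -map_comp.
  by [].
by rewrite count_map; apply: eq_count.
Qed.

Let flag_of (p : cell -> 'I_N) : chain n d F :=
  [ffun i : 'I_N.+1 => coordv F (fun k => (p (cell_of k) < i)%N)].

Let step_flag_of p i : (i <= N)%N ->
  step (flag_of p) i = coordv F (fun k => (p (cell_of k) < i)%N).
Proof. by move=> iN; rewrite /step ffunE; apply: eq_coordv => k; rewrite inordK. Qed.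

Let flag_of_flag p : (forall c, p (rev_cell c) = rev_ord (p c)) ->
  flag_of p \in flags n (@antidiag_form F D).
Proof.
move=> p_rev; apply/flagsP; split=> [||i iN|i iN].
- by rewrite step_flag_of // -coordv0; apply: eq_coordv.
- rewrite step_flag_of // -coordv_full; apply: eq_coordv => k; exact: ltn_ord.
- by rewrite !step_flag_of ?(ltnW iN) //; apply: coordvS => k /leqW.
rewrite !step_flag_of ?leq_subr // orthov_coordv; apply: eq_coordv => k.
rewrite cell_of_rev p_rev rev_dimN; have := leq_dimN (p (cell_of k)).
by rewrite /dimN in iN *; lia.
Qed.

(** The first flag sorts the basis vectors by the row of their cell, the second by the column. An
    intersection is then spanned by the vectors whose cells lie in a corner, and [cells] repeats
    each cell as often as [A] requires. *)
Lemma nonempty_orbit : exists V1 V2 : chain n d F,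
  [/\ V1 \in flags n (@antidiag_form F D), V2 \in flags n (@antidiag_form F D)
     & in_orbit_of A V1 V2].
Proof.
exists (flag_of fst), (flag_of snd); split; try exact: flag_of_flag.
apply/(orbitP _ (flag_of_flag _) (flag_of_flag _)) => // i j iN jN.
rewrite !step_flag_of // coordv_cap dim_coordv.
rewrite -[LHS]/#|[pred k | (fun c : cell => (c.1 < i) && (c.2 < j))%N (cell_of k)]|.
rewrite card_cell_of /rk /psum pair_big_dep /=.
by apply: eq_bigl => c.
Qed.

End NonemptyOrbits.

Lemma exists_odd_primes k :
  exists s : seq nat, [/\ size s = k, uniq s & all (fun p => prime p && odd p) s].
Proof.
suff [s [b [sz us ps bs]]] : exists s b, [/\ size s = k, uniq s,
    all (fun p => prime p && odd p) s & all (fun p => p <= b)%N s] by exists s.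
elim: k => [|k [s [b [sz us ps bs]]]]; first by exists [::], 0%N.
have [p p_gt p_prime] := prime_above (maxn b 2).
move: p_gt; rewrite gtn_max => /andP[bp p2].
exists (p :: s), p; split=> /=.
- by rewrite sz.
- by rewrite us andbT; apply: contraL bp => /(allP bs); rewrite -leqNgt.
- by rewrite p_prime ps andbT; apply: contraLR p2 => /(prime_oddPn p_prime) ->.
- by rewrite leqnn; apply: sub_all bs => x /leq_trans; apply; apply: ltnW.
Qed.

Lemma poly_eq_on_odd_primes (G H : {poly int}) :
  (forall p, prime p -> odd p -> G.[p%:Z] = H.[p%:Z]) -> G = H.
Proof.
move=> GH; apply/eqP; rewrite -subr_eq0; apply/negPn/negP => GH0.
have [s [sz us ps]] := exists_odd_primes (size (G - H)).
have roots : all (root (G - H)) [seq p%:Z | p <- s].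
  rewrite all_map; apply/allP => p /(allP ps)/andP[pp op] /=.
  by rewrite /root hornerD hornerN GH // subrr.
have := max_poly_roots GH0 roots.
by rewrite size_map sz ltnn map_inj_uniq ?us => [/(_ isT)|? ? []].
Qed.

Lemma struct_polyE n d (A A' A'' : Xi n d) G :
  is_struct_poly A A' A'' G -> struct_poly A A' A'' = G.
Proof.
move=> GP; have HP : is_struct_poly A A' A'' (struct_poly A A' A'').
  exact: (classical_sets.xgetPex 0 (ex_intro _ G GP)).
apply: poly_eq_on_odd_primes => p p_prime p_odd.
have cardF : #|'F_p| = p by apply: card_Fp.
have [V1 [V2 [V1f V2f V12]]] := nonempty_orbit A'' 'F_p.
have F_odd : odd #|'F_p| by rewrite cardF.
have nd := antidiag_nondegenerate 'F_p (dimN d).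
by rewrite -cardF (GP _ _ F_odd nd V1 V2) // (HP _ _ F_odd nd V1 V2).
Qed.

(** * Dimensions of orbits *)

Section QuadraticForm.

Variable n : nat.
Local Notation N := (dimN n).
Implicit Types (f g t : 'I_N -> int) (x y : 'I_N -> 'I_N -> int) (i j k l c : 'I_N).

Definition ltp f g : int := \sum_(j < N) \sum_(l < N | (j < l)%N) f j * g l.

Lemma eq_ltp f f' g g' : f =1 f' -> g =1 g' -> ltp f g = ltp f' g'.
Proof.
by move=> ff gg; apply: eq_bigr => j _; apply: eq_bigr => l _; rewrite ff gg.
Qed.

Lemma ltpDl f f' g : ltp (fun j => f j + f' j) g = ltp f g + ltp f' g.
Proof.
rewrite /ltp -big_split; apply: eq_bigr => j _; rewrite -big_split /=.
by apply: eq_bigr => l _; rewrite mulrDl.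
Qed.

Lemma ltpDr f g g' : ltp f (fun j => g j + g' j) = ltp f g + ltp f g'.
Proof.
rewrite /ltp -big_split; apply: eq_bigr => j _; rewrite -big_split /=.
by apply: eq_bigr => l _; rewrite mulrDr.
Qed.

Lemma ltpZl (a : int) f g : ltp (fun j => a * f j) g = a * ltp f g.
Proof.
rewrite /ltp big_distrr; apply: eq_bigr => j _; rewrite big_distrr /=.
by apply: eq_bigr => l _; rewrite mulrA.
Qed.

Lemma ltpZr (a : int) f g : ltp f (fun j => a * g j) = a * ltp f g.
Proof.
rewrite /ltp big_distrr; apply: eq_bigr => j _; rewrite big_distrr /=.
by apply: eq_bigr => l _; rewrite mulrCA.
Qed.

Lemma ltn_rev i j : (rev_ord i < rev_ord j)%N = (j < i)%N.
Proof. by rewrite !rev_dimN; have := leq_dimN i; have := leq_dimN j; lia. Qed.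

Lemma leq_rev i j : (rev_ord i <= rev_ord j)%N = (j <= i)%N.
Proof. by rewrite leqNgt ltn_rev -leqNgt. Qed.

Lemma ltp_rev f g : ltp (f \o @rev_ord N) (g \o @rev_ord N) = ltp g f.
Proof.
rewrite /ltp (reindex_inj rev_ord_inj) (exchange_big_dep xpredT) //=.
rewrite (reindex_inj rev_ord_inj); apply: eq_bigr => j _.
apply: eq_big => [l|l _]; first by rewrite ltn_rev.
by rewrite !rev_ordK mulrC.
Qed.

Lemma ltp_anti f g : ltp f (g \o @rev_ord N) =
  \sum_(j < N) \sum_(l < N | (j + l < n.*2)%N) f j * g l.
Proof.
apply: eq_bigr => j _; rewrite (reindex_inj rev_ord_inj); apply: eq_big => [l|l _].
  by rewrite rev_dimN; have := leq_dimN l; lia.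
by rewrite /= rev_ordK.
Qed.

Lemma ltp_anti_diag f : ltp f (f \o @rev_ord N) =
  (\sum_(j < N) \sum_(l < N | (j < l)%N && (j + l < n.*2)%N) f j * f l) *+ 2 +
  \sum_(j : 'I_N | (j < n)%N) f j ^+ 2.
Proof.
have split_l j : \sum_(l < N | (j + l < n.*2)%N) f j * f l =
    \sum_(l < N | (j < l)%N && (j + l < n.*2)%N) f j * f l +
    \sum_(l < N | (l < j)%N && (l + j < n.*2)%N) f l * f j +
    (if (j < n)%N then f j ^+ 2 else 0).
  rewrite (bigID (fun l : 'I_N => (j < l)%N)) /= -addrA; congr (_ + _).
    by apply: eq_bigl => l; rewrite andbC.
  rewrite (bigID (fun l : 'I_N => (l < j)%N)) /=; congr (_ + _).
    apply: eq_big => [l|l _]; last exact: mulrC.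
    by rewrite (addnC l); case: (ltngtP j l); rewrite ?andbF ?andbT.
  have [jn|nj] := ltnP j n.
    rewrite (big_pred1 j) // => l /=; rewrite -val_eqE /=.
    by case: (ltngtP j l) => [||<-]; rewrite ?andbF ?andbT //=; lia.
  by rewrite big1 // => l /andP[/andP[jl lj] jl']; lia.
rewrite ltp_anti (eq_bigr _ (fun j _ => split_l j)) !big_split /=.
rewrite [X in _ + X + _](exchange_big_dep xpredT) //= mulr2n.
by congr (_ + _); rewrite -big_mkcond.
Qed.

Definition qf x y : int := \sum_(i < N) \sum_(k < N | (k <= i)%N) ltp (x i) (y k).

Definition rev_inv x := forall i j, x (rev_ord i) (rev_ord j) = x i j.

Lemma ltp_rev_inv x y i k : rev_inv x -> rev_inv y ->
  ltp (x (rev_ord i)) (y (rev_ord k)) = ltp (y k) (x i).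
Proof.
move=> x_rev y_rev; rewrite -ltp_rev; apply: eq_ltp => j /=.
  exact: y_rev.
exact: x_rev.
Qed.

(** The half-turn of the matrix reverses both the row order and the column order, which exchanges
    the two arguments. *)
Lemma qf_sym x y : rev_inv x -> rev_inv y -> qf x y = qf y x.
Proof.
move=> x_rev y_rev; rewrite /qf (reindex_inj rev_ord_inj) [RHS](exchange_big_dep xpredT) //=.
apply: eq_bigr => i _; rewrite (reindex_inj rev_ord_inj); apply: eq_big => k.
  exact: leq_rev.
by move=> _; apply: ltp_rev_inv.
Qed.

Lemma qfD x y : rev_inv x -> rev_inv y ->
  qf (fun i j => x i j + y i j) (fun i j => x i j + y i j) =
    qf x x + qf x y *+ 2 + qf y y.
Proof.
move=> x_rev y_rev; rewrite mulr2n {2}(qf_sym x_rev y_rev) /qf -!big_split.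
apply: eq_bigr => i _; rewrite -!big_split; apply: eq_bigr => k _ /=.
by rewrite ltpDl !ltpDr; ring.
Qed.

Lemma sum_delta_le c i : \sum_(k < N | (k <= i)%N) (k == c)%:R = (c <= i)%N%:R :> int.
Proof.
have [ci|ic] := leqP c i.
  by rewrite (bigD1 c) //= eqxx big1 ?addr0 // => k /andP[_ /negbTE->].
by apply: big1 => k ki; case: eqP => // kc; move: ic; rewrite -kc ltnNge ki.
Qed.

Lemma sum_delta (F : 'I_N -> int) c : \sum_k (k == c)%:R * F k = F c.
Proof.
rewrite (bigD1 c) //= eqxx mul1r big1 ?addr0 // => k /negbTE->.
by rewrite mul0r.
Qed.

Definition below x : int := \sum_(i : 'I_N | (n <= i)%N) \sum_(j : 'I_N | (j < n)%N) x i j.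

Definition dim2 x : int := qf x x - below x.

Section Shift.

Variable h : nat.
Hypothesis h_range : (1 <= h <= n)%N.
Let ih := idx n h.
Let ihS := idx n h.+1.
Let ihE : ih = h.-1 :> nat. Proof. by rewrite idx_val; lia. Qed.
Let ihSE : ihS = h :> nat. Proof. by rewrite idx_val; lia. Qed.

Let xi k : int := (k == ih)%:R - (k == ihS)%:R.

(** Integer coefficients allow [t] to be negated, so that subtracting a shift is again a shift. *)
Definition shiftz t k l : int :=
  ((k == idx n h)%:R - (k == idx n h.+1)%:R) * t l +
  ((rev_ord k == idx n h)%:R - (rev_ord k == idx n h.+1)%:R) * t (rev_ord l).

Lemma shiftz_rev t : rev_inv (shiftz t).
Proof. by move=> k l; rewrite /shiftz !rev_ordK addrC. Qed.

Lemma shiftzN t k l : shiftz (fun u => - t u) k l = - shiftz t k l.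
Proof. by rewrite /shiftz; ring. Qed.

Let sum_xi i : \sum_(k < N | (k <= i)%N) xi k = (i == ih)%:R.
Proof.
rewrite sumrB !sum_delta_le -val_eqE /= ihE ihSE; apply/eqP.
rewrite subr_eq -natrD eqr_nat; apply/eqP.
by case: leqP; case: leqP; case: eqP => /=; lia.
Qed.

Let sum_xi_rev i : \sum_(k < N | (k <= i)%N) xi (rev_ord k) = - (i == rev_ord ihS)%:R.
Proof.
under eq_bigr => k _ do rewrite /xi !(canF_eq rev_ordK).
rewrite sumrB !sum_delta_le -[i == _]val_eqE -[val (rev_ord ihS)]/(nat_of_ord _).
rewrite !rev_dimN /= !subSS ihE ihSE; apply/eqP.
rewrite subr_eq eq_sym addrC subr_eq -natrD eqr_nat; apply/eqP.
by case: leqP; case: leqP; case: eqP => /=; lia.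
Qed.

(** The row coefficients telescope: the partial sums of [xi] vanish except at [ih], those of its
    reflection except at [rev_ord ihS]. *)
Lemma qf_shift x t : qf x (shiftz t) =
  ltp (x ih) t - ltp (x (rev_ord ihS)) (t \o @rev_ord N).
Proof.
transitivity (\sum_i ((i == ih)%:R * ltp (x i) t +
                      (i == rev_ord ihS)%:R * - ltp (x i) (t \o @rev_ord N))).
  apply: eq_bigr => i _; rewrite -sum_xi mulrN -mulNr -sum_xi_rev !mulr_suml -big_split.
  by apply: eq_bigr => k _; rewrite /shiftz ltpDr !ltpZr.
by rewrite big_split /= !sum_delta.
Qed.

Lemma below_shift t : below (shiftz t) = - ((h == n)%:R * \sum_(j : 'I_N | (j < n)%N) t j).
Proof.
have sum_ge c : \sum_(i : 'I_N | (n <= i)%N) (i == c)%:R = (n <= c)%N%:R :> int.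
  have [nc|cn] := leqP n c.
    by rewrite (bigD1 c) //= eqxx big1 ?addr0 // => k /andP[_ /negbTE->].
  by apply: big1 => k nk; case: eqP => // kc; move: cn; rewrite -kc ltnNge nk.
transitivity (\sum_(i : 'I_N | (n <= i)%N)
    (xi i * \sum_(j : 'I_N | (j < n)%N) t j +
     xi (rev_ord i) * \sum_(j : 'I_N | (j < n)%N) t (rev_ord j))).
  by apply: eq_bigr => i _; rewrite !mulr_sumr -big_split.
rewrite big_split -!mulr_suml /=.
under [X in _ + X * _]eq_bigr => i _ do rewrite /xi !(canF_eq rev_ordK).
rewrite !sumrB !sum_ge !rev_dimN ihE ihSE.
have -> : (n <= h.-1)%N = false by lia.
have -> : (n <= h)%N = (h == n) by lia.
have -> : (n <= n.*2 - h.-1)%N by lia.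
have -> : (n <= n.*2 - h)%N by lia.
by rewrite subrr mul0r addr0 sub0r mulNr.
Qed.

Lemma ltpNl f g : ltp (fun j => - f j) g = - ltp f g.
Proof. by rewrite -mulN1r -ltpZl; apply: eq_ltp => // j; rewrite mulN1r. Qed.

(** Polarisation leaves [qf_shift] to be evaluated at [x] and at the shift itself. The last summand
    comes from [rev_ord ihS = ihS] for [h = n], where both halves of the shift meet the same row,
    and from the linear term [below]. *)
Lemma dim2_shift x t : rev_inv x ->
  dim2 (fun i j => x i j + shiftz t i j) = dim2 x +
    (ltp (x ih) t - ltp t (x ihS) + ltp t t) *+ 2 +
    (h == n)%:R * (ltp t (t \o @rev_ord N) + \sum_(j : 'I_N | (j < n)%N) t j).
Proof.
move=> x_rev; rewrite /dim2 qfD //; last exact: shiftz_rev.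
have -> : below (fun i j => x i j + shiftz t i j) = below x + below (shiftz t).
  rewrite /below -big_split; apply: eq_bigr => i _.
  by rewrite -big_split.
have ltp_xt : ltp (x (rev_ord ihS)) (t \o @rev_ord N) = ltp t (x ihS).
  by rewrite -ltp_rev; apply: eq_ltp => j //=; rewrite ?rev_ordK // -[in LHS](rev_ordK j) x_rev.
have ord_eqF k k' : k <> k' :> nat -> (k == k') = false.
  by move=> kk; apply/negP => /eqP kk'; apply: kk; rewrite kk'.
have rev_ihS : (rev_ord ihS == ihS) = (h == n).
  by rewrite -val_eqE -[val _]/(nat_of_ord _) rev_dimN /= ihSE; lia.
have row_ih : shiftz t ih =1 t.
  move=> l; rewrite /shiftz -/ih -/ihS eqxx !ord_eqF ?rev_dimN ?ihE ?ihSE; lia.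
have row_ihS : shiftz t (rev_ord ihS) =1 (fun l => - ((h == n)%:R * t l) + - t (rev_ord l)).
  move=> l; rewrite /shiftz -/ih -/ihS rev_ordK eqxx rev_ihS.
  rewrite (ord_eqF (rev_ord ihS) ih) ?(ord_eqF ihS ih) ?rev_dimN ?ihE ?ihSE; lia.
rewrite !qf_shift ltp_xt (eq_ltp row_ih (fun=> erefl)) (eq_ltp row_ihS (fun=> erefl)).
rewrite ltpDl !ltpNl ltpZl (_ : ltp (fun l => t (rev_ord l)) _ = ltp t t); last exact: ltp_rev.
rewrite below_shift; ring.
Qed.

End Shift.

End QuadraticForm.

Section OrbitDimension.

Variables (n d : nat).
Local Notation N := (dimN n).
Implicit Types (A B C : Xi n d).

Lemma bin2_double (a : nat) : ('C(a, 2))%:Z *+ 2 = a%:Z ^+ 2 - a%:Z.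
Proof.
have : ('C(a, 2) * 2 + a = a * a)%N by elim: a => [|a] //; rewrite binS bin1; lia.
by move=> /(congr1 Posz); rewrite PoszD !PoszM => aa; lia.
Qed.

Definition entryz A (i j : 'I_N) : int := (A i j)%:Z.

Lemma entryz_rev A : rev_inv (entryz A).
Proof. by move=> i j; rewrite /entryz xi_rev. Qed.

Lemma ltp_rows_split A i : ltp (entryz A i) (entryz A (rev_ord i)) =
  (\sum_(j < N) \sum_(l : 'I_N | (j < l)%N && (j + l < n.*2)%N) (A i j)%:Z * (A i l)%:Z) *+ 2 +
  \sum_(j : 'I_N | (j < n)%N) (A i j)%:Z ^+ 2.
Proof.
rewrite -ltp_anti_diag; apply: eq_ltp => // j.
by rewrite -[in LHS](rev_ordK j) entryz_rev.
Qed.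

(** Pairs of rows are sorted by the sign of i + k - 2n; the half-turn identifies the two sides, and
    likewise the diagonal terms above and below the middle. The middle diagonal term joins the
    antidiagonal sum. *)
Lemma qf_rows x : rev_inv x -> qf x x =
  (\sum_(i < N) \sum_(k < N | (k < i)%N && (i + k < n.*2)%N) ltp (x i) (x k)) *+ 2 +
  (\sum_(i : 'I_N | (i < n)%N) ltp (x i) (x i)) *+ 2 +
  \sum_(i : 'I_N | (n <= i)%N) ltp (x i) (x (rev_ord i)).
Proof.
move=> x_rev.
have split_k (i : 'I_N) : \sum_(k < N | (k <= i)%N) ltp (x i) (x k) =
    \sum_(k < N | (k < i)%N && (i + k < n.*2)%N) ltp (x i) (x k) +
    \sum_(k < N | (k < i)%N && (n.*2 < i + k)%N) ltp (x i) (x k) +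
    (if (n < i)%N then ltp (x i) (x (rev_ord i)) else 0) + ltp (x i) (x i).
  rewrite (bigD1 i) //= addrC; congr (_ + _).
  rewrite (bigID (fun k : 'I_N => (i + k < n.*2)%N)) /= -addrA; congr (_ + _).
    by apply: eq_bigl => k; rewrite -val_eqE /=; lia.
  rewrite (bigID (fun k : 'I_N => (n.*2 < i + k)%N)) /=; congr (_ + _).
    by apply: eq_bigl => k; rewrite -val_eqE /=; have := leq_dimN k; lia.
  have [ni|ni] := ltnP n i.
    rewrite (big_pred1 (rev_ord i)) // => k /=.
    rewrite -!val_eqE -[val (rev_ord i)]/(nat_of_ord _) rev_dimN /=.
    by have := leq_dimN i; lia.
  by rewrite big1 // => k; rewrite -val_eqE /= => ?; exfalso; lia.
have -> : qf x x = \sum_(i < N) \sum_(k < N | (k <= i)%N) ltp (x i) (x k) by [].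
rewrite (eq_bigr _ (fun i _ => split_k i)) !big_split /=.
have -> : \sum_(i < N) \sum_(k < N | (k < i)%N && (n.*2 < i + k)%N) ltp (x i) (x k) =
    \sum_(i < N) \sum_(k < N | (k < i)%N && (i + k < n.*2)%N) ltp (x i) (x k).
  rewrite (reindex_inj rev_ord_inj) [RHS](exchange_big_dep xpredT) //=.
  apply: eq_bigr => i _; rewrite (reindex_inj rev_ord_inj) /=; apply: eq_big => [k|k _].
    by rewrite /= !subSS; have := leq_dimN i; have := leq_dimN k; lia.
  exact: ltp_rev_inv.
rewrite -big_mkcond /=.
pose mid := idx n n.+1; have midE : mid = n :> nat by rewrite idx_val.
have is_mid (i : 'I_N) : (i == mid) = (nat_of_ord i == n) by rewrite -val_eqE /= midE.
have rev_mid : rev_ord mid = mid by apply: ord_inj; rewrite rev_dimN midE; lia.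
have -> : \sum_i ltp (x i) (x i) =
    (\sum_(i : 'I_N | (i < n)%N) ltp (x i) (x i)) *+ 2 + ltp (x mid) (x mid).
  rewrite (bigD1 mid) //= addrC; congr (_ + _).
  rewrite (bigID (fun i : 'I_N => (i < n)%N)) mulr2n /=; congr (_ + _).
    by apply: eq_bigl => i; rewrite is_mid; lia.
  rewrite (reindex_inj rev_ord_inj) /=; apply: eq_big => [i|i _].
    by rewrite is_mid /= !subSS; have := leq_dimN i; lia.
  exact: ltp_rev_inv.
have -> : \sum_(i : 'I_N | (n <= i)%N) ltp (x i) (x (rev_ord i)) =
    ltp (x mid) (x mid) + \sum_(i : 'I_N | (n < i)%N) ltp (x i) (x (rev_ord i)).
  rewrite (bigD1 mid) ?midE //= rev_mid; congr (_ + _).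
  by apply: eq_bigl => i; rewrite is_mid; lia.
ring.
Qed.

Lemma Posz_sum (I : Type) (r : seq I) (P : pred I) (F : I -> nat) :
  (\sum_(i <- r | P i) F i)%N%:Z = \sum_(i <- r | P i) (F i)%:Z.
Proof. exact: (big_morph Posz PoszD). Qed.

(** For a row [i >= n] the antidiagonal term of [qf_rows] is twice a sum over pairs in one row plus
    a sum of squares. The squares match those in a_ij (a_ij - 1), whose linear part is [below]. *)
Lemma dA_double A : (dA A)%:Z *+ 2 = dim2 (entryz A).
Proof.
rewrite /dim2 (qf_rows (entryz_rev A)) /dA !PoszD.
have pair_sum i k : ltp (entryz A i) (entryz A k) =
  (\sum_(j < N) \sum_(l : 'I_N | (j < l)%N) (A i j * A k l)%N)%N%:Z.
  rewrite Posz_sum; apply: eq_bigr => j _; rewrite Posz_sum.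
  by apply: eq_bigr => l _; rewrite PoszM.
have -> : \sum_(i < N) \sum_(k < N | (k < i)%N && (i + k < n.*2)%N)
    ltp (entryz A i) (entryz A k) =
  (\sum_i \sum_j \sum_k \sum_(l | [&& pos k < pos i, pos j < pos l
      & pos i + pos k < (dimN n).+1]) A i j * A k l)%N%:Z.
  rewrite Posz_sum; apply: eq_bigr => i _.
  rewrite (eq_bigr _ (fun k _ => pair_sum i k)).
  rewrite -Posz_sum big_mkcond exchange_big; congr Posz; apply: eq_bigr => k _ /=.
  have -> : (k < i)%N && (i + k < n.*2)%N =
      (pos k < pos i)%N && (pos i + pos k < (dimN n).+1)%N.
    by rewrite /pos /dimN; lia.
  case: andP => [[-> ->]|neg].
    by apply: eq_bigr => j _; apply: eq_bigl => l; rewrite /= andbT.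
  rewrite big1 // => j _; rewrite big_pred0 // => l.
  by apply/negP => /and3P[? _ ?]; apply: neg.
have -> : (\sum_i \sum_j \sum_(l | (pos j < pos l) &&
      ((pos i < n.+1) || (pos j < (dimN n).+1 - pos l))) A i j * A i l)%N%:Z =
    \sum_(i : 'I_N | (i < n)%N) ltp (entryz A i) (entryz A i) +
    \sum_(i : 'I_N | (n <= i)%N) \sum_(j < N) \sum_(l : 'I_N | (j < l)%N && (j + l < n.*2)%N)
      (A i j)%:Z * (A i l)%:Z.
  rewrite (bigID (fun i : 'I_N => (i < n)%N)) /= PoszD !Posz_sum.
  congr (_ + _); last first.
    apply: eq_big => [i|i]; rewrite -leqNgt // => ni; rewrite Posz_sum.
    apply: eq_bigr => j _; rewrite Posz_sum; apply: eq_big => [l|l _]; last exact: PoszM.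
    by rewrite /pos; have NE : N = n.*2.+1 := erefl; lia.
  apply: eq_bigr => i i_lt; rewrite pair_sum; congr Posz.
  apply: eq_bigr => j _; apply: eq_bigl => l.
  by rewrite /pos; lia.
have -> : (\sum_(i : 'I_N | n.+1 <= pos i) \sum_(j : 'I_N | pos j < n.+1)
       (A i j * (A i j).-1) %/ 2)%N%:Z =
    \sum_(i : 'I_N | (n <= i)%N) \sum_(j : 'I_N | (j < n)%N) ('C(A i j, 2))%:Z.
  rewrite Posz_sum; apply: eq_bigr => i _; rewrite Posz_sum.
  by apply: eq_bigr => j _; rewrite bin2 divn2.
rewrite (eq_bigr _ (fun i _ => ltp_rows_split A i)) big_split /= sumrMnl.
have bin_sum : (\sum_(i : 'I_N | (n <= i)%N) \sum_(j : 'I_N | (j < n)%N) ('C(A i j, 2))%:Z) *+ 2 =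
    \sum_(i : 'I_N | (n <= i)%N) \sum_(j : 'I_N | (j < n)%N) (A i j)%:Z ^+ 2 - below (entryz A).
  rewrite /below -sumrB -sumrMnl; apply: eq_bigr => i _.
  by rewrite -sumrB -sumrMnl; apply: eq_bigr => j _; rewrite bin2_double.
by rewrite !mulrnDl bin_sum !addrA.
Qed.

End OrbitDimension.

(** * Orbit dimensions of the generators *)

Section DeltaSums.

Variable n : nat.
Local Notation N := (dimN n).
Implicit Types (f g : 'I_N -> int) (a b : 'I_N).

Lemma ltp_deltar f (b : 'I_N) (r : int) : ltp f (fun l => r * (l == b)%:R) =
  r * \sum_(j : 'I_N | (j < b)%N) f j.
Proof.
rewrite ltpZr; congr (_ * _); rewrite /ltp [RHS]big_mkcond; apply: eq_bigr => j _.
case: ltnP => [jb|bj].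
  rewrite (bigD1 b) //= eqxx mulr1 big1 ?addr0 // => l /andP[_ /negbTE->].
  by rewrite mulr0.
by apply: big1 => l jl; case: eqP => [lb|]; rewrite ?mulr0 //; move: jl; rewrite lb; lia.
Qed.

Lemma sum_deltar (P : pred 'I_N) a (r : int) :
  \sum_(j : 'I_N | P j) r * (j == a)%:R = r * (P a)%:R.
Proof.
have [Pa|nPa] := boolP (P a).
  by rewrite (bigD1 a) //= eqxx big1 ?addr0 // => l /andP[_ /negbTE->]; rewrite mulr0.
rewrite mulr0 big1 // => l Pl; case: eqP => [la|]; rewrite ?mulr0 //.
by move: nPa; rewrite -la Pl.
Qed.

Lemma eq_dim2 (x y : 'I_N -> 'I_N -> int) : x =2 y -> dim2 x = dim2 y.
Proof.
move=> xy; congr (_ - _); apply: eq_bigr => i _; apply: eq_bigr => k _ //.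
exact: eq_ltp.
Qed.

Lemma dim2_diag (a : 'I_N -> int) : dim2 (fun i j => a i * (j == i)%:R) = 0.
Proof.
rewrite /dim2 /qf /below !big1 ?subr0 // => i ni.
  by rewrite sum_deltar ltnNge ni mulr0.
apply: big1 => k ki; rewrite ltp_deltar big1 ?mulr0 // => j jk.
by case: eqP => [ji|]; rewrite ?mulr0 //; move: jk; rewrite ji; lia.
Qed.

End DeltaSums.

Section ChevalleyDimension.

Variables (n d h R : nat).
Local Notation N := (dimN n).
Implicit Types (A B C : Xi n d).
Hypothesis h_range : (1 <= h <= n)%N.

Let ih := idx n h.
Let ihS := idx n h.+1.
Let ihE : ih = h.-1 :> nat. Proof. by rewrite idx_val; lia. Qed.
Let ihSE : ihS = h :> nat. Proof. by rewrite idx_val; lia. Qed.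

Let ord_eqF (k k' : 'I_N) : k <> k' :> nat -> (k == k') = false.
Proof. by move=> kk; apply/negP => /eqP kk'; apply: kk; rewrite kk'. Qed.

Let delta_mul (i j p p' : 'I_N) : i != j ->
  ((i == p)%:R - (i == p')%:R) * (R%:Z * (j == p')%:R) =
  (((i == p) && (j == p')) * R)%N%:Z.
Proof.
move=> ij; case: (j =P p') ij => [->|_] ij; last by rewrite andbF !mulr0.
by rewrite (negbTE ij) andbT subr0 mulr1 PoszM natz.
Qed.

(** [B] is a diagonal matrix plus the shift by [R] times the unit vector at [ihS]; [dim2] vanishes
    on the diagonal part, so [dim2_shift] gives the value. *)
Lemma dA_upper B : is_diag_mx (mxZ B - Etheta ih ihS *+ R) ->
  dA B = (R * co B ih)%N.
Proof.
move=> diagB; have eq0 := upper_eq0 h_range diagB.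
have co_ih : co B ih = B ih ih.
  rewrite ffunE (bigD1 ih) //= big1 ?addn0 // => i; rewrite -val_eqE /= ihE => iih.
  by apply: eq0; rewrite ?ihE; lia.
pose e := fun l : 'I_N => R%:Z * (l == ihS)%:R.
pose x i := (B i i)%:Z - shiftz h e i i.
have BE : entryz B =2 (fun i j => x i * (j == i)%:R + shiftz h e i j).
  move=> i j; case: eqP => [->|/eqP ij]; first by rewrite mulr1 subrK.
  rewrite mulr0 add0r /entryz (diag_entry diagB) 1?eq_sym // PoszD /shiftz.
  by rewrite -/ih -/ihS !delta_mul ?(inj_eq rev_ord_inj) 1?eq_sym // !(canF_eq rev_ordK).
have x_rev : rev_inv (fun i j : 'I_N => x i * (j == i)%:R).
  by move=> i j; rewrite /x xi_rev shiftz_rev (inj_eq rev_ord_inj).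
have x_ih : x ih = B ih ih.
  rewrite /x /shiftz -/ih -/ihS /e ![rev_ord ih == _]ord_eqF ?(ord_eqF (k := ih) (k' := ihS));
    rewrite ?rev_dimN ?ihE ?ihSE; lia.
have ltp_e f : ltp f e = R%:Z * \sum_(j : 'I_N | (j < ihS)%N) f j by apply: ltp_deltar.
have sum_e (P : pred 'I_N) : \sum_(j : 'I_N | P j) e j = R%:Z * (P ihS)%:R by apply: sum_deltar.
have := dA_double B; rewrite (eq_dim2 BE) dim2_shift // dim2_diag.
rewrite -/ih -/ihS ltp_deltar !ltp_e !sum_e sum_deltar ltnn ihE ihSE.
rewrite (eq_ltp (g' := fun l => R%:Z * (l == rev_ord ihS)%:R) (fun=> erefl)); last first.
  by move=> l; rewrite /e /= (canF_eq rev_ordK).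
rewrite ltp_deltar sum_e rev_dimN ihSE x_ih co_ih.
have -> : (h.-1 < h)%N by lia.
case: eqP => [->|_].
  by rewrite ltnn (_ : (n < n.*2 - n)%N = false); lia.
by rewrite mul0r; lia.
Qed.

Lemma dA_lower C : is_diag_mx (mxZ C - Etheta ihS ih *+ R) ->
  (dA C * 2 = R * co C ihS * 2 + (h == n) * (R * R.-1))%N.
Proof.
move=> diagC; have eq0 := lower_eq0 h_range diagC.
have co_ihS : co C ihS = C ihS ihS.
  rewrite ffunE (bigD1 ihS) //= big1 ?addn0 // => i; rewrite -val_eqE /= ihSE => iih.
  by apply: eq0; rewrite ?ihSE; lia.
(* A shift moves entries from row [ihS] up to row [ih]; the negative sign puts [R] at position (ihS,
   ih), and the diagonal part [x] absorbs the remaining entries. *)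
pose e := fun l : 'I_N => - R%:Z * (l == ih)%:R.
pose x i := (C i i)%:Z - shiftz h e i i.
have delta_mulN (i j p p' : 'I_N) : i != j ->
  ((i == p)%:R - (i == p')%:R) * (- R%:Z * (j == p)%:R) =
  (((i == p') && (j == p)) * R)%N%:Z.
  by move=> ij; rewrite mulNr mulrN -mulNr opprB delta_mul.
have CE : entryz C =2 (fun i j => x i * (j == i)%:R + shiftz h e i j).
  move=> i j; case: eqP => [->|/eqP ij]; first by rewrite mulr1 subrK.
  rewrite mulr0 add0r /entryz (diag_entry diagC) 1?eq_sym // PoszD /shiftz.
  by rewrite -/ih -/ihS !delta_mulN ?(inj_eq rev_ord_inj) 1?eq_sym // !(canF_eq rev_ordK).
have x_rev : rev_inv (fun i j : 'I_N => x i * (j == i)%:R).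
  by move=> i j; rewrite /x xi_rev shiftz_rev (inj_eq rev_ord_inj).
have x_ihS : x ihS = C ihS ihS.
  rewrite /x /shiftz -/ih -/ihS /e ![rev_ord ihS == ih]ord_eqF ?(ord_eqF (k := ihS) (k' := ih));
    rewrite ?rev_dimN ?ihE ?ihSE; lia.
have ltp_e f : ltp f e = - R%:Z * \sum_(j : 'I_N | (j < ih)%N) f j by apply: ltp_deltar.
have sum_e (P : pred 'I_N) : \sum_(j : 'I_N | P j) e j = - R%:Z * (P ih)%:R by apply: sum_deltar.
have := dA_double C; rewrite (eq_dim2 CE) dim2_shift // dim2_diag.
rewrite -/ih -/ihS ltp_deltar !ltp_e !sum_e sum_deltar ltnn ihE ihSE.
rewrite (eq_ltp (g' := fun l => - R%:Z * (l == rev_ord ih)%:R) (fun=> erefl)); last first.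
  by move=> l; rewrite /e /= (canF_eq rev_ordK).
rewrite ltp_deltar sum_e rev_dimN ihE x_ihS co_ihS.
have -> : (h.-1 < h)%N by lia.
have -> : (h.-1 < n.*2 - h.-1)%N by lia.
have -> : (h.-1 < n)%N by lia.
have : (R * R.-1)%N%:Z = R%:Z * R%:Z - R%:Z by rewrite PoszM; case: R => [|r] //=; lia.
by case: eqP => _; lia.
Qed.

End ChevalleyDimension.

(** * Comparison of the powers of v *)

Section ExponentSums.

Variable n : nat.
Local Notation N := (dimN n).
Implicit Types (f g : 'I_N -> int).

Lemma ltpNr f g : ltp f (fun u => - g u) = - ltp f g.
Proof. by rewrite -mulN1r -ltpZr; apply: eq_ltp => // u; rewrite mulN1r. Qed.

Lemma sum_le_ltp f g :
  \sum_j \sum_(l | (pos j <= pos l)%N) f l * g j = ltp g f + \sum_j f j * g j.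
Proof.
rewrite /ltp -big_split; apply: eq_bigr => j _ /=.
rewrite (bigD1 j) //= addrC; congr (_ + _); apply: eq_big => [l|l _]; last exact: mulrC.
by rewrite -val_eqE /pos /=; lia.
Qed.

Lemma sum_lt_ltp f g : \sum_j \sum_(l | (pos j < pos l)%N) f l * g j = ltp g f.
Proof. by apply: eq_bigr => j _; apply: eq_bigr => l _; rewrite mulrC. Qed.

Lemma sum_gt_ltp f g : \sum_j \sum_(l | (pos l < pos j)%N) f l * g j = ltp f g.
Proof. by rewrite (exchange_big_dep xpredT). Qed.

Lemma sum_ge_ltp f g :
  \sum_j \sum_(l | (pos l <= pos j)%N) f l * g j = ltp f g + \sum_j f j * g j.
Proof.
rewrite -sum_gt_ltp -big_split; apply: eq_bigr => j _ /=.
rewrite (bigD1 j) //= addrC; congr (_ + _); apply: eq_bigl => l.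
by rewrite -val_eqE /pos /=; lia.
Qed.

Lemma mul_sum_ltp f g :
  (\sum_j g j) * (\sum_l f l) = ltp g f + ltp f g + \sum_j f j * g j.
Proof.
rewrite addrAC -sum_le_ltp -sum_gt_ltp -big_split mulr_suml; apply: eq_bigr => j _.
rewrite mulr_sumr (bigID (fun l : 'I_N => (pos j <= pos l)%N)) /=.
by congr (_ + _); apply: eq_big => [l|l _]; rewrite 1?mulrC // -ltnNge.
Qed.

Definition lower_pairs f : int :=
  \sum_(j < N) \sum_(l < N | (j < l)%N && (j + l < n.*2)%N) f j * f l.

Lemma pos_lower_pairs f :
  \sum_j \sum_(l | (pos j < pos l)%N && (pos j + pos l < (dimN n).+1)%N) f j * f l =
  lower_pairs f.
Proof.
apply: eq_bigr => j _; apply: eq_bigl => l.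
by rewrite /pos; have NE : N = n.*2.+1 := erefl; lia.
Qed.

Lemma ltp_split_anti f : ltp f f = lower_pairs f +
  \sum_(j < N) \sum_(l < N | (j < l)%N && (n.*2 < j + l)%N) f j * f l +
  \sum_(j : 'I_N | (j < n)%N) f j * f (rev_ord j).
Proof.
rewrite [X in _ + X]big_mkcond -!big_split; apply: eq_bigr => j _ /=.
rewrite (bigID (fun l : 'I_N => (j + l < n.*2)%N)) /= -addrA; congr (_ + _).
rewrite (bigID (fun l : 'I_N => (n.*2 < j + l)%N)) /=; congr (_ + _).
  by apply: eq_bigl => l; lia.
have [jn|nj] := ltnP j n.
  rewrite (big_pred1 (rev_ord j)) // => l /=.
  by rewrite -val_eqE -[val (rev_ord j)]/(nat_of_ord _) rev_dimN /=; have := leq_dimN j; lia.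
by rewrite big1 // => l ?; exfalso; lia.
Qed.

Lemma flag_exp_ltp (a t : 'I_N -> nat) :
  (flag_exp a t)%:Z = ltp (fun j => (a j)%:Z) (fun j => (t j)%:Z).
Proof.
rewrite -sum_gt_ltp /flag_exp Posz_sum; apply: eq_bigr => u _.
rewrite PoszM /psum Posz_sum mulr_suml; apply: eq_bigr => l _.
by [].
Qed.

End ExponentSums.

Section ExponentIdentities.

Variables (n d h R : nat).
Local Notation N := (dimN n).
Implicit Types (A B C : Xi n d).
Hypothesis h_range : (1 <= h <= n)%N.

Let ih := idx n h.
Let ihS := idx n h.+1.

Variable t : tvec n R.
Hypothesis t_sum : sum_is t.
Let s (u : 'I_N) : int := (t u : nat)%:Z.

Lemma shift_shiftz (k l : 'I_N) : shift h t k l = shiftz h s k l.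
Proof.
rewrite shiftE // /shiftz -!val_eqE /=.
by rewrite !idx_val //; lia.
Qed.

Lemma dA_addshift A A'' : mxZ A'' = mxZ A + shift h t ->
  (dA A'')%:Z *+ 2 = (dA A)%:Z *+ 2 +
    (ltp (entryz A ih) s - ltp s (entryz A ihS) + ltp s s) *+ 2 +
    (h == n)%:R * (ltp s (s \o @rev_ord N) + \sum_(j : 'I_N | (j < n)%N) s j).
Proof.
move=> A''E; rewrite !dA_double -dim2_shift //; last exact: entryz_rev.
apply: eq_dim2 => i j; have := congr1 (fun M : 'M_N => M i j) A''E.
by rewrite !mxE shift_shiftz.
Qed.

Lemma dA_subshift A A'' : mxZ A = mxZ A'' + shift h t ->
  (dA A'')%:Z *+ 2 = (dA A)%:Z *+ 2 +
    (- ltp (entryz A ih) s + ltp s (entryz A ihS) + ltp s s) *+ 2 +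
    (h == n)%:R * (ltp s (s \o @rev_ord N) - \sum_(j : 'I_N | (j < n)%N) s j).
Proof.
move=> AE; pose s' u := - s u.
rewrite !dA_double.
have -> : dim2 (entryz A'') = dim2 (fun i j => entryz A i j + shiftz h s' i j).
  apply: eq_dim2 => i j; have := congr1 (fun M : 'M_N => M i j) AE.
  by rewrite !mxE shift_shiftz shiftzN /entryz => ->; rewrite addrK.
rewrite dim2_shift //; last exact: entryz_rev.
have -> : ltp s' (s' \o @rev_ord N) = ltp s (s \o @rev_ord N).
  by rewrite -[RHS]opprK -ltpNr -ltpNl.
by rewrite /s' !ltpNl !ltpNr !opprK sumrN.
Qed.

Let sum_s : \sum_u s u = R%:Z.
Proof. by rewrite -(eqP t_sum) Posz_sum. Qed.

Let dA_upper_ltp A B : is_diag_mx (mxZ B - Etheta ih ihS *+ R) -> ro A = co B ->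
  (dA B)%:Z = ltp s (entryz A ih) + ltp (entryz A ih) s + \sum_j entryz A ih j * s j.
Proof.
move=> diagB roco; rewrite (dA_upper h_range diagB) -roco ffunE PoszM -sum_s Posz_sum.
exact: mul_sum_ltp.
Qed.

Let dA_lower_ltp A C : is_diag_mx (mxZ C - Etheta ihS ih *+ R) -> co C = ro A ->
  (dA C)%:Z *+ 2 = (ltp s (entryz A ihS) + ltp (entryz A ihS) s +
    \sum_j entryz A ihS j * s j) *+ 2 + (h == n)%:R * (R * R.-1)%N%:Z.
Proof.
move=> diagC coro; rewrite -mul_sum_ltp sum_s.
have := dA_lower h_range diagC; rewrite -/ihS coro ffunE => dC.
have -> : \sum_j entryz A ihS j = (\sum_j A ihS j)%N%:Z by rewrite Posz_sum.
by case: eqP dC => _ dC; lia.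
Qed.

Let sum_gt_self : \sum_(j < N) \sum_(l | (pos l < pos j)%N) s j * s l = ltp s s.
Proof.
rewrite -sum_gt_ltp; apply: eq_bigr => j _; apply: eq_bigr => l _.
exact: mulrC.
Qed.

Let dot (a : 'I_N) A : int := \sum_j entryz A a j * s j.

Let sum_mul_dot (a : 'I_N) A : (\sum_u A a u * t u)%N%:Z = dot a A.
Proof. by rewrite Posz_sum; apply: eq_bigr => u _; rewrite PoszM. Qed.

Lemma beta_ltp A : beta h A t *+ 2 =
  (ltp s (entryz A ih) + dot ih A - ltp s (entryz A ihS) + ltp s s) *+ 2 +
  (h == n)%:R * (ltp s (s \o @rev_ord N) + \sum_(j : 'I_N | (j < n)%N) s j).
Proof.
have -> : beta h A t = ltp s (entryz A ih) + dot ih A - ltp s (entryz A ihS) + ltp s s +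
    (h == n)%:R * (lower_pairs s +
      \sum_(j | (pos j < n.+1)%N) ((t j * (t j).+1) %/ 2)%N%:Z).
  by rewrite natz /beta sum_le_ltp sum_lt_ltp pos_lower_pairs.
have half : (\sum_(j | (pos j < n.+1)%N) ((t j * (t j).+1) %/ 2)%N%:Z) *+ 2 =
    \sum_(j : 'I_N | (j < n)%N) s j ^+ 2 + \sum_(j : 'I_N | (j < n)%N) s j.
  rewrite -sumrMnl -big_split; apply: eq_bigr => j _ /=; rewrite /s.
  have := bin2_double (t j).+1; rewrite bin2 /= divn2 mulnC => ->.
  by rewrite -addn1 PoszD; ring.
rewrite mulrnDl; congr (_ + _); rewrite -mulrnAr; congr (_ * _).
by rewrite mulrnDl half ltp_anti_diag addrA.
Qed.

Lemma beta'_ltp A : beta' h A t =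
  ltp (entryz A ihS) s + dot ihS A - ltp (entryz A ih) s + ltp s s.
Proof. by rewrite /beta' sum_ge_ltp sum_gt_self sum_gt_ltp. Qed.

Lemma beta''_ltp A : h = n -> beta'' A t *+ 2 =
  (ltp (entryz A ihS) s + dot ihS A - ltp (entryz A ih) s + ltp s s) *+ 2 -
  (ltp s (s \o @rev_ord N) - \sum_(j : 'I_N | (j < n)%N) s j) + (R * R.-1)%N%:Z.
Proof.
move=> hn.
have -> : beta'' A t = ltp (entryz A ihS) s + dot ihS A - ltp (entryz A ih) s + ltp s s -
   lower_pairs s - \sum_(j | (pos j < n.+1)%N) ((t j * (t j).-1) %/ 2)%N%:Z +
   ((R * R.-1) %/ 2)%N%:Z.
  by rewrite /beta'' sum_ge_ltp sum_gt_self sum_gt_ltp pos_lower_pairs /dot /ihS /ih hn.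
have half : (\sum_(j | (pos j < n.+1)%N) ((t j * (t j).-1) %/ 2)%N%:Z) *+ 2 =
    \sum_(j : 'I_N | (j < n)%N) s j ^+ 2 - \sum_(j : 'I_N | (j < n)%N) s j.
  rewrite -sumrMnl -sumrB; apply: eq_bigr => j _ /=; rewrite /s.
  by rewrite -bin2_double bin2 divn2.
have halfR : ((R * R.-1) %/ 2)%N%:Z *+ 2 = (R * R.-1)%N%:Z.
  by case: (R) => [|r] //=; have := oddM r.+1 r; lia.
rewrite mulrnDl halfR !mulrnBl half ltp_anti_diag -/(lower_pairs s).
by ring.
Qed.

(** The coefficient of [A''] carries v^(d_A'' - d_B - d_A) times the structure polynomial. The
    doubled term removes from [beta] the powers already present in the barred binomials and in
    [linear_count]. *)
Lemma exponent_upper A A'' B :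
  is_diag_mx (mxZ B - Etheta ih ihS *+ R) -> ro A = co B ->
  mxZ A'' = mxZ A + shift h t ->
  (dA B)%:Z + (dA A)%:Z + beta h A t = (dA A'')%:Z +
    (2 * (flag_exp (fun u => t u : nat) (A ih) + \sum_u A ih u * t u))%N%:Z.
Proof.
move=> diagB roco A''E; have dB := dA_upper_ltp diagB roco; have dA'' := dA_addshift A''E.
rewrite PoszM PoszD flag_exp_ltp sum_mul_dot -/s -/(entryz A ih).
have betaE := beta_ltp A; rewrite -/(dot ih A) in dB.
move: dB dA'' betaE; move: (ltp s (entryz A ih)) ((h == n)%:R * _) => ? ?.
by lia.
Qed.

Lemma exponent_lower A A'' C : (h < n)%N ->
  is_diag_mx (mxZ C - Etheta ihS ih *+ R) -> co C = ro A ->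
  mxZ A = mxZ A'' + shift h t ->
  (dA C)%:Z + (dA A)%:Z + beta' h A t = (dA A'')%:Z +
    (2 * (flag_exp (A ihS) (fun u => t u : nat) + \sum_u A ihS u * t u))%N%:Z.
Proof.
move=> hn diagC coro AE; have dC := dA_lower_ltp diagC coro; have dA'' := dA_subshift AE.
have hnF : (h == n) = false by lia.
rewrite PoszM PoszD flag_exp_ltp sum_mul_dot -/s -/(entryz A ihS) beta'_ltp.
rewrite -/(dot ihS A) hnF !mul0r in dC dA''.
by lia.
Qed.

(** Beyond the linear case, the reflected t in the tops of the barred binomials gives the products
    t_u t_(N+1-u), and the barred quotients of the middle factor give t(t-1) at the middle index. *)
Lemma exponent_lower_mid A A'' C : h = n ->
  is_diag_mx (mxZ C - Etheta ihS ih *+ R) -> co C = ro A ->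
  mxZ A = mxZ A'' + shift h t ->
  (dA C)%:Z + (dA A)%:Z + beta'' A t = (dA A'')%:Z +
    (2 * (isotropic_exp (A ihS) (fun u => t u : nat) + \sum_u A ihS u * t u +
          \sum_(u : 'I_N | (u < n)%N) t u * t (rev_ord u) + 'C(t ihS, 2)))%N%:Z.
Proof.
move=> hn diagC coro AE; have dC := dA_lower_ltp diagC coro; have dA'' := dA_subshift AE.
move: (dA C) (dA A) (dA A'') dC dA'' => dc da da'' dC dA''.
rewrite PoszM /isotropic_exp !PoszD flag_exp_ltp sum_mul_dot -/s -/(entryz A ihS).
have upper_pairs : (\sum_(j < N) \sum_(l < N | (j < l) && (n.*2 < j + l)) t j * t l)%N%:Z =
    \sum_(j < N) \sum_(l < N | (j < l)%N && (n.*2 < j + l)%N) s j * s l.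
  rewrite Posz_sum; apply: eq_bigr => j _; rewrite Posz_sum.
  by apply: eq_bigr => l _; rewrite PoszM.
have anti_pairs : (\sum_(u : 'I_N | (u < n)%N) t u * t (rev_ord u))%N%:Z =
    \sum_(u : 'I_N | (u < n)%N) s u * s (rev_ord u).
  by rewrite Posz_sum; apply: eq_bigr => u _; rewrite PoszM.
have RR : (R * R.-1)%N%:Z = R%:Z * R%:Z - R%:Z.
  by rewrite PoszM; case: (R) => [|r] //=; lia.
have bin_s (P : pred 'I_N) : (\sum_(u : 'I_N | P u) 'C(t u, 2))%N%:Z *+ 2 =
    \sum_(u : 'I_N | P u) s u * s u - \sum_(u : 'I_N | P u) s u.
  by rewrite Posz_sum -sumrMnl -sumrB; apply: eq_bigr => u _; rewrite bin2_double expr2.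
have split_mid (F : 'I_N -> int) : \sum_u F u =
    \sum_(u : 'I_N | (u < n)%N) F u + \sum_(u : 'I_N | (n < u)%N) F u + F ihS.
  rewrite (bigD1 ihS) //= addrC; congr (_ + _).
  have mid (u : 'I_N) : (u != ihS) = (nat_of_ord u != n).
    by rewrite -val_eqE /= /ihS idx_val hn //; lia.
  rewrite (bigID (fun u : 'I_N => (u < n)%N)) /=.
  by congr (_ + _); apply: eq_bigl => u; rewrite mid; lia.
have RRs := mul_sum_ltp s s; rewrite sum_s in RRs.
have := ltp_split_anti s; have := ltp_anti_diag s; rewrite -/(lower_pairs s).
have := bin_s (fun u => n < u)%N; have := bin2_double (t ihS); rewrite -/(s ihS) expr2.
have := beta''_ltp A hn; have := split_mid s; have /= := split_mid (fun u => s u * s u).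
rewrite -/(dot ihS A) hn eqxx !mul1r in dC dA''; rewrite sum_s upper_pairs anti_pairs RR in dC *.
have -> : \sum_(u : 'I_N | (u < n)%N) s u ^+ 2 = \sum_(u : 'I_N | (u < n)%N) s u * s u by [].
move: RRs dC dA''; rewrite !mulr2n.
(* After all the expansions the identity is linear in the sums involved, here replaced by
   independent variables. *)
have combine (las sa_h lsr lss L H Q D lsa S2 S2lo S2up slo sup sm sm2 RR' R' dc' da' da2 be : int)
    (B C2 : nat) :
  RR' = lss + lss + S2 ->
  dc' + dc' = lsa + las + D + (lsa + las + D) + (RR' - R') ->
  da2 + da2 = da' + da' + (- sa_h + lsa + lss + (- sa_h + lsa + lss)) + (lsr - slo) ->
  S2 = S2lo + S2up + sm2 -> R' = slo + sup + sm ->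
  be + be = las + D - sa_h + lss + (las + D - sa_h + lss) - (lsr - slo) + (RR' - R') ->
  C2%:Z + C2%:Z = sm2 - sm -> B%:Z + B%:Z = S2up - sup ->
  lsr = L + L + S2lo -> lss = L + H + Q ->
  dc' + da' + be = da2 + 2 * (las + B%:Z + H + D + Q + C2%:Z) by clear; lia.
exact: combine.
Qed.

End ExponentIdentities.

(** * Products in the standard basis *)

Section CountValues.

Implicit Types (n : nat).

Let mul_shift (F : fieldType) (x p1 p2 : F) (k1 k2 : nat) :
  (x ^- (2 * k1) * p1) * (x ^- (2 * k2) * p2) = x ^- (2 * (k1 + k2)) * (p1 * p2).
Proof. by rewrite mulnDr exprD invfM mulrACA. Qed.

Lemma prod_bar_qbinom n (P : pred 'I_n) (a t : 'I_n -> nat) :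
  \prod_(u | P u) bar (qbinom (a u + t u)%N (t u)) =
  vv ^- (2 * (\sum_(u | P u) a u * t u)) *
    polyv2 (\prod_(u | P u) gaussp (a u + t u) (t u)).
Proof.
apply: (big_ind3 (fun (x : Qv) k G => x = vv ^- (2 * k) * polyv2 G)).
- by rewrite muln0 expr0 invr1 mul1r (rmorph1 polyv2).
- by move=> x1 k1 G1 x2 k2 G2 -> ->; rewrite (rmorphM polyv2) mul_shift.
by move=> u _; apply: bar_qbinom.
Qed.

Let mul_exprz (F : fieldType) (x p : F) (b : int) (k m : nat) : x != 0 ->
  x ^ b * (x ^- k * p) = x ^ (b - (k + m)%N%:Z) * (p * x ^+ m).
Proof.
move=> x0; rewrite PoszD opprD addrA !expfzDr // -!exprnN -!mulrA; congr (_ * (_ * _)).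
by rewrite mulrCA mulVf ?mulr1 // expf_neq0.
Qed.

Lemma linear_count_value n (b : int) (a t : 'I_n -> nat) :
  vv ^ b * \prod_u bar (qbinom (a u + t u)%N (t u)) =
  vv ^ (b - (2 * (flag_exp a t + \sum_u a u * t u))%N%:Z) *
    polyv2 (linear_count a t).
Proof.
rewrite prod_bar_qbinom (mul_exprz _ _ _ (2 * flag_exp a t) vv_neq0).
by rewrite -polyv2Xn -(rmorphM polyv2) -mulnDr addnC.
Qed.

(** Symmetry of the binomials reconciles the exchanged arguments of [struct_poly_upper] with the t_u
    at the bottom of the stated binomials; only the exponent [flag_exp] depends on the order. *)
Lemma linear_count_transpose n (a t : 'I_n -> nat) (b : int) :
  vv ^ b * \prod_u bar (qbinom (a u + t u)%N (t u)) =
  vv ^ (b - (2 * (flag_exp t a + \sum_u a u * t u))%N%:Z) *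
    polyv2 (linear_count t a).
Proof.
rewrite prod_bar_qbinom (mul_exprz _ _ _ (2 * flag_exp t a) vv_neq0).
rewrite -polyv2Xn -(rmorphM polyv2) -mulnDr addnC /linear_count.
congr (_ * polyv2 (_ * _)); apply: eq_bigr => u _.
by rewrite -gaussp_sym addnC.
Qed.

Let mul_exprz3 (F : fieldType) (x p1 p2 p3 : F) (b : int) (k1 k2 k3 m : nat) : x != 0 ->
  x ^ b * (x ^- k1 * p1) * (x ^- k2 * p2) * (x ^- k3 * p3) =
    x ^ (b - (k1 + k2 + k3 + m)%N%:Z) * (p1 * p2 * p3 * x ^+ m).
Proof.
move=> x0; rewrite -mul_exprz // -!mulrA; congr (_ * _); rewrite !exprD !invfM.
move: (x ^- k1) (x ^- k2) (x ^- k3) => y1 y2 y3; ring.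
Qed.

Lemma isotropic_count_value n (b : int) (a t : 'I_(dimN n) -> nat) :
  let mid := idx n n.+1 in odd (a mid) ->
  vv ^ b * \prod_(u | (pos u < n.+1)%N) bar (qbinom (a u + t u + t (rev_ord u))%N (t u)) *
    \prod_(u | (n.+1 < pos u)%N) bar (qbinom (a u + t u)%N (t u)) *
    \prod_(0 <= i < t mid) (bar (qint (a mid + 1 + 2 * i)%N) / bar (qint i.+1)) =
  vv ^ (b - (2 * (isotropic_exp a t + \sum_u a u * t u +
    \sum_(u : 'I_(dimN n) | (u < n)%N) t u * t (rev_ord u) + 'C(t mid, 2)))%N%:Z) *
    polyv2 (isotropic_count a t).
Proof.
move=> mid a_odd; rewrite bar_prod_qint // (prod_bar_qbinom (fun u => n.+1 < pos u)%N).
have -> : \prod_(u | (pos u < n.+1)%N) bar (qbinom (a u + t u + t (rev_ord u))%N (t u)) =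
    \prod_(u | (pos u < n.+1)%N) bar (qbinom (a u + t (rev_ord u) + t u)%N (t u)).
  by apply: eq_bigr => u _; rewrite addnAC.
rewrite (prod_bar_qbinom (fun u => pos u < n.+1)%N (fun u => a u + t (rev_ord u))%N).
rewrite (mul_exprz3 _ _ _ _ _ _ _ (2 * isotropic_exp a t) vv_neq0).
rewrite -polyv2Xn -!(rmorphM polyv2); congr (vv ^ (b - _%:Z) * polyv2 (_ * _ * _ * _)).
  have mid_sum : (\sum_u a u * t u = \sum_(u : 'I_(dimN n) | u < n) a u * t u +
      \sum_(u : 'I_(dimN n) | n < u) a u * t u + a mid * t mid)%N.
    rewrite (bigD1 mid) //= addnC; congr (_ + _)%N.
    have is_mid (u : 'I_(dimN n)) : (u != mid) = (nat_of_ord u != n).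
      by rewrite -val_eqE /= /mid idx_val //; lia.
    rewrite (bigID (fun u : 'I_(dimN n) => u < n)%N) /=.
    by congr (_ + _)%N; apply: eq_bigl => u; rewrite is_mid; lia.
  rewrite mid_sum; under eq_bigr => u _ do rewrite mulnDl.
  rewrite big_split /=.
  have -> : (\sum_(u | pos u < n.+1) t (rev_ord u) * t u =
      \sum_(u : 'I_(dimN n) | u < n) t u * t (rev_ord u))%N.
    by apply: eq_bigr => u _; rewrite mulnC.
  have -> : (\sum_(u | pos u < n.+1) a u * t u =
      \sum_(u : 'I_(dimN n) | u < n) a u * t u)%N by [].
  have -> : (\sum_(u | n.+1 < pos u) a u * t u =
      \sum_(u : 'I_(dimN n) | n < u) a u * t u)%N by [].
  have : ('C(t mid, 2) * 2 = t mid * (t mid).-1)%N.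
    by rewrite bin2 -divn2 divnK // dvdn2; case: (t mid) => //= m; rewrite oddM /=; case: odd.
  move: ('C(t mid, 2)) (t mid * (t mid).-1)%N (a mid * t mid)%N (isotropic_exp a t) => c tt m e.
  move: (\sum_(u : 'I_(dimN n) | u < n) a u * t u)%N (\sum_(u : 'I_(dimN n) | n < u) a u * t u)%N.
  move: (\sum_(u : 'I_(dimN n) | u < n) t u * t (rev_ord u))%N => s1 s2 s3; lia.
by apply: eq_bigr => u _; rewrite addnAC.
Qed.

End CountValues.

Section Products.

Variables (n d : nat).
Local Notation N := (dimN n).
Implicit Types (A B C : Xi n d).

Lemma vpowD (i j : int) : vpow i * vpow j = vpow (i + j).
Proof. by apply: val_inj; rewrite /= -expfzDr // vv_neq0. Qed.

Lemma mxZ_inj : injective (@mxZ n d).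
Proof.
move=> A B AB; apply/val_inj/matrixP => i j; apply/val_inj.
by have := congr1 (fun M : 'M_N => M i j) AB; rewrite !mxE => -[].
Qed.

Lemma std_coef A A' : std A A' = (A' == A)%:R * vpow (- (dA A)%:Z).
Proof. by rewrite /std !ffunE mulrC. Qed.

Lemma std_mx_coef (M : 'M_N) A : std_mx d M A = (mxZ A == M)%:R * vpow (- (dA A)%:Z).
Proof.
rewrite /std_mx sum_ffunE; case: eqP => [<-|AM].
  rewrite (big_pred1 A) => [|B /=]; first by rewrite std_coef eqxx.
  by rewrite (inj_eq mxZ_inj).
rewrite mul0r big1 // => B /eqP BM; rewrite std_coef.
by case: eqP => [AB|_]; rewrite ?mul0r //; case: AM; rewrite AB.
Qed.

Lemma Sj_mul_std A B C :
  Sj_mul (std B) (std A) C = vpow (- (dA B)%:Z - (dA A)%:Z) * struct_const B A C.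
Proof.
rewrite /Sj_mul sum_ffunE (bigD1 B) //= [X in _ + X]big1 ?addr0 => [|B' BB']; last first.
  rewrite sum_ffunE big1 // => A' _; rewrite ffunE !std_coef (negbTE BB') !mul0r.
  exact: scale0r.
rewrite sum_ffunE (bigD1 A) //= [X in _ + X]big1 ?addr0 => [|A' AA']; last first.
  by rewrite ffunE !std_coef (negbTE AA') mul0r mulr0; apply: scale0r.
rewrite ffunE !std_coef !eqxx !mul1r vpowD sum_ffunE; congr (_ * _).
rewrite (bigD1 C) //= [X in _ + X]big1 ?addr0 => [|C' CC'].
  by rewrite !ffunE eqxx; apply: mulr1.
by rewrite !ffunE eq_sym (negbTE CC'); apply: mulr0.
Qed.

(** The barred products are elements of Q(v); this form of the coefficients exhibits them in the
    Laurent ring. *)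
Definition laurent_term (e : int) (G : {poly int}) : laurent :=
  vpow e * (map_poly intr G).[vpow 2].

Lemma laurent_termE e G : laurent_val (laurent_term e G) = vv ^ e * polyv2 G.
Proof. by rewrite -laurent_val_horner. Qed.

(** The two sides are compared at each [A'']. Injectivity of [M] leaves at most one [t] with
    [mxZ A'' = M t]; without such a [t] both sides vanish, the structure polynomial being 0. *)
Lemma Sj_mul_std_sum R A B (P : pred (tvec n R)) (M : tvec n R -> 'M[int]_N)
    (e : tvec n R -> int) (G : tvec n R -> {poly int}) :
  (forall t, P t -> sum_is t) -> injective M ->
  (forall A'' t, sum_is t -> mxZ A'' = M t ->
    [/\ P t, is_struct_poly B A A'' (G t) &
      e t - (dA A'')%:Z = - (dA B)%:Z - (dA A)%:Z]) ->
  (forall A'', (forall t, sum_is t -> mxZ A'' <> M t) -> is_struct_poly B A A'' 0) ->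
  Sj_mul (std B) (std A) =
    \sum_(t : tvec n R | P t) laurent_term (e t) (G t) *: std_mx d (M t).
Proof.
move=> P_sum M_inj yes no; apply/ffunP => A''; rewrite Sj_mul_std sum_ffunE.
have termE t : (laurent_term (e t) (G t) *: std_mx d (M t)) A'' =
    laurent_term (e t) (G t) * ((mxZ A'' == M t)%:R * vpow (- (dA A'')%:Z)).
  by rewrite ffunE std_mx_coef.
rewrite (eq_bigr _ (fun t _ => termE t)) /struct_const.
have [/existsP[t /andP[Pt /eqP A''E]]|] := boolP [exists t, P t && (mxZ A'' == M t)].
  have [_ GP eE] := yes A'' t (P_sum t Pt) A''E.
  rewrite [RHS](bigD1 t) //= [X in _ = _ + X]big1 ?addr0 => [|t' /andP[_ tt']]; last first.
    by rewrite A''E (inj_eq M_inj) eq_sym (negbTE tt') mul0r mulr0.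
  rewrite A''E eqxx mul1r (struct_polyE GP) /laurent_term mulrAC vpowD eE.
  by [].
rewrite negb_exists => /forallP none.
rewrite (struct_polyE (no A'' _)) => [|t t_sum A''E]; last first.
  by have [Pt _ _] := yes A'' t t_sum A''E; have := none t; rewrite Pt A''E eqxx.
rewrite rmorph0 horner0 mulr0 big1 // => t Pt.
by have := none t; rewrite Pt /= => /negbTE->; rewrite mul0r mulr0.
Qed.

End Products.

Section Shifts.

Variables (n h R : nat).
Local Notation N := (dimN n).
Hypothesis h_range : (1 <= h <= n)%N.

Lemma shift_row_idx (t : tvec n R) l : shift h t (idx n h) l = (t l : nat)%:Z.
Proof.
rewrite shiftE // rev_dimN idx_val; last by lia.
have -> : (h.-1 == h) = false by lia.
have -> : (n.*2 - h.-1 == h.-1)%N = false by lia.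
have -> : (n.*2 - h.-1 == h)%N = false by lia.
by rewrite eqxx; lia.
Qed.

Lemma shift_inj : injective (@shift n R h).
Proof.
move=> t t' tt'; apply/ffunP => l; apply/val_inj/eqP.
by rewrite -eqz_nat -[X in X == _]shift_row_idx -[X in _ == X]shift_row_idx tt'.
Qed.

Variable d : nat.
Implicit Types A : Xi n d.

(** Nonnegativity of row h+1 of [A'']; for [h = n] this row is its own mirror image and loses both
    t_u and its reflection. *)
Lemma range_a_shift A A'' (t : tvec n R) : sum_is t -> mxZ A'' = mxZ A + shift h t ->
  range_a h A t.
Proof.
move=> t_sum A''E; rewrite /range_a t_sum; case: ltnP => hn.
  apply/forallP => u; have := shift_row h_range A''E (k := idx n h.+1) u.
  rewrite idx_val; last by lia.
  by rewrite eqxx (_ : (h == h.-1) = false); lia.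
apply/forallP => u; have := congr1 (fun M : 'M_N => M (idx n h.+1) u) A''E.
rewrite !mxE shiftE // rev_dimN idx_val; last by lia.
have -> : (h.+1.-1 == h.-1) = false by lia.
have -> : (n.*2 - h.+1.-1 == h.-1)%N = false by lia.
have -> : (n.*2 - h.+1.-1 == h)%N by lia.
by rewrite eqxx; lia.
Qed.

Lemma range_b_shift A A'' (t : tvec n R) : sum_is t -> mxZ A = mxZ A'' + shift h t ->
  range_b h A t.
Proof.
move=> t_sum AE; rewrite /range_b t_sum; apply/forallP => u.
have := congr1 (fun M : 'M_N => M (idx n h) u) AE.
by rewrite !mxE shift_row_idx => /eqP; rewrite eqz_nat => /eqP->; apply: leq_addl.
Qed.

End Shifts.

Theorem theorem3p7 (n d h R : nat)
    (n_ge1 : (1 <= n)%N) (d_ge1 : (1 <= d)%N) (h_range : (1 <= h <= n)%N) :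
  (forall A B : Xi n d,
     is_diag_mx (mxZ B - Etheta (idx n h) (idx n h.+1) *+ R) ->
     ro A = co B ->
     exists2 c : tvec n R -> laurent,
       forall t, range_a h A t ->
         laurent_val (c t) =
           vv ^ beta h A t *
           \prod_u bar (qbinom (A (idx n h) u + t u)%N (t u))
     & Sj_mul (std B) (std A) =
         \sum_(t : tvec n R | range_a h A t)
           c t *: std_mx d (mxZ A + shift h t))
  /\
  (forall A C : Xi n d,
     is_diag_mx (mxZ C - Etheta (idx n h.+1) (idx n h) *+ R) ->
     co C = ro A ->
     ((h < n)%N ->
      exists2 c : tvec n R -> laurent,
        forall t, range_b h A t ->
          laurent_val (c t) =
            vv ^ beta' h A t *
            \prod_u bar (qbinom (A (idx n h.+1) u + t u)%N (t u))
      & Sj_mul (std C) (std A) =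
          \sum_(t : tvec n R | range_b h A t)
            c t *: std_mx d (mxZ A - shift h t))
     /\
     (h = n ->
      exists2 c : tvec n R -> laurent,
        forall t, range_b h A t ->
          laurent_val (c t) =
            vv ^ beta'' A t *
            \prod_(u | (pos u < n.+1)%N)
               bar (qbinom (A (idx n n.+1) u + t u + t (rev_ord u))%N (t u)) *
            \prod_(u | (n.+1 < pos u)%N)
               bar (qbinom (A (idx n n.+1) u + t u)%N (t u)) *
            \prod_(0 <= i < t (idx n n.+1))
               (bar (qint (A (idx n n.+1) (idx n n.+1) + 1 + 2 * i)%N) /
                bar (qint i.+1))
      & Sj_mul (std C) (std A) =
          \sum_(t : tvec n R | range_b h A t)
            c t *: std_mx d (mxZ A - shift n t))).
Proof.
have balance (x y a b c : int) : b + a + x = c + y -> x - y - c = - b - a by lia.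
split=> [A B diagB roco|A C diagC coro].
  pose a := A (idx n h) : 'I_(dimN n) -> nat; pose s (t : tvec n R) u : nat := t u.
  exists (fun t => laurent_term
    (beta h A t - (2 * (flag_exp (s t) a + \sum_u a u * s t u))%N%:Z) (linear_count (s t) a)).
    by move=> t _; rewrite laurent_termE -(linear_count_transpose a (s t)).
  apply: Sj_mul_std_sum => [t /andP[]|t t' /addrI|A'' t t_sum A''E|A'' none] //.
  - exact: shift_inj.
  - split; first exact: range_a_shift A''E.
      exact: struct_poly_upper A''E.
    exact: balance (exponent_upper h_range t_sum diagB roco A''E).
  exact: struct_poly_upper0 diagB _.
have M_inj : injective (fun t : tvec n R => mxZ A - shift h t).
  by move=> t t' /addrI /oppr_inj; apply: shift_inj.
(* The lower generator subtracts a shift, so the results on shifts apply with [A] and [A'']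
   exchanged. *)
have addM A'' t : mxZ A'' = mxZ A - shift h t -> mxZ A = mxZ A'' + shift h t.
  by move=> ->; rewrite subrK.
have none_sub A'' : (forall t : tvec n R, sum_is t -> mxZ A'' <> mxZ A - shift h t) ->
    is_struct_poly C A A'' 0.
  move=> none; apply: (struct_poly_lower0 h_range diagC) => t t_sum AE.
  by apply: (none t t_sum); rewrite AE addrK.
split=> [hn|hn].
  pose a := A (idx n h.+1) : 'I_(dimN n) -> nat; pose s (t : tvec n R) u : nat := t u.
  exists (fun t => laurent_term
    (beta' h A t - (2 * (flag_exp a (s t) + \sum_u a u * s t u))%N%:Z) (linear_count a (s t))).
    by move=> t _; rewrite laurent_termE -(linear_count_value _ a (s t)).
  apply: Sj_mul_std_sum => [t /andP[]|//|A'' t t_sum /addM AE|//] //.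
  split; first exact: range_b_shift AE.
    exact: struct_poly_lower (esym coro) t_sum AE hn.
  exact: balance (exponent_lower h_range t_sum hn diagC coro AE).
pose a := A (idx n n.+1) : 'I_(dimN n) -> nat; pose s (t : tvec n R) u : nat := t u.
exists (fun t => laurent_term
  (beta'' A t - (2 * (isotropic_exp a (s t) + \sum_u a u * s t u +
    \sum_(u : 'I_(dimN n) | (u < n)%N) s t u * s t (rev_ord u) +
    'C(s t (idx n n.+1), 2)))%N%:Z) (isotropic_count a (s t))).
  by move=> t _; rewrite laurent_termE -(isotropic_count_value _ (s t)) //; apply: xi_center_odd.
rewrite -[X in shift X]hn; apply: Sj_mul_std_sum => [t /andP[]|//|A'' t t_sum /addM AE|//] //.
split; first exact: range_b_shift AE.
  exact: struct_poly_lower_mid (esym coro) t_sum AE hn.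
have := exponent_lower_mid h_range t_sum hn diagC coro AE; rewrite hn.
exact: balance.
Qed.
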